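(* Let $p$ be a prime with $p \equiv \pm 1$ or $\pm 9 \pmod{40}$, such that $1+\sqrt 5$ or $1-\sqrt 5$ is a square modulo $p$. Let $\mathcal Q$ be a finite locally spherical directly regular $4$-polytope of type $\{5,3,4\}$ such that $p(p^{2}-1)$ does not divide $|\Gamma(\mathcal{Q})|$. Then there exists a locally spherical chiral $4$-polytope of type $\{5,3,4\}$ whose automorphism group is isomorphic to $L_{2}(p)\times\Gamma^{+}(\mathcal{Q})$.
   Context: An abstract $n$-polytope is a ranked poset (ranks $-1,\dots,n$) with a least and a greatest face, all flags of size $n+2$, strongly flag-connected, and satisfying the diamond condition; $\Gamma(\mathcal P)$ is its automorphism group. $\mathcal P$ is regular if $\Gamma(\mathcal P)$ is flag-transitive, and chiral if $\Gamma(\mathcal P)$ has exactly two flag orbits with adjacent flags always in distinct orbits. For regular $\mathcal P$, $\Gamma(\mathcal P)$ is generated by involutions $\rho_0,\dots,\rho_{n-1}$ ($\rho_i$ maps a base flag to its $i$-adjacent flag); the rotation subgroup $\Gamma^+(\mathcal P)$ is generated by $\sigma_i=\rho_{i-1}\rho_i$, has index at most $2$, and $\mathcal P$ is directly regular if the index is $2$. The type $\{p_1,\dots,p_{n-1}\}$ records the orders of the (rotation) generators $\sigma_i$. A $4$-polytope is locally spherical if its facets and vertex-figures are spherical maps. Here $\sqrt5$ denotes a square root of $5$ modulo $p$ (which exists under the congruence condition). $L_2(p)=PSL_2(p)$. *)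

(* Defs.v *)
From HB Require Import structures.
From mathcomp Require Import all_boot all_order all_algebra all_fingroup all_solvable.
From mathcomp Require Import boolp classical_sets reals topology normedtype.

Set Implicit Arguments.
Unset Strict Implicit.
Unset Printing Implicit Defensive.

Import Order.TTheory GRing.Theory Num.Theory.
Import numFieldNormedType.Exports.

Local Open Scope ring_scope.

Section Flags.
Variables (d : Order.disp_t) (T : finPOrderType d).
Implicit Types (C Phi Psi : {set T}).

Definition chain C : bool := [forall x in C, forall y in C, (x >=< y)%O].

Definition flags : {set {set T}} := [set Phi | maxset chain Phi].

Definition adjacent Phi Psi : bool :=
  (#|Phi :\: Psi| == 1%N) && (#|Psi :\: Phi| == 1%N).

(* Joinable by successively adjacent flags, all containing Phi :&: Psi. *)
Definition strongly_joined Phi Psi : bool :=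
  connect [rel A B : {set T} |
    [&& A \in flags, B \in flags, adjacent A B,
        Phi :&: Psi \subset A & Phi :&: Psi \subset B]] Phi Psi.

End Flags.
Arguments flags {d} T.

(* Finite abstract n-polytopes.  Finiteness loses nothing for regular or chiral
   polytopes with finite automorphism group, since automorphisms act freely on
   flags. *)
Record polytope (n : nat) := Polytope {
  face_disp : Order.disp_t;
  face :> finPOrderType face_disp;
  face_rank : face -> int;
  rank_bounds : forall F, -1 <= face_rank F <= n%:Z;
  rank_lt : forall F G : face, (F < G)%O -> face_rank F < face_rank G;
  least_face : exists F : face, forall G : face, (F <= G)%O;
  greatest_face : exists G : face, forall F : face, (F <= G)%O;
  card_flag : forall Phi, Phi \in flags face -> #|Phi| = n.+2;
  strong_flag_connectedness : forall Phi Psi,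
    Phi \in flags face -> Psi \in flags face -> strongly_joined Phi Psi;
  diamond : forall F G : face, (F < G)%O -> face_rank G = face_rank F + 2 ->
    #|[set H : face | (F < H < G)%O]| = 2%N
}.

Section Automorphisms.
Variables (n : nat) (P : polytope n).
Implicit Types (Phi Psi : {set P}) (s : {perm P}).

Definition Aut_polytope : {set {perm P}} :=
  [set s : {perm P} | [forall F, forall G, (s F <= s G)%O == (F <= G)%O]].

Lemma Aut_polytope_group_set : group_set Aut_polytope.
Proof.
apply/group_setP; split=> [|s t].
  by rewrite inE; apply/'forall_'forall_eqP=> F G; rewrite !perm1.
rewrite !inE => /'forall_'forall_eqP hs /'forall_'forall_eqP ht.
by apply/'forall_'forall_eqP=> F G; rewrite !permM ht hs.
Qed.
Canonical Aut_polytope_group := Group Aut_polytope_group_set.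

Definition regular : bool := [transitive Aut_polytope, on flags P | 'P^*].

Definition chiral : Prop :=
  #|orbit 'P^* Aut_polytope @: flags P| = 2%N /\
  (forall Phi Psi, Phi \in flags P -> Psi \in flags P -> adjacent Phi Psi ->
    Psi \notin orbit 'P^* Aut_polytope Phi).

(* i-adjacency of flags: they differ in exactly the face of rank i. *)
Definition adjacent_at (i : nat) Phi Psi : bool :=
  [&& Psi \in flags P, Phi != Psi &
      [set F in Phi | face_rank F != i%:Z] ==
      [set F in Psi | face_rank F != i%:Z]].

(* The distinguished generators of a regular polytope with base flag Phi, and
   the rotations sigma_i = rho_(i-1) rho_i for 1 <= i <= n-1. *)
Definition rho Phi (i : nat) : {perm P} :=
  odflt 1%g [pick s in Aut_polytope | adjacent_at i Phi (s @: Phi)].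

Definition sigma Phi (i : nat) : {perm P} := (rho Phi i.-1 * rho Phi i)%g.

Definition rotation_group Phi : {group {perm P}} :=
  <<[set sigma Phi i | i : 'I_n & (0 < i)%N]>>%G.

Definition directly_regular : Prop :=
  regular /\ (forall Phi, Phi \in flags P ->
    #|Aut_polytope : rotation_group Phi|%g = 2%N).

(* s is the rotation sigma_i at Phi, i.e. it maps Phi to (Phi^i)^(i-1).  In the
   regular case this is rho_(i-1) rho_i (permutations act on the right); in the
   chiral case, where the rho_i do not exist, it is the usual definition. *)
Definition is_rotation Phi (i : nat) s : bool :=
  (s \in Aut_polytope) &&
  [exists Psi, adjacent_at i Phi Psi && adjacent_at i.-1 Psi (s @: Phi)].

(* Type {p_1, ..., p_(n-1)} of a regular or chiral polytope, listed in ps. *)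
Definition has_type (ps : seq nat) : Prop :=
  size ps = n.-1 /\
  (forall Phi (i : nat), Phi \in flags P -> (0 < i < n)%N ->
    exists2 s, is_rotation Phi i s & #[s]%g = nth 0%N ps i.-1).

End Automorphisms.
Arguments Aut_polytope {n} P.
Arguments Aut_polytope_group {n} P.
Arguments regular {n} P.
Arguments chiral {n} P.
Arguments directly_regular {n} P.
Arguments has_type {n} P ps.

Section Spherical.
Local Open Scope classical_set_scope.

Definition homeomorphic (X Y : topologicalType) (A : set X) (B : set Y) : Prop :=
  exists (f : X -> Y) (g : Y -> X),
    [/\ {within A, continuous f}, {within B, continuous g},
        (forall x, A x -> B (f x) /\ g (f x) = x) &
        (forall y, B y -> A (g y) /\ f (g y) = y)].

Definition sphere2 (R : realType) : set 'rV[R]_3 :=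
  [set v : 'rV[R]_3 | \sum_i v ord0 i ^+ 2 = 1].

(* Geometric realization, in barycentric coordinates, of the order complex of
   the open interval ]F, G[ of P: the underlying space of the section G/F. *)
Definition section_space (R : realType) n (P : polytope n) (F G : P) :
    set {ptws P -> R} :=
  [set x : {ptws P -> R} | [/\ forall H, 0 <= x H, \sum_H x H = 1,
      forall H, x H != 0 -> (F < H < G)%O &
      forall H K, x H != 0 -> x K != 0 -> (H >=< K)%O]].

(* Meant for sections G/F of rank 3: these are maps, whose underlying surface is
   section_space F G (triangulated by the barycentric subdivision of the map). *)
Definition spherical_section (R : realType) n (P : polytope n) (F G : P)
    : Prop :=
  homeomorphic (@section_space R n P F G) (@sphere2 R).

Definition locally_spherical (R : realType) (P : polytope 4) : Prop :=
  (forall F G : P, face_rank F = -1 -> face_rank G = 3 ->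
    @spherical_section R 4 P F G) /\
  (forall F G : P, face_rank F = 0 -> face_rank G = 4 ->
    @spherical_section R 4 P F G).

End Spherical.

Section PSL.
Variable p : nat.

Definition SL2 : {set {'GL_2['F_p]}} :=
  [set A : {'GL_2['F_p]} | \det (GLval A) == 1].

Lemma SL2_group_set : group_set SL2.
Proof.
apply/group_setP; split=> [|A B]; first by rewrite inE GL_1E det1.
by rewrite !inE GL_ME det_mulmx => /eqP-> /eqP->; rewrite mulr1.
Qed.
Canonical SL2_group := Group SL2_group_set.

Definition L2 := (SL2 / 'Z(SL2))%G.

End PSL.

(* Main.v *)
(* Let sigma_i be the rotations of Q.  Unit quaternions over F_p provide elements
   s1, s2, s3 of L2(p) satisfying the relations of the rotation group of type
   {5,3,4}; they generate L2(p), since a subgroup of SL2(p) of order prime to p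
   is excluded by Dickson's count of its maximal abelian subgroups, and one of
   order divisible by p contains transvections.  As #|L2(p)| does not divide
   #|Gamma+(Q)|, Goursat's lemma shows that the pairs (s_i, sigma_i) generate
   G = L2(p) x Gamma+(Q).  In G, the subgroups generated by the rotations fixing a
   base face map isomorphically onto the corresponding stabilizers in Gamma+(Q),
   because their relations already define finite spherical groups; hence their
   cosets form a polytope which covers Q and is isomorphic to Q on facets and
   vertex-figures.  A reflection of this polytope would induce an automorphism of
   L2(p) fixing s1 and inverting s3, that is, a conjugation by an element of
   GL2(p), which is impossible as the traces of s1 s3 and of s1 / s3 differ even
   up to sign. *)

Require Import Defs.
From HB Require Import structures.
From mathcomp Require Import all_boot all_order all_algebra all_fingroup all_solvable all_field.
From mathcomp Require Import boolp reals zify ring lra.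
From mathcomp Require classical_sets functions topology normedtype.

Set Implicit Arguments.
Unset Strict Implicit.
Unset Printing Implicit Defensive.

Import Order.TTheory GRing.Theory Num.Theory.

(** * Flags and rotations of polytopes *)

(** No abstract presentation is ever used. Apart from global connectedness, which is the generation
    of G by the stabilizers, the polytope axioms are pulled back from Q: over the star of a face
    that is neither least nor greatest, the projection to Q is an isomorphism. What this needs is
    that each face stabilizer embeds in Gamma+(Q). For a vertex and a facet, coset enumeration
    bounds the order of the stabilizer by that of the octahedral or dodecahedral rotation group, and
    counting elements of prime order shows that the image cannot be half as large. The arithmetic
    hypotheses provide the coordinates of the quaternions. Lifted to SL2(p), the generators have
    traces 2cos(pi/5), 2cos(pi/3) and 2cos(pi/4), so the square roots of 5 and of 2 are required,
    the latter because p is 1 or 7 modulo 8. Normalizing the first quaternion requires one more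
    square root, which exists because 1 - sqrt 5 is a square for one choice of sqrt 5. Over the
    reals that root would be imaginary for f = cos(pi/5): the honeycomb {5,3,4} is hyperbolic. *)

Section PosetFlags.
Variables (d : Order.disp_t) (T : finPOrderType d).
Implicit Types (C Phi : {set T}) (F G : T).

Lemma chainP C : reflect {in C &, forall x y, (x >=< y)%O} (chain C).
Proof.
apply: (iffP forall_inP) => H x.
  by move=> y /H/forall_inP; apply.
by move=> xC; apply/forall_inP => y; apply: H.
Qed.

Lemma flag_chain Phi : Phi \in flags T -> chain Phi.
Proof. by rewrite inE => /maxsetP[]. Qed.

Lemma flag_comp Phi : Phi \in flags T -> {in Phi &, forall x y, (x >=< y)%O}.
Proof. by move/flag_chain/chainP. Qed.

Lemma chainU1 C F : chain C -> {in C, forall G, (F >=< G)%O} -> chain (F |: C).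
Proof.
move=> /chainP hC hF; apply/chainP => x y.
move=> /setU1P[->|xC] /setU1P[->|yC]; [exact: comparablexx|exact: hF| |exact: hC].
by rewrite comparable_sym; apply: hF.
Qed.

Lemma flag_max Phi F :
  Phi \in flags T -> {in Phi, forall G, (F >=< G)%O} -> F \in Phi.
Proof.
move=> fPhi hF; have hC := chainU1 (flag_chain fPhi) hF.
move: fPhi; rewrite inE => /maxsetP[_ /(_ _ hC (subsetUr _ _)) <-].
exact: setU11.
Qed.

Lemma max_flag Phi : chain Phi ->
  (forall F, {in Phi, forall G, (F >=< G)%O} -> F \in Phi) -> Phi \in flags T.
Proof.
move=> hC hm; rewrite inE; apply/maxsetP; split=> // B /chainP hB sPB.
apply/eqP; rewrite eqEsubset sPB andbT; apply/subsetP => F FB.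
by apply: hm => G /(subsetP sPB); apply: hB.
Qed.

Lemma chain_in_flag C : chain C -> exists2 Phi, Phi \in flags T & C \subset Phi.
Proof. by move/maxset_exists => [Phi mPhi sC]; exists Phi; rewrite ?inE. Qed.

End PosetFlags.

(** * Flags as families of faces indexed by rank, and adjacency *)

Section PolytopeFlags.
Variables (n : nat) (P : polytope n).
Implicit Types (Phi Psi A B C : {set P}) (F G : P) (s : {perm P}) (i j : nat).

(* Ranks shifted by one, so that they are natural numbers from 0 to n + 1. *)
Definition rk F : nat := `|(face_rank F + 1)%R|%N.

Lemma face_rankE F : face_rank F = ((rk F)%:Z - 1)%R.
Proof. by rewrite /rk; have := rank_bounds F; lia. Qed.

Lemma rk_le F : rk F <= n.+1.
Proof. by rewrite /rk; have := rank_bounds F; lia. Qed.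

Lemma rk_lt F G : (F < G)%O -> rk F < rk G.
Proof. by move/rank_lt; rewrite !face_rankE; lia. Qed.

Lemma rk_leq F G : (F <= G)%O -> rk F <= rk G.
Proof. by rewrite le_eqVlt => /predU1P[->//|/rk_lt/ltnW]. Qed.

Lemma rk_inj_chain C : chain C -> {in C &, injective rk}.
Proof.
move=> /chainP hC x y xC yC e.
have := hC _ _ xC yC; rewrite /Order.comparable !le_eqVlt.
by case/orP => /predU1P[->//|/rk_lt]; rewrite e ltnn.
Qed.

Lemma chain_flag C : chain C -> #|C| = n.+2 -> C \in flags P.
Proof.
move=> hC cC; have [Phi fPhi sC] := chain_in_flag hC.
suff -> : C = Phi by [].
by apply/eqP; rewrite eqEcard sC cC (card_flag fPhi) leqnn.
Qed.

(** A total function, convenient for rewriting; the least face is a default, never reached for a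
    flag and an index up to [n.+1]. *)
Definition flag_face Phi i : P :=
  odflt (projT1 (cid (least_face P))) [pick F in Phi | rk F == i].

(** Pigeonhole: the [n.+2] faces of a flag have distinct shifted ranks among [n.+2] values. *)
Lemma flag_faceP Phi i : Phi \in flags P -> i <= n.+1 ->
  flag_face Phi i \in Phi /\ rk (flag_face Phi i) = i.
Proof.
move=> fPhi lei; rewrite /flag_face.
case: pickP => [F /andP[? /eqP]//|no].
pose f F : 'I_n.+2 := inord (rk F).
have injf : {in Phi &, injective f}.
  move=> x y xP yP /(congr1 (@nat_of_ord _)); rewrite /f !inordK ?ltnS ?rk_le //.
  exact: rk_inj_chain (flag_chain fPhi) _ _ xP yP.
have cf : #|f @: Phi| = #|'I_n.+2| by rewrite card_in_imset // (card_flag fPhi) card_ord.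
have /subset_leqif_cards/leqifP: f @: Phi \subset [set: 'I_n.+2] by exact: subsetT.
rewrite cf cardsT; case: eqP => [e _|_]; last by rewrite ltnn.
have : (inord i : 'I_n.+2) \in f @: Phi by rewrite e inE.
case/imsetP => F FP /(congr1 (@nat_of_ord _)); rewrite /f !inordK ?ltnS ?rk_le // => e1.
by have := no F; rewrite FP e1 eqxx.
Qed.

Lemma flag_face_in Phi i : Phi \in flags P -> i <= n.+1 -> flag_face Phi i \in Phi.
Proof. by move=> h /(flag_faceP h)[]. Qed.

Lemma rk_flag_face Phi i : Phi \in flags P -> i <= n.+1 -> rk (flag_face Phi i) = i.
Proof. by move=> h /(flag_faceP h)[]. Qed.

Lemma flag_face_rk Phi F : Phi \in flags P -> F \in Phi -> flag_face Phi (rk F) = F.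
Proof.
move=> fPhi FP; have [h1 h2] := flag_faceP fPhi (rk_le F).
exact: rk_inj_chain (flag_chain fPhi) _ _ h1 FP h2.
Qed.

Lemma flag_face_lt Phi i j : Phi \in flags P -> i < j -> j <= n.+1 ->
  (flag_face Phi i < flag_face Phi j)%O.
Proof.
move=> fPhi ij jn; have ii : i <= n.+1 by lia.
have := flag_comp fPhi (flag_face_in fPhi ii) (flag_face_in fPhi jn).
rewrite lt_neqAle; case: eqP => [e|_].
  by move: ij; rewrite -(rk_flag_face fPhi ii) e (rk_flag_face fPhi jn) ltnn.
rewrite /Order.comparable => /orP[//|/rk_leq].
by rewrite !rk_flag_face //; lia.
Qed.

Lemma flag_face_le Phi i j : Phi \in flags P -> i <= j -> j <= n.+1 ->
  (flag_face Phi i <= flag_face Phi j)%O.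
Proof.
move=> fPhi; rewrite leq_eqVlt => /predU1P[->//|ij jn].
exact/ltW/flag_face_lt.
Qed.

Lemma flag_faces_sub Phi Psi : Phi \in flags P -> Psi \in flags P ->
  (forall i, i <= n.+1 -> flag_face Phi i = flag_face Psi i) -> Phi \subset Psi.
Proof.
move=> fPhi fPsi h; apply/subsetP => F FP.
by rewrite -(flag_face_rk fPhi FP) h ?rk_le // flag_face_in ?rk_le.
Qed.

Lemma flag_ext Phi Psi : Phi \in flags P -> Psi \in flags P ->
  (forall i, i <= n.+1 -> flag_face Phi i = flag_face Psi i) -> Phi = Psi.
Proof.
move=> fPhi fPsi h; apply/eqP; rewrite eqEsubset !flag_faces_sub // => i hi.
by rewrite h.
Qed.

Lemma face_in_flag F : exists2 Phi, Phi \in flags P & F \in Phi.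
Proof.
have /chain_in_flag[Phi fPhi] : chain [set F].
  by apply/chainP => x y /set1P-> /set1P->; rewrite comparablexx.
by rewrite sub1set; exists Phi.
Qed.

Lemma flag_ex : exists Phi, Phi \in flags P.
Proof. by have [F _] := least_face P; have [Phi] := face_in_flag F; exists Phi. Qed.

Lemma flag_extremes Phi F : Phi \in flags P ->
  (forall G, (F <= G)%O) \/ (forall G, (G <= F)%O) -> F \in Phi.
Proof.
move=> fPhi h; apply: flag_max => // G _; rewrite /Order.comparable.
by case: h => ->; rewrite ?orbT.
Qed.

Lemma rk_least F : (forall G, (F <= G)%O) -> rk F = 0.
Proof.
move=> h; have [Phi fPhi] := flag_ex.
by have := rk_leq (h (flag_face Phi 0)); rewrite rk_flag_face // leqn0 => /eqP.
Qed.

Lemma rk_greatest F : (forall G, (G <= F)%O) -> rk F = n.+1.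
Proof.
move=> h; have [Phi fPhi] := flag_ex.
have := rk_leq (h (flag_face Phi n.+1)); rewrite rk_flag_face // => h1.
by apply/eqP; rewrite eqn_leq rk_le.
Qed.

Lemma rk0_least F : rk F = 0 -> forall G, (F <= G)%O.
Proof.
move=> r0; have [Phi fPhi FP] := face_in_flag F; have [E hE] := least_face P.
have <- // : E = F.
apply: (rk_inj_chain (flag_chain fPhi)) => //; last by rewrite r0 rk_least.
by apply: flag_extremes => //; left.
Qed.

Lemma rkn_greatest F : rk F = n.+1 -> forall G, (G <= F)%O.
Proof.
move=> r0; have [Phi fPhi FP] := face_in_flag F; have [E hE] := greatest_face P.
have <- // : E = F.
apply: (rk_inj_chain (flag_chain fPhi)) => //; last by rewrite r0 rk_greatest.
by apply: flag_extremes => //; right.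
Qed.

Lemma flag_face0 Phi Psi : Phi \in flags P -> Psi \in flags P ->
  flag_face Phi 0 = flag_face Psi 0.
Proof.
move=> fPhi fPsi; apply/le_anti/andP.
by split; apply: rk0_least; rewrite rk_flag_face.
Qed.

Lemma flag_facen Phi Psi : Phi \in flags P -> Psi \in flags P ->
  flag_face Phi n.+1 = flag_face Psi n.+1.
Proof.
move=> fPhi fPsi; apply/le_anti/andP.
by split; apply: rkn_greatest; rewrite rk_flag_face.
Qed.

(** The index [i] is an unshifted rank, so the exchanged face has shifted rank [i.+1]. *)
Definition adj i Phi : {set P} :=
  odflt Phi [pick Psi in flags P | (Psi != Phi) &&
    [forall j : 'I_n.+2, (j != i.+1 :> nat) ==>
                         (flag_face Psi j == flag_face Phi j)]].

Lemma diamond_other F G H : (F < H)%O -> (H < G)%O -> rk G = (rk F).+2 ->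
  exists2 K, (F < K < G)%O && (K != H) &
    forall L, (F < L < G)%O -> L = H \/ L = K.
Proof.
move=> FH HG e; have FG := lt_trans FH HG.
have /eqP/cards2P[x [y [xy E]]] : #|[set K : P | (F < K < G)%O]| = 2.
  by apply: diamond => //; rewrite !face_rankE e; lia.
have inE2 L : (F < L < G)%O = (L == x) || (L == y).
  by move/setP/(_ L): E; rewrite !inE.
have := inE2 H; rewrite FH HG /= => /esym/orP[]/eqP->.
  exists y; first by rewrite inE2 eqxx orbT eq_sym.
  by move=> L; rewrite inE2 => /orP[]/eqP; [left|right].
exists x; first by rewrite inE2 eqxx.
by move=> L; rewrite inE2 => /orP[]/eqP; [right|left].
Qed.

Lemma flag_face_betw Phi Psi i : Phi \in flags P -> Psi \in flags P -> i < n ->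
  (forall j, j <= n.+1 -> j <> i.+1 -> flag_face Psi j = flag_face Phi j) ->
  (flag_face Phi i < flag_face Psi i.+1 < flag_face Phi i.+2)%O.
Proof.
move=> fPhi fPsi lin h; rewrite -!h; try lia.
by rewrite !flag_face_lt //; lia.
Qed.

(** The face of rank [i] is exchanged for the other face of its diamond; the result is a chain with
    as many elements as a flag. *)
Lemma adj_exists Phi i : Phi \in flags P -> i < n ->
  exists2 Psi, Psi \in flags P & Psi != Phi /\
  (forall j, j <= n.+1 -> j <> i.+1 -> flag_face Psi j = flag_face Phi j).
Proof.
move=> fPhi lin.
have l1 : (flag_face Phi i < flag_face Phi i.+1)%O by rewrite flag_face_lt //; lia.
have l2 : (flag_face Phi i.+1 < flag_face Phi i.+2)%O by rewrite flag_face_lt //; lia.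
have [|K /andP[/andP[FK KG] KH] _] := diamond_other l1 l2.
  by rewrite !rk_flag_face //; lia.
set H := flag_face Phi i.+1 in KH l1 l2.
have HP : H \in Phi by apply: flag_face_in => //; lia.
have rK : rk K = i.+1.
  by move/rk_lt: FK; move/rk_lt: KG; rewrite !rk_flag_face //; lia.
have rH : rk H = i.+1 by apply: rk_flag_face => //; lia.
have KP : K \notin Phi.
  apply/negP => KP; case/eqP: KH; apply: (rk_inj_chain (flag_chain fPhi)) => //.
  by rewrite rK rH.
have hch : chain (K |: Phi :\ H).
  apply: chainU1.
    by apply/chainP => x y /setD1P[_ xP] /setD1P[_ yP]; apply: (flag_comp fPhi).
  move=> G /setD1P[GH GP]; rewrite -(flag_face_rk fPhi GP).
  have : rk G <> i.+1.
    move=> e; case/eqP: GH; apply: (rk_inj_chain (flag_chain fPhi)) => //.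
    by rewrite e rH.
  move: (rk_le G) => rG ne; rewrite /Order.comparable.
  have [le|lt] := leqP (rk G) i.
    rewrite (le_trans _ (ltW FK)) ?orbT //.
    by apply: flag_face_le => //; lia.
  by rewrite (le_trans (ltW KG)) //; apply: flag_face_le => //; lia.
have fPsi : K |: Phi :\ H \in flags P.
  apply: chain_flag => //; rewrite cardsU1 !inE (negPf KP) andbF /=.
  by have := cardsD1 H Phi; rewrite HP (card_flag fPhi) => <-.
exists (K |: Phi :\ H) => //; split.
  by apply/eqP => e; move: KP; rewrite -e setU11.
move=> j hj ne.
have jin : flag_face Phi j \in K |: Phi :\ H.
  rewrite !inE flag_face_in // andbT; apply/orP; right; apply/eqP => e.
  by apply: ne; rewrite -rH -e rk_flag_face.
by rewrite -{1}(rk_flag_face fPhi hj) flag_face_rk.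
Qed.

Lemma adjP Phi i : Phi \in flags P -> i < n ->
  [/\ adj i Phi \in flags P, adj i Phi != Phi &
  forall j, j <= n.+1 -> j <> i.+1 -> flag_face (adj i Phi) j = flag_face Phi j].
Proof.
move=> fPhi lin; rewrite /adj; case: pickP => [Psi /and3P[h1 h2 /forallP h3]|no].
  split=> // j hj ne; have := h3 (inord j); rewrite inordK //.
  by move/eqP/negPf: ne => -> /= /eqP.
have [Psi fPsi [ne h]] := adj_exists fPhi lin.
have := no Psi; rewrite fPsi ne /= => /negP[]; apply/forallP => j.
by apply/implyP => /eqP nej; rewrite h // -ltnS.
Qed.

Lemma adj_flag Phi i : Phi \in flags P -> i < n -> adj i Phi \in flags P.
Proof. by move=> h1 h2; case: (adjP h1 h2). Qed.

Lemma adj_neq Phi i : Phi \in flags P -> i < n -> adj i Phi != Phi.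
Proof. by move=> h1 h2; case: (adjP h1 h2). Qed.

Lemma flag_face_adj Phi i j : Phi \in flags P -> i < n ->
  j <= n.+1 -> j <> i.+1 -> flag_face (adj i Phi) j = flag_face Phi j.
Proof. by move=> h1 h2; case: (adjP h1 h2) => _ _; apply. Qed.

Lemma flag_neq_face Phi Psi i : Phi \in flags P -> Psi \in flags P -> i < n ->
  Psi != Phi ->
  (forall j, j <= n.+1 -> j <> i.+1 -> flag_face Psi j = flag_face Phi j) ->
  flag_face Psi i.+1 != flag_face Phi i.+1.
Proof.
move=> fPhi fPsi lin /eqP ne h; apply/eqP => e; apply: ne; apply: flag_ext => // j hj.
by have [->//|/eqP ne] := eqVneq j i.+1; apply: h.
Qed.

Lemma face_uniq_adj Phi i F G : Phi \in flags P -> i < n ->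
  (flag_face Phi i < F < flag_face Phi i.+2)%O -> F != flag_face Phi i.+1 ->
  (flag_face Phi i < G < flag_face Phi i.+2)%O -> G != flag_face Phi i.+1 -> F = G.
Proof.
move=> fPhi lin hF nF hG nG.
have l1 : (flag_face Phi i < flag_face Phi i.+1)%O by rewrite flag_face_lt //; lia.
have l2 : (flag_face Phi i.+1 < flag_face Phi i.+2)%O by rewrite flag_face_lt //; lia.
have [|K _ hK] := diamond_other l1 l2; first by rewrite !rk_flag_face //; lia.
case: (hK _ hF) => [e|->]; first by rewrite e eqxx in nF.
by case: (hK _ hG) => [e|->//]; rewrite e eqxx in nG.
Qed.

Lemma adj_uniq Phi Psi i : Phi \in flags P -> Psi \in flags P -> i < n ->
  Psi != Phi ->
  (forall j, j <= n.+1 -> j <> i.+1 -> flag_face Psi j = flag_face Phi j) ->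
  Psi = adj i Phi.
Proof.
move=> fPhi fPsi lin ne h; have [fA nA hA] := adjP fPhi lin.
apply: flag_ext => // j hj; have [->|/eqP nj] := eqVneq j i.+1; last first.
  by rewrite h // hA.
by apply: (@face_uniq_adj Phi i) => //;
   [apply: flag_face_betw | apply: flag_neq_face |
    apply: flag_face_betw | apply: flag_neq_face].
Qed.

Lemma adjK Phi i : Phi \in flags P -> i < n -> adj i (adj i Phi) = Phi.
Proof.
move=> fPhi lin; symmetry; apply: adj_uniq; rewrite ?adj_flag //.
  by rewrite eq_sym adj_neq.
by move=> j hj ne; rewrite flag_face_adj.
Qed.

Lemma flag_face_adj_neq Phi i : Phi \in flags P -> i < n ->
  flag_face (adj i Phi) i.+1 != flag_face Phi i.+1.
Proof.
move=> fPhi lin; apply: flag_neq_face; rewrite ?adj_flag ?adj_neq //.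
by move=> j; apply: flag_face_adj.
Qed.

(** The diamond that determines [adj i] lies between the faces of shifted ranks [i] and [i.+2],
    which [adj j] leaves alone; so the same new face is chosen from [Phi] and from [adj j Phi]. *)
Lemma adjC Phi i j : Phi \in flags P -> i.+1 < j -> j < n ->
  adj i (adj j Phi) = adj j (adj i Phi).
Proof.
move=> fPhi ij jn; have lin : i < n by lia.
have fi := adj_flag fPhi lin; have fj := adj_flag fPhi jn.
apply: adj_uniq; rewrite ?adj_flag //.
  apply: contraTneq (flag_face_adj_neq fPhi jn) => e.
  rewrite negbK -(flag_face_adj fj lin) ?e; try lia.
  by rewrite (flag_face_adj fPhi lin) //; lia.
move=> k hk ne; have [->|/eqP nk] := eqVneq k i.+1; last first.
  by rewrite !flag_face_adj.
have hb B : B \in flags P ->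
  (forall k, k <= n.+1 -> k <> j.+1 -> flag_face B k = flag_face Phi k) ->
  (flag_face Phi i < flag_face (adj i B) i.+1 < flag_face Phi i.+2)%O /\
  flag_face (adj i B) i.+1 != flag_face Phi i.+1.
  move=> fB hB; rewrite -(hB i); try lia; rewrite -(hB i.+1); try lia.
  rewrite -(hB i.+2); try lia; split; last exact: flag_face_adj_neq.
  by apply: flag_face_betw; rewrite ?adj_flag // => l *; rewrite flag_face_adj.
have [h1 h2] := hb _ fj (fun k => flag_face_adj fPhi jn).
have [h3 h4] := hb _ fPhi (fun k _ _ => erefl).
exact: face_uniq_adj h1 h2 h3 h4.
Qed.

Lemma adjacent_atE Phi Psi i : Phi \in flags P -> i < n ->
  adjacent_at i Phi Psi = (Psi == adj i Phi).
Proof.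
move=> fPhi lin; apply/idP/eqP.
  case/and3P => fPsi ne /eqP/setP h; apply: adj_uniq; rewrite // 1?eq_sym //.
  move=> j hj nj; have := h (flag_face Phi j).
  rewrite !inE flag_face_in // face_rankE rk_flag_face //.
  have -> : (j%:Z - 1 != i%:Z)%R by apply/eqP; lia.
  by rewrite /= andbT => /esym /(flag_face_rk fPsi); rewrite rk_flag_face.
move=> ->; rewrite /adjacent_at adj_flag // eq_sym adj_neq //=.
have nr F : (face_rank F != i%:Z)%R = (rk F != i.+1).
  by rewrite face_rankE; congr (~~ _); apply/eqP/eqP; lia.
apply/eqP/setP => F; rewrite !inE nr; case: eqP => /=; rewrite ?andbF // => ne.
have fA := adj_flag fPhi lin; rewrite !andbT; apply/idP/idP => hF.
  by rewrite -(flag_face_rk fPhi hF) -(flag_face_adj fPhi lin) ?rk_le // flag_face_in ?rk_le.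
by rewrite -(flag_face_rk fA hF) (flag_face_adj fPhi lin) ?rk_le // flag_face_in ?rk_le.
Qed.

Lemma adjacent_adj Phi Psi : Phi \in flags P -> Psi \in flags P ->
  adjacent Phi Psi -> exists2 i, i < n & Psi = adj i Phi.
Proof.
move=> fPhi fPsi /andP[/cards1P[F eF] /cards1P[G eG]].
have /setDP[FP nF] : F \in Phi :\: Psi by rewrite eF set11.
have sub i : i <= n.+1 -> i <> rk F -> flag_face Psi i = flag_face Phi i.
  move=> hi ne; have : flag_face Phi i \in Psi.
    apply/negPn/negP => nin; apply: ne; rewrite -(rk_flag_face fPhi hi); congr rk.
    by apply/set1P; rewrite -eF inE nin flag_face_in.
  by move/(flag_face_rk fPsi); rewrite rk_flag_face.
have h0 : rk F != 0.
  apply/eqP => e; case/negP: nF; rewrite -(flag_face_rk fPhi FP) e.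
  by rewrite (flag_face0 fPhi fPsi) flag_face_in.
have hn : rk F != n.+1.
  apply/eqP => e; case/negP: nF; rewrite -(flag_face_rk fPhi FP) e.
  by rewrite (flag_facen fPhi fPsi) flag_face_in.
have hr := rk_le F; exists (rk F).-1; first by lia.
apply: adj_uniq => //; first by lia.
  by apply: contraNneq nF => ->.
by move=> j hj; rewrite prednK ?lt0n // => ne; apply: sub.
Qed.

(** Induction along the gallery given by strong flag-connectedness; the common faces [X] stay in
    each of its flags. *)
Lemma flag_ind_sub (T : {set P} -> Prop) (X : {set P}) Phi Psi :
  Phi \in flags P -> Psi \in flags P -> X \subset Phi -> X \subset Psi -> T Phi ->
  (forall A i, A \in flags P -> i < n -> X \subset A -> X \subset adj i A ->
     T A -> T (adj i A)) -> T Psi.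
Proof.
move=> fPhi fPsi XPhi XPsi TPhi hT.
have /connectP[p] := strong_flag_connectedness fPhi fPsi.
have XI : X \subset Phi :&: Psi by rewrite subsetI XPhi.
move: (Phi :&: Psi) XI => Y XY.
elim: p Phi fPhi XPhi TPhi => [|B p IH] A fA XA TA /=; first by move=> _ ->.
case/andP => /and5P[_ fB hAB YA YB] hp e; apply: (IH B) => //.
  exact: subset_trans YB.
have [i lin eB] := adjacent_adj fA fB hAB; rewrite eB; apply: hT => //.
by rewrite -eB; apply: subset_trans YB.
Qed.

Lemma flag_ind (T : {set P} -> Prop) Phi Psi :
  Phi \in flags P -> Psi \in flags P -> T Phi ->
  (forall A i, A \in flags P -> i < n -> T A -> T (adj i A)) -> T Psi.
Proof.
move=> fPhi fPsi TPhi hT.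
by apply: (flag_ind_sub fPhi fPsi (sub0set _) (sub0set _) TPhi) => A i fA hi _ _; apply: hT.
Qed.

(** * Automorphisms acting on flags *)

Section Aut.
Variables (s : {perm P}) (autS : s \in Aut_polytope P).

Lemma aut_le F G : (s F <= s G)%O = (F <= G)%O.
Proof. by move: autS; rewrite inE => /'forall_'forall_eqP->. Qed.

Lemma aut_comp F G : (s F >=< s G)%O = (F >=< G)%O.
Proof. by rewrite /Order.comparable !aut_le. Qed.

Lemma aut_lt F G : (s F < s G)%O = (F < G)%O.
Proof. by rewrite !lt_neqAle aut_le (inj_eq perm_inj). Qed.

Lemma aut_flag Phi : Phi \in flags P -> s @: Phi \in flags P.
Proof.
move=> fPhi; apply: chain_flag; last by rewrite card_imset ?(card_flag fPhi) //; apply: perm_inj.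
apply/chainP => _ _ /imsetP[x xP ->] /imsetP[y yP ->].
by rewrite aut_comp (flag_comp fPhi).
Qed.

(** Automorphisms are defined by the order alone; the rank is recovered as the number of smaller
    faces in any flag through the face. *)
Lemma aut_rk F : rk (s F) = rk F.
Proof.
have rkE Phi G : Phi \in flags P -> G \in Phi -> rk G = #|[set H in Phi | (H < G)%O]|.
  move=> fPhi GP.
  have -> : [set H in Phi | (H < G)%O] = [set flag_face Phi i | i : 'I_(rk G)].
    apply/setP => H; rewrite inE; apply/andP/imsetP => [[HP HG]|[i _ ->]].
      by exists (Ordinal (rk_lt HG)); rewrite //= flag_face_rk.
    have := ltn_ord i; have := rk_le G => h1 h2; rewrite flag_face_in //; last by lia.
    by split=> //; rewrite -[X in (_ < X)%O](flag_face_rk fPhi GP) flag_face_lt.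
  rewrite card_imset ?card_ord // => i j /(congr1 rk).
  have := ltn_ord i; have := ltn_ord j; have := rk_le G => h1 h2 h3.
  by rewrite !rk_flag_face //; [apply: val_inj | lia | lia].
have [Phi fPhi FP] := face_in_flag F.
rewrite (rkE (s @: Phi)) ?aut_flag ?imset_f // (rkE Phi) //.
rewrite -[RHS](card_imset _ (@perm_inj _ s)); congr #|pred_of_set _|; apply/setP => H.
rewrite inE; apply/andP/imsetP.
  case=> /imsetP[K KP ->]; rewrite aut_lt => h.
  by exists K => //; rewrite inE KP.
case=> K; rewrite inE => /andP[KP h] ->.
by rewrite imset_f // aut_lt.
Qed.

Lemma aut_flag_face Phi i : Phi \in flags P -> i <= n.+1 ->
  flag_face (s @: Phi) i = s (flag_face Phi i).
Proof.
move=> fPhi hi; have h : s (flag_face Phi i) \in s @: Phi by rewrite imset_f ?flag_face_in.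
by rewrite -(flag_face_rk (aut_flag fPhi) h) aut_rk rk_flag_face.
Qed.

Lemma aut_adj Phi i : Phi \in flags P -> i < n -> s @: adj i Phi = adj i (s @: Phi).
Proof.
move=> fPhi lin; apply: adj_uniq; rewrite ?aut_flag ?adj_flag //.
  by rewrite (inj_eq (imset_inj (@perm_inj _ s))) adj_neq.
by move=> j hj nj; rewrite !aut_flag_face ?adj_flag // flag_face_adj.
Qed.

(** An automorphism commutes with every [adj i], so fixing one flag propagates along galleries to
    all flags, hence to all faces. *)
Lemma aut_free Phi : Phi \in flags P -> s @: Phi = Phi -> s = 1%g.
Proof.
move=> fPhi sPhi; apply/permP => F; rewrite perm1.
have [Psi fPsi FP] := face_in_flag F.
have sPsi : s @: Psi = Psi.
  apply: (@flag_ind (fun A => s @: A = A) Phi) => // A i fA hi e.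
  by rewrite aut_adj // e.
by rewrite -{1}(flag_face_rk fPsi FP) -aut_flag_face ?rk_le // sPsi flag_face_rk.
Qed.

End Aut.

Lemma imset_permM (s t : {perm P}) A : (s * t)%g @: A = t @: (s @: A).
Proof. by rewrite -imset_comp; apply: eq_imset => x; rewrite permM. Qed.

Lemma imset_perm1 A : (1%g : {perm P}) @: A = A.
Proof. by rewrite -[RHS]imset_id; apply: eq_imset => x; rewrite perm1. Qed.

Lemma aut_eq (s t : {perm P}) Phi : s \in Aut_polytope P -> t \in Aut_polytope P ->
  Phi \in flags P -> s @: Phi = t @: Phi -> s = t.
Proof.
move=> sA tA fPhi e; apply/eqP; rewrite eq_mulgV1; apply/eqP.
apply: (@aut_free _ _ Phi) => //; first by rewrite groupM ?groupV.
by rewrite imset_permM e -imset_permM mulgV imset_perm1.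
Qed.

Lemma setactE (s : {perm P}) A : ('P^*%act A s) = s @: A.
Proof. by rewrite /= /setact; apply: eq_imset => x. Qed.

End PolytopeFlags.

(** * Generating reflections and face stabilizers of a regular polytope *)

Section RegularPolytope.
Variables (n : nat) (P : polytope n) (Phi : {set P}).
Hypotheses (regP : regular P) (fPhi : Phi \in flags P).
Implicit Types (A : {set P}) (g h : {perm P}) (i j k : nat).

Notation r := (rho Phi).
Notation Gp := (rotation_group Phi).
Notation face i := (flag_face Phi i).

Lemma regular_transP A : A \in flags P ->
  exists2 g, g \in Aut_polytope P & A = g @: Phi.
Proof.
move=> fA; have [g gA ->] := atransP2 regP fPhi fA.
by exists g => //; rewrite setactE.
Qed.

Lemma rhoP i : i < n -> r i \in Aut_polytope P /\ r i @: Phi = adj i Phi.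
Proof.
move=> lin; rewrite /rho; case: pickP => [s /andP[sA]|no] /=.
  by rewrite adjacent_atE // => /eqP.
have [g gA e] := regular_transP (adj_flag fPhi lin).
by have := no g; rewrite gA adjacent_atE // e eqxx.
Qed.

Lemma rho_aut i : i < n -> r i \in Aut_polytope P.
Proof. by case/rhoP. Qed.

Lemma rho_flag i : i < n -> r i @: Phi = adj i Phi.
Proof. by case/rhoP. Qed.

(** Since automorphisms commute with adjacency, words in the [r i], read from the right, are
    galleries starting at [Phi]. *)
Lemma rhoM_flag i g : i < n -> g \in Aut_polytope P ->
  (r i * g)%g @: Phi = adj i (g @: Phi).
Proof. by move=> hi gA; rewrite imset_permM rho_flag // aut_adj. Qed.

Lemma rho2 i : i < n -> (r i * r i)%g = 1%g.
Proof.
move=> hi; apply: (aut_eq _ _ fPhi); rewrite ?groupM ?group1 ?rho_aut //.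
by rewrite rhoM_flag ?rho_aut // rho_flag // adjK // imset_perm1.
Qed.

Lemma rhoV i : i < n -> ((r i)^-1)%g = r i.
Proof. by move/rho2 => e; apply/eqP; rewrite eq_sym eq_mulgV1 invgK e. Qed.

Lemma rhoC i j : i.+1 < j -> j < n -> (r i * r j = r j * r i)%g.
Proof.
move=> ij jn; have lin : i < n by lia.
apply: (aut_eq _ _ fPhi); rewrite ?groupM ?rho_aut //.
by rewrite !rhoM_flag ?rho_aut // !rho_flag // adjC.
Qed.

Lemma rho_fix i j : i < n -> j <= n.+1 -> j <> i.+1 -> r i (face j) = face j.
Proof.
move=> hi hj ne; rewrite -aut_flag_face ?rho_aut // rho_flag //.
by rewrite flag_face_adj.
Qed.

Lemma rho_move i : i < n -> r i (face i.+1) != face i.+1.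
Proof.
move=> hi; rewrite -aut_flag_face ?rho_aut //; last by lia.
by rewrite rho_flag // flag_face_adj_neq.
Qed.

Lemma rotation_sub : Gp \subset Aut_polytope P.
Proof.
rewrite gen_subG; apply/subsetP => _ /imsetP[i _ ->].
by rewrite groupM ?rho_aut //; have := ltn_ord i; lia.
Qed.

Lemma rho_pair i j : i < n -> j < n -> (r i * r j)%g \in Gp.
Proof.
(* Products [r 0 * r k] telescope into consecutive rotations, and every other pair is a quotient of
   two of them. *)
have h0 k : k < n -> (r 0 * r k)%g \in Gp.
  elim: k => [|k IH] hk; first by rewrite rho2.
  have -> : (r 0 * r k.+1 = (r 0 * r k) * (r k * r k.+1))%g.
    by rewrite mulgA -(mulgA (r 0)) rho2 ?mulg1 //; lia.
  rewrite groupM ?IH //; first by lia.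
  by apply: mem_gen; apply/imsetP; exists (Ordinal hk); rewrite ?inE.
move=> hi hj; have -> : (r i * r j = (r 0 * r i)^-1 * (r 0 * r j))%g.
  rewrite invMg !rhoV //; last by lia.
  by rewrite mulgA -(mulgA (r i)) rho2 ?mulg1 //; lia.
by rewrite groupM ?groupV ?h0.
Qed.

(** [I] is the set of ranks to be kept, so the reflections used have indices outside [I]. *)
Definition rho_pairs (I : pred nat) : {set {perm P}} :=
  [set (r jk.1 * r jk.2)%g | jk : 'I_n * 'I_n & ~~ I jk.1 && ~~ I jk.2].

Lemma mem_rho_pairs I i j : i < n -> j < n -> ~~ I i -> ~~ I j ->
  (r i * r j)%g \in rho_pairs I.
Proof.
move=> hi hj Ii Ij; apply/imsetP.
by exists (Ordinal hi, Ordinal hj); rewrite // inE /= Ii Ij.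
Qed.

Lemma rho_pairs_sub I : <<rho_pairs I>>%g \subset Gp.
Proof.
by rewrite gen_subG; apply/subsetP => _ /imsetP[[i j] _ ->]; apply: rho_pair.
Qed.

(* Strong flag-connectedness: a gallery from Phi to g Phi keeping the faces
   fixed by g only uses reflections r_j with j outside I. *)
Lemma stab_parity (I : pred nat) g : g \in Aut_polytope P ->
  (forall i, i < n -> I i -> g (face i.+1) = face i.+1) ->
  g \in <<rho_pairs I>>%g \/
  exists2 k, k < n & ~~ I k /\ (r k * g)%g \in <<rho_pairs I>>%g.
Proof.
move=> gA gI; pose X := [set face (val i).+1 | i : 'I_n & I i].
have XPhi : X \subset Phi.
  by apply/subsetP => _ /imsetP[i _ ->]; apply: flag_face_in => //; exact/leqW/ltn_ord.
have XgPhi : X \subset g @: Phi.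
  apply/subsetP => F /imsetP[i]; rewrite inE => Ii ->.
  rewrite -(gI i) //; apply: imset_f; apply: flag_face_in => //.
  exact/leqW/ltn_ord.
have [h [hA hE]] : exists h, [/\ h \in Aut_polytope P, g @: Phi = h @: Phi &
    h \in <<rho_pairs I>>%g \/
    exists2 k, k < n & ~~ I k /\ (r k * h)%g \in <<rho_pairs I>>%g]; last first.
  by rewrite (aut_eq gA hA fPhi hE).
apply: (@flag_ind_sub _ _ (fun A => exists h, [/\ h \in Aut_polytope P, A = h @: Phi &
    h \in <<rho_pairs I>>%g \/
    exists2 k, k < n & ~~ I k /\ (r k * h)%g \in <<rho_pairs I>>%g]) X Phi)
   => //; first exact: aut_flag.
  by exists 1%g; rewrite group1 imset_perm1; split=> //; left.
move=> A i fA hi XA XiA [h [hA eA hh]].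
have nI : ~~ I i.
  apply/negP => Ii; have Fx : face i.+1 \in X.
    by apply/imsetP; exists (Ordinal hi); rewrite ?inE.
  have := flag_face_adj_neq fA hi.
  have hi1 : i.+1 <= n.+1 by lia.
  have := flag_face_rk fA (subsetP XA _ Fx); rewrite rk_flag_face // => ->.
  have := flag_face_rk (adj_flag fA hi) (subsetP XiA _ Fx).
  by rewrite rk_flag_face // => ->; rewrite eqxx.
exists (r i * h)%g; rewrite rhoM_flag // eA groupM ?rho_aut //; split=> //.
case: hh => [hE|[k hk [nk hE]]].
  by right; exists i => //; rewrite mulgA rho2 // mul1g.
left; have -> : (r i * h = (r i * r k) * (r k * h))%g.
  by rewrite mulgA -(mulgA (r i)) rho2 ?mulg1.
by rewrite groupM // mem_gen // mem_rho_pairs.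
Qed.

Lemma rotation_parity g i : g \in Aut_polytope P -> i < n ->
  g \in Gp \/ (r i * g)%g \in Gp.
Proof.
move=> gA hi; have sub := subsetP (rho_pairs_sub xpred0).
have [//|/sub|[k hk [_ /sub gp]]] := stab_parity (I := xpred0) gA; [by left|right].
have -> : (r i * g = (r i * r k) * (r k * g))%g.
  by rewrite mulgA -(mulgA (r i)) rho2 ?mulg1.
by rewrite groupM // rho_pair.
Qed.

Hypothesis index_rot : #|Aut_polytope P : Gp|%g = 2.

Lemma rho_odd i : i < n -> r i \notin Gp.
Proof.
move=> hi; apply/negP => ri.
have : Aut_polytope P \subset Gp.
  apply/subsetP => g gA; case: (rotation_parity gA hi) => // h.
  by rewrite -(mul1g g) -(rho2 hi) -mulgA groupM.
by rewrite -indexg_eq1 index_rot.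
Qed.

(** In the odd alternative of [stab_parity] both [g] and [r k * g] would be rotations, against
    [rho_odd]. *)
Lemma rotation_stab (I : pred nat) g : g \in Gp ->
  (forall i, i < n -> I i -> g (face i.+1) = face i.+1) ->
  g \in <<rho_pairs I>>%g.
Proof.
move=> gG gI; have gA := subsetP rotation_sub _ gG.
case: (stab_parity gA gI) => // -[k hk [_ /(subsetP (rho_pairs_sub I)) h]].
by have := rho_odd hk; rewrite -(groupMr _ gG) h.
Qed.

(** Regularity provides an automorphism; if it is odd, composing it with [r l] yields a rotation
    with the same effect on the chain, which has no face of rank [l]. *)
Lemma rotation_chain (C : {set P}) l : chain C -> l < n ->
  {in C, forall F, rk F <> l.+1} ->
  exists2 g, g \in Gp & {in C, forall F, g (face (rk F)) = F}.
Proof.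
move=> hC hl nl; have [Psi fPsi sC] := chain_in_flag hC.
have [g gA eg] := regular_transP fPsi.
case: (rotation_parity gA hl) => gp.
  exists g => // F FC.
  by rewrite -aut_flag_face ?rk_le // -eg flag_face_rk // (subsetP sC).
exists (r l * g)%g => // F FC.
rewrite -aut_flag_face ?rk_le //; last exact: (subsetP rotation_sub).
rewrite rhoM_flag // -eg flag_face_adj ?rk_le //; last exact: nl.
by rewrite flag_face_rk // (subsetP sC).
Qed.

End RegularPolytope.

(** * Coset geometries covering a polytope *)

Lemma connect_homo (T T' : finType) (e : rel T) (e' : rel T') (h : T -> T') x y :
  (forall a b, e a b -> e' (h a) (h b)) -> connect e x y -> connect e' (h x) (h y).
Proof.
move=> he /connectP[p]; elim: p x => [|z p IH] x /=; first by move=> _ ->.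
case/andP => /he exz hp hy; exact: connect_trans (connect1 exz) (IH _ hp hy).
Qed.

Section Cover.
Variables (n : nat) (Q : polytope n) (Phi : {set Q}).
Variables (gT : finGroupType) (G : {group gT}).
Variables (f : gT -> {perm Q}) (K : nat -> {group gT}).

(** The index belongs to the face because equal cosets occur for different indices, as for
    [K 0 = K n.+1 = G]. *)
Definition cover_face : Type :=
  {u : 'I_n.+2 * {set gT} | u.2 \in rcosets (K u.1) G}.
HB.instance Definition _ := Finite.on cover_face.

Implicit Types (u v w : cover_face) (g h k : gT).

Notation face i := (flag_face Phi i).
Definition cidx u : nat := (val u).1.
Definition ccoset u : {set gT} := (val u).2.
Notation idx := cidx.
Notation coset := ccoset.
Notation proper_idx i := (0 < i <= n).
Notation proper v := (0 < idx v <= n).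

Definition cover_le : rel cover_face := fun u v =>
  (idx u <= idx v) && (coset u :&: coset v != set0).

(** Independent of the representative, because [K i] fixes the base face of index [i] (see
    [projE]). *)
Definition cover_proj u : Q := f (repr (coset u)) (face (idx u)).
Notation pi := cover_proj.

Hypothesis fPhi : Phi \in flags Q.
Hypothesis fM : {morph f : x y / (x * y)%g}.
Hypothesis fA : forall g, g \in G -> f g \in Aut_polytope Q.
Hypothesis n_ge2 : 2 <= n.
Hypothesis K_sub : forall i, K i \subset G.
Hypothesis K_least : K 0 = G.
Hypothesis K_greatest : K n.+1 = G.
Hypothesis K_fix : forall i g, proper_idx i -> g \in K i -> f g (face i) = face i.
(** [K_meet] tests in [Q] whether an element of [K i] lies in [K j]; [K_trans] says that [K i]
    carries base faces to any two comparable faces in the star of its own base face. Together they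
    allow chains of [Q] to be lifted. *)
Hypothesis K_meet : forall i j g, proper_idx i -> proper_idx j -> g \in K i ->
  f g (face j) = face j -> g \in K j.
Hypothesis K_trans : forall i F H, proper_idx i ->
  (face i >=< F)%O -> (face i >=< H)%O -> (F >=< H)%O ->
  exists2 g, g \in K i & f g (face (rk F)) = F /\ f g (face (rk H)) = H.
Hypothesis K_gen : G \subset <<\bigcup_(i < n.+2 | proper_idx i) K i>>%g.

Lemma cover_f1 : f 1%g = 1%g.
Proof. by apply: (mulgI (f 1%g)); rewrite -fM !mulg1. Qed.

Lemma cover_fV g : f (g^-1)%g = ((f g)^-1)%g.
Proof. by apply: (mulgI (f g)); rewrite -fM !mulgV cover_f1. Qed.

Lemma idx_le u : idx u <= n.+1.
Proof. by rewrite -ltnS; apply: ltn_ord. Qed.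

Lemma fix_face i g : i <= n.+1 -> g \in K i -> f g (face i) = face i.
Proof.
move=> hi gK; have [p|np] := boolP (proper_idx i); first exact: K_fix.
have gG := subsetP (K_sub i) _ gK; have fgA := fA gG.
rewrite -aut_flag_face //; have fl := aut_flag fgA fPhi.
have [->|->] : i = 0 \/ i = n.+1 by lia.
  exact: flag_face0.
exact: flag_facen.
Qed.

Lemma meet_face i j g : proper_idx i -> j <= n.+1 -> g \in K i ->
  f g (face j) = face j -> g \in K j.
Proof.
move=> pi hj gK e; have [p|np] := boolP (proper_idx j); first exact: (K_meet pi p gK e).
have [->|->] : j = 0 \/ j = n.+1 by lia.
  by rewrite K_least (subsetP (K_sub i)).
by rewrite K_greatest (subsetP (K_sub i)).
Qed.

Lemma coset_sub u g : g \in coset u -> g \in G.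
Proof.
rewrite /ccoset ?/cidx; case: u => [[i A] /= /rcosetsP[h hG ->]] /rcosetP[k kK ->].
by rewrite groupM // (subsetP (K_sub i)).
Qed.

Lemma cosetE u g : g \in coset u -> coset u = (K (idx u) :* g)%g.
Proof.
rewrite /ccoset ?/cidx; case: u => [[i A] /= /rcosetsP[h hG ->]] gA.
exact/esym/rcoset_eqP.
Qed.

Lemma coset_ex u : exists g, g \in coset u.
Proof.
rewrite /ccoset ?/cidx; case: u => [[i A] /= /rcosetsP[h hG ->]].
by exists h; rewrite rcoset_refl.
Qed.

Lemma mem_coset u g k : g \in coset u -> (k \in coset u) = ((k * g^-1)%g \in K (idx u)).
Proof. by move=> hg; rewrite (cosetE hg) mem_rcoset. Qed.

Lemma cover_face_eq u v g : idx u = idx v -> g \in coset u -> g \in coset v -> u = v.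
Proof.
move=> e gu gv; apply: val_inj; move: (cosetE gu) (cosetE gv) e.
rewrite /ccoset /cidx; case: (val u) (val v) => [i A] [j B] /= -> -> /val_inj ->.
by [].
Qed.

Lemma cface_subproof : (ord0 : 'I_n.+2, (K (ord0 : 'I_n.+2) :* 1)%g).2 \in
  rcosets (K (ord0 : 'I_n.+2, (K (ord0 : 'I_n.+2) :* 1)%g).1) G.
Proof. by apply/rcosetsP; exists 1%g. Qed.

Definition cface i g : cover_face :=
  insubd (exist _ (ord0 : 'I_n.+2, (K (ord0 : 'I_n.+2) :* 1)%g) cface_subproof : cover_face)
         (inord i : 'I_n.+2, (K (inord i : 'I_n.+2) :* g)%g).

Lemma val_cface i g : i <= n.+1 -> g \in G ->
  val (cface i g) = (inord i : 'I_n.+2, (K i :* g)%g).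
Proof.
move=> hi gG; rewrite insubdK inordK ?ltnS //.
by rewrite -topredE /=; apply/rcosetsP; exists g; rewrite ?inordK.
Qed.

Lemma idx_cface i g : i <= n.+1 -> g \in G -> idx (cface i g) = i.
Proof. by move=> hi gG; rewrite /cidx val_cface //= inordK. Qed.

Lemma cface_refl i g : i <= n.+1 -> g \in G -> g \in coset (cface i g).
Proof. by move=> hi gG; rewrite /ccoset val_cface //= rcoset_refl. Qed.

Lemma cfaceE u g : g \in coset u -> u = cface (idx u) g.
Proof.
move=> gu; have gG := coset_sub gu; have hi := idx_le u.
apply: (@cover_face_eq _ _ g) => //; last by rewrite cface_refl.
by rewrite idx_cface.
Qed.

Lemma projE u g : g \in coset u -> pi u = f g (face (idx u)).
Proof.
move=> gu; rewrite /pi.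
have : repr (coset u) \in coset u by apply: mem_repr gu.
rewrite (mem_coset _ gu) => /(fix_face (idx_le u)).
rewrite fM cover_fV permM => e; apply: (@perm_inj _ ((f g)^-1)%g).
by rewrite e permK.
Qed.

Lemma rk_proj u : rk (pi u) = idx u.
Proof.
have [g gu] := coset_ex u; rewrite (projE gu) aut_rk ?rk_flag_face ?idx_le //.
by apply: fA; apply: coset_sub gu.
Qed.

Lemma proj_mono u v : cover_le u v -> (pi u <= pi v)%O.
Proof.
case/andP => le /set0Pn[g /setIP[gu gv]].
rewrite (projE gu) (projE gv) aut_le; last exact: fA (coset_sub gu).
by rewrite flag_face_le ?idx_le.
Qed.

(* Covering property: over the star of a proper face v, elements of the coset
   of v correspond to rotations of Q, so chains of Q lift uniquely. *)
Lemma star_meet u v w a b : proper v ->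
  a \in coset u -> a \in coset v -> b \in coset w -> b \in coset v ->
  (pi u >=< pi w)%O ->
  exists2 g, g \in coset v & (g \in coset u) && (g \in coset w).
Proof.
move=> pv au av bw bv cuw; have aG := coset_sub au; have bG := coset_sub bw.
have aVA : ((f a)^-1)%g \in Aut_polytope Q by rewrite groupV fA.
have pv' : pi v = f a (face (idx v)) by rewrite (projE av).
have cmp z c : c \in coset z -> c \in coset v -> (pi v >=< pi z)%O.
  move=> cz cv; rewrite (projE cz) (projE cv) aut_comp; last exact: fA (coset_sub cz).
  rewrite /Order.comparable; case/orP: (leq_total (idx v) (idx z)) => le.
    by rewrite flag_face_le ?idx_le.
  by rewrite orbC flag_face_le ?idx_le.
have [||| g0 g0K [eu ew]] := @K_trans (idx v) (((f a)^-1)%g (pi u)) (((f a)^-1)%g (pi w)) pv.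
- by rewrite -[face _](permK (f a)) -pv' aut_comp // (cmp _ a).
- by rewrite -[face _](permK (f a)) -pv' aut_comp // (cmp _ b).
- by rewrite aut_comp.
rewrite !(aut_rk aVA) !rk_proj in eu ew.
have gv : (g0 * a)%g \in coset v by rewrite (mem_coset _ av) mulgK.
exists (g0 * a)%g => //; apply/andP; split.
  rewrite (mem_coset _ au) mulgK; apply: (meet_face pv) => //; first exact: idx_le.
  by rewrite eu (projE au) permK.
rewrite (mem_coset _ bw); apply: (meet_face pv); first exact: idx_le.
  by rewrite -(mem_coset _ bv).
by rewrite !fM !permM cover_fV ew permKV (projE bw) permK.
Qed.

Lemma cover_le_refl : reflexive cover_le.
Proof. by move=> u; have [g gu] := coset_ex u; rewrite /cover_le leqnn setIid; apply/set0Pn; exists g. Qed.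

Lemma cover_le_anti : antisymmetric cover_le.
Proof.
move=> u v /andP[/andP[l1 /set0Pn[g /setIP[gu gv]]] /andP[l2 _]].
apply: cover_face_eq gu gv; apply/eqP.
by rewrite eqn_leq l1 l2.
Qed.

Lemma improper_coset v : ~~ proper v -> coset v = G :> {set gT}.
Proof.
move=> np; have [g gv] := coset_ex v; have gG := coset_sub gv; rewrite (cosetE gv).
have [->|->] : idx v = 0 \/ idx v = n.+1 by have := idx_le v; lia.
  by rewrite K_least rcoset_id.
by rewrite K_greatest rcoset_id.
Qed.

(** Meeting of cosets is not transitive in general. For a proper middle face the three projections
    form a chain of [Q], and [star_meet] lifts it to a common element; an improper middle face
    equals one of the two ends. *)
Lemma cover_le_trans : transitive cover_le.
Proof.
move=> v u w uv vw; have [pv|npv] := boolP (proper v); last first.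
  have [luv /set0Pn[a /setIP[au av]]] := andP uv.
  have [lvw /set0Pn[b /setIP[bv bw]]] := andP vw.
  have [e|e] : idx v = 0 \/ idx v = n.+1 by have := idx_le v; lia.
    suff -> : u = v by [].
    by apply: cover_face_eq au av; lia.
  suff <- : v = w by [].
  by apply: cover_face_eq bv bw; have := idx_le w; lia.
have [luv /set0Pn[a /setIP[au av]]] := andP uv.
have [lvw /set0Pn[b /setIP[bv bw]]] := andP vw.
have [|g _ /andP[gu gw]] := star_meet pv au av bw bv.
  by rewrite /Order.comparable (le_trans (proj_mono uv) (proj_mono vw)).
rewrite /cover_le (leq_trans luv lvw); apply/set0Pn; exists g.
by rewrite inE gu gw.
Qed.

Fact cover_display : Order.disp_t. Proof. exact: (Order.Disp tt tt). Qed.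

HB.instance Definition _ := Order.Le_isPOrder.Build cover_display cover_face
  cover_le_refl cover_le_anti cover_le_trans.

Lemma cover_leE u v : (u <= v)%O = (idx u <= idx v) && (coset u :&: coset v != set0).
Proof. by []. Qed.

Lemma cover_compP u v :
  reflect (exists2 g, g \in coset u & g \in coset v) (u >=< v)%O.
Proof.
rewrite /Order.comparable !cover_leE (setIC (coset v)) -andb_orl leq_total /=.
apply: (iffP (set0Pn _)) => [[g /setIP[gu gv]]|[g gu gv]]; exists g => //.
by rewrite inE gu.
Qed.

Lemma cover_lt_idx u v : (u < v)%O -> idx u < idx v.
Proof.
rewrite lt_neqAle cover_leE => /and3P[ne le /set0Pn[g /setIP[gu gv]]].
rewrite ltn_neqAle le andbT; apply: contraNneq ne => e.
by apply/eqP; apply: cover_face_eq e gu gv.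
Qed.

Lemma proj_le u v : (u <= v)%O -> (pi u <= pi v)%O.
Proof. exact: proj_mono. Qed.

Lemma proj_comp u v : (u >=< v)%O -> (pi u >=< pi v)%O.
Proof. by case/orP => /proj_le h; rewrite /Order.comparable h ?orbT. Qed.

Lemma proj_lt u v : (u < v)%O -> (pi u < pi v)%O.
Proof.
move=> h; rewrite lt_neqAle (proj_le (ltW h)) andbT.
by apply/eqP => /(congr1 (@rk _ _)); rewrite !rk_proj; have := cover_lt_idx h; lia.
Qed.

(** * The projection restricted to the star of a proper face *)

Lemma star_comp v u w : proper v -> (u >=< v)%O -> (w >=< v)%O ->
  (pi u >=< pi w)%O -> (u >=< w)%O.
Proof.
move=> pv /cover_compP[a au av] /cover_compP[b bw bv] h.
have [g _ /andP[gu gw]] := star_meet pv au av bw bv h.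
by apply/cover_compP; exists g.
Qed.

Lemma star_le v u w : proper v -> (u >=< v)%O -> (w >=< v)%O ->
  (pi u <= pi w)%O -> (u <= w)%O.
Proof.
move=> pv uv wv h; have /(star_comp pv uv wv)/cover_compP[g gu gw] : (pi u >=< pi w)%O.
  by rewrite /Order.comparable h.
rewrite cover_leE -!rk_proj rk_leq //=; apply/set0Pn; exists g.
by rewrite inE gu gw.
Qed.

Lemma star_inj v u w : proper v -> (u >=< v)%O -> (w >=< v)%O -> pi u = pi w -> u = w.
Proof.
move=> pv uv wv e; apply/le_anti/andP.
by split; apply: (star_le pv) => //; rewrite e.
Qed.

Lemma star_lt v u w : proper v -> (u >=< v)%O -> (w >=< v)%O ->
  (pi u < pi w)%O = (u < w)%O.
Proof.
move=> pv uv wv; apply/idP/idP; last exact: proj_lt.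
move=> h; rewrite lt_neqAle (star_le pv uv wv (ltW h)) andbT.
by apply/eqP => e; move: h; rewrite e ltxx.
Qed.

Lemma star_surj v F : proper v -> (F >=< pi v)%O -> exists2 u, (u >=< v)%O & pi u = F.
Proof.
move=> pv c; have [a av] := coset_ex v; have aG := coset_sub av.
have aVA : ((f a)^-1)%g \in Aut_polytope Q by rewrite groupV fA.
have pv' : pi v = f a (face (idx v)) by rewrite (projE av).
have c1 : (face (idx v) >=< ((f a)^-1)%g F)%O.
  by rewrite -[face _](permK (f a)) -pv' aut_comp // comparable_sym.
have [g gK [e _]] := K_trans pv c1 c1 (comparablexx _).
rewrite aut_rk // in e.
have gG : (g * a)%g \in G by rewrite groupM // (subsetP (K_sub (idx v))).
exists (cface (rk F) (g * a)%g).
  apply/cover_compP; exists (g * a)%g; first by rewrite cface_refl ?rk_le.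
  by rewrite (mem_coset _ av) mulgK.
rewrite (projE (cface_refl (rk_le F) gG)) idx_cface ?rk_le //.
by rewrite fM permM e permKV.
Qed.

Lemma improper_cmp u v : ~~ proper u -> (u >=< v)%O.
Proof.
move=> npu; have [g gv] := coset_ex v; apply/cover_compP; exists g => //.
by rewrite (improper_coset (v := u)) // (coset_sub gv).
Qed.

(** Improper faces are comparable with everything, so a flag made of them could be enlarged by a
    face of index 1. *)
Lemma flag_proper (C : {set cover_face}) : C \in flags cover_face -> exists2 v, v \in C & proper v.
Proof.
move=> fC; have [/existsP[v /andP[]]|/existsPn no] := boolP [exists v, (v \in C) && proper v].
  by exists v.
have pv : proper (cface 1 1) by rewrite idx_cface //; lia.
exists (cface 1 1) => //; apply: flag_max => // u uC.
rewrite comparable_sym; apply: improper_cmp.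
by have := no u; rewrite uC.
Qed.

Definition star_lift v (D : {set Q}) := [set w | (w >=< v)%O && (pi w \in D)].

Lemma proj_star_lift v (D : {set Q}) : proper v -> {in D, forall F, (F >=< pi v)%O} -> pi @: star_lift v D = D.
Proof.
move=> pv hD; apply/setP => F; apply/imsetP/idP => [[w]|FD].
  by rewrite inE => /andP[_ h] ->.
by have [u uv e] := star_surj pv (hD _ FD); exists u; rewrite // inE uv e.
Qed.

Lemma card_lift v (D : {set Q}) : proper v -> {in D, forall F, (F >=< pi v)%O} -> #|star_lift v D| = #|D|.
Proof.
move=> pv hD; rewrite -{2}(proj_star_lift pv hD) card_in_imset // => u w.
by rewrite !inE => /andP[uv _] /andP[wv _]; apply: (star_inj pv).
Qed.

Lemma flag_star v (D : {set Q}) : D \in flags Q -> pi v \in D -> {in D, forall F, (F >=< pi v)%O}.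
Proof. by move=> fD vD F FD; apply: (flag_comp fD). Qed.

Lemma lift_flag v D : proper v -> D \in flags Q -> pi v \in D -> star_lift v D \in flags cover_face.
Proof.
move=> pv fD vD; apply: max_flag.
  apply/chainP => u w; rewrite !inE => /andP[uv uD] /andP[wv wD].
  by apply: (star_comp pv) => //; apply: (flag_comp fD).
move=> u hu; have uv : (u >=< v)%O by apply: hu; rewrite inE comparablexx.
rewrite inE uv; apply: (flag_max fD) => F FD.
have [w wv e] := star_surj pv (flag_star fD vD FD).
by rewrite -e; apply: proj_comp; apply: hu; rewrite inE wv e.
Qed.

Lemma proj_inj_flag (C : {set cover_face}) : C \in flags cover_face -> {in C &, injective pi}.
Proof.
move=> fC u w uC wC e; have [v vC pv] := flag_proper fC.
by apply: (star_inj pv) => //; apply: (flag_comp fC).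
Qed.

Lemma proj_flag (C : {set cover_face}) : C \in flags cover_face -> pi @: C \in flags Q.
Proof.
move=> fC; have [v vC pv] := flag_proper fC; apply: max_flag.
  apply/chainP => _ _ /imsetP[u uC ->] /imsetP[w wC ->].
  by apply: proj_comp; apply: (flag_comp fC).
move=> F hF; have [u uv e] := star_surj pv (hF _ (imset_f pi vC)).
rewrite -e; apply: imset_f; apply: (flag_max fC) => w wC; apply: (star_comp pv) => //.
  exact: (flag_comp fC).
by rewrite e; apply: hF; apply: imset_f.
Qed.

Lemma lift_proj v (C : {set cover_face}) : C \in flags cover_face -> v \in C -> proper v ->
  star_lift v (pi @: C) = C.
Proof.
move=> fC vC pv; apply/setP => w; rewrite inE; apply/andP/idP => [[wv]|wC].
  case/imsetP => c cC e; suff -> : w = c by [].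
  by apply: (star_inj pv) => //; apply: (flag_comp fC).
by rewrite (flag_comp fC) // imset_f.
Qed.

Lemma cover_card_flag (C : {set cover_face}) : C \in flags cover_face -> #|C| = n.+2.
Proof.
move=> fC; rewrite -(card_flag (proj_flag fC)) card_in_imset //.
exact: proj_inj_flag.
Qed.

(** * Rank, diamond condition and connectedness of the cover *)

Definition cover_rank u : int := ((idx u)%:Z - 1)%R.

Lemma cover_rank_bounds u : (-1 <= cover_rank u <= n%:Z)%R.
Proof. by rewrite /cover_rank; have := idx_le u; lia. Qed.

Lemma cover_rank_lt u v : (u < v)%O -> (cover_rank u < cover_rank v)%R.
Proof. by move/cover_lt_idx; rewrite /cover_rank; lia. Qed.

Lemma improper_leP u v : ~~ proper u || ~~ proper v -> idx u <= idx v -> (u <= v)%O.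
Proof.
move=> np le; rewrite cover_leE le /=.
have /cover_compP[g gu gv] : (u >=< v)%O.
  case/orP: np => np; first exact: improper_cmp.
  by rewrite comparable_sym; apply: improper_cmp.
by apply/set0Pn; exists g; rewrite inE gu gv.
Qed.

Lemma cover_least : exists u, forall v, (u <= v)%O.
Proof.
exists (cface 0 1) => v; have e : idx (cface 0 1) = 0 by rewrite idx_cface.
by apply: improper_leP; rewrite e.
Qed.

Lemma cover_greatest : exists u, forall v, (v <= u)%O.
Proof.
exists (cface n.+1 1) => v; have e : idx (cface n.+1 1) = n.+1 by rewrite idx_cface.
by apply: improper_leP; rewrite e ?idx_le // ltnn !andbF orbT.
Qed.

Lemma interval_card v u w : proper v -> (u >=< v)%O -> (w >=< v)%O ->
  (forall x : cover_face, (u < x < w)%O -> (x >=< v)%O) ->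
  (forall F : Q, (pi u < F < pi w)%O -> (F >=< pi v)%O) ->
  #|[set x : cover_face | (u < x < w)%O]| = #|[set F : Q | (pi u < F < pi w)%O]|.
Proof.
move=> pv uv wv h1 h2.
have -> : [set F : Q | (pi u < F < pi w)%O] = pi @: [set x | (u < x < w)%O].
  apply/setP => F; rewrite inE; apply/idP/imsetP => [hF|[x]].
    have [x xv e] := star_surj pv (h2 _ hF); exists x => //.
    by rewrite inE -!(star_lt pv) // e.
  by rewrite inE => /andP[a b] ->; rewrite !proj_lt.
rewrite card_in_imset // => x y; rewrite !inE => /h1 xv /h1 yv.
exact: (star_inj pv).
Qed.

Lemma cover_diamond u w : (u < w)%O -> cover_rank w = (cover_rank u + 2)%R ->
  #|[set x : cover_face | (u < x < w)%O]| = 2.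
Proof.
move=> uw e; have e' : idx w = (idx u).+2 by move: e; rewrite /cover_rank; lia.
have hd : #|[set F : Q | (pi u < F < pi w)%O]| = 2.
  by apply: diamond; rewrite ?proj_lt // !face_rankE !rk_proj; lia.
have hw := idx_le w.
have [pu|npu] := boolP (proper u).
  rewrite (@interval_card u) ?comparablexx //.
  - by rewrite comparable_sym /Order.comparable (ltW uw).
  - by move=> x /andP[ux _]; rewrite /Order.comparable (ltW ux) orbT.
  by move=> x /andP[ux _]; rewrite /Order.comparable (ltW ux) orbT.
(* An improper [u] below [w] has index 0, so [w] has index 2, which is proper because [2 <= n]. *)
have pw : proper w by lia.
rewrite (@interval_card w) ?comparablexx //.
- by rewrite /Order.comparable (ltW uw).
- by move=> x /andP[_ ux]; rewrite /Order.comparable (ltW ux).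
by move=> x /andP[_ ux]; rewrite /Order.comparable (ltW ux).
Qed.

Lemma lift_setD v C D : star_lift v C :\: star_lift v D = star_lift v (C :\: D).
Proof. by apply/setP => w; rewrite !inE; case: (w >=< v)%O. Qed.

(** A gallery of [Q] joining the two projections keeps [pi v], so it lifts flag by flag through the
    star of [v]. *)
Lemma joined_star (A B : {set cover_face}) v : A \in flags cover_face ->
  B \in flags cover_face -> v \in A -> v \in B -> proper v -> strongly_joined A B.
Proof.
move=> flA flB vA vB pv.
have := strong_flag_connectedness (proj_flag flA) (proj_flag flB).
rewrite /strongly_joined => hc.
rewrite -[X in connect _ X _](lift_proj flA vA pv) -[X in connect _ _ X](lift_proj flB vB pv).
apply: connect_homo hc => C D /and5P[fC fD /andP[c1 c2] sC sD].
have vI : pi v \in pi @: A :&: pi @: B by rewrite inE !imset_f.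
have vC := subsetP sC _ vI; have vD := subsetP sD _ vI.
have hs X : X \in flags Q -> pi v \in X -> forall Y, {in X :\: Y, forall F, (F >=< pi v)%O}.
  by move=> fX vX Y F /setDP[FX _]; apply: (flag_star fX).
have hsub (X : {set Q}) : pi @: A :&: pi @: B \subset X -> A :&: B \subset star_lift v X.
  move=> sX; apply/subsetP => c /setIP[cA cB]; rewrite inE (flag_comp flA) //=.
  by apply: (subsetP sX); rewrite inE !imset_f.
have k1 := card_lift pv (hs C fC vC D); have k2 := card_lift pv (hs D fD vD C).
by rewrite /= !lift_flag // !hsub // /adjacent !lift_setD k1 k2 c1 c2.
Qed.

Definition flag_rel : rel {set cover_face} :=
  [rel A B | [&& A \in flags cover_face, B \in flags cover_face & adjacent A B]].

Lemma joined_connect (A B : {set cover_face}) : strongly_joined A B -> connect flag_rel A B.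
Proof.
apply: (@connect_homo _ _ _ _ id) => C D /and5P[fC fD a _ _].
by rewrite /flag_rel /= fC fD.
Qed.

Definition base_flag g : {set cover_face} := [set cface (val i) g | i : 'I_n.+2].

Lemma base_flagP g : g \in G -> base_flag g \in flags cover_face.
Proof.
move=> gG; apply: max_flag.
  apply/chainP => _ _ /imsetP[i _ ->] /imsetP[j _ ->].
  by apply/cover_compP; exists g; apply: cface_refl => //; rewrite -ltnS; apply: ltn_ord.
move=> u hu.
have /hu/cover_compP[h hhu hh] : cface (idx u) g \in base_flag g.
  by apply/imsetP; exists (val u).1.
suff -> : u = cface (idx u) g by apply/imsetP; exists (val u).1.
by apply: cover_face_eq hhu hh; rewrite idx_cface ?idx_le.
Qed.

Lemma cface_base i g : i <= n.+1 -> cface i g \in base_flag g.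
Proof. by move=> hi; apply/imsetP; exists (inord i); rewrite //= inordK. Qed.

(** The elements that leave every base flag in its component form a subgroup. It contains [K i],
    since [base_flag y] and [base_flag (k * y)] share the face of index [i] when [k] is in [K i]. *)
Lemma connect_base g h : g \in G -> h \in G -> connect flag_rel (base_flag h) (base_flag (g * h)%g).
Proof.
pose H := [set g in G | [forall h in G, connect flag_rel (base_flag h) (base_flag (g * h)%g)]].
have HP x : reflect (x \in G /\ (forall y, y \in G -> connect flag_rel (base_flag y) (base_flag (x * y)%g))) (x \in H).
  by rewrite inE; apply: (iffP andP) => -[xG /forall_inP].
have gH : group_set H.
  apply/group_setP; split; first by apply/HP; split=> // y _; rewrite mul1g.
  move=> x y /HP[xG hx] /HP[yG hy]; apply/HP; split; first exact: groupM.
  move=> z zG; rewrite -mulgA; apply: connect_trans (hy _ zG) (hx _ _).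
  exact: groupM.
suff sGH : G \subset H by move=> /(subsetP sGH)/HP[_ hg] /hg.
apply: subset_trans K_gen _; change (<<\bigcup_(i < n.+2 | proper_idx i) K i>>%g \subset Group gH).
rewrite gen_subG; apply/bigcupsP => i pi; apply/subsetP => k kK.
have kG := subsetP (K_sub i) _ kK; have hi : i <= n.+1 by rewrite -ltnS.
apply/HP; split => // y yG; have kyG : (k * y)%g \in G by rewrite groupM.
apply: joined_connect; apply: (@joined_star _ _ (cface i y)); rewrite ?base_flagP ?cface_base //.
  suff -> : cface i y = cface i (k * y)%g by rewrite cface_base.
  apply: (@cover_face_eq _ _ (k * y)%g); first by rewrite !idx_cface.
    by rewrite (mem_coset _ (cface_refl hi yG)) mulgK idx_cface.
  by rewrite cface_refl.
by rewrite idx_cface.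
Qed.

Lemma flag_rel_sym : connect_sym flag_rel.
Proof.
apply: sym_connect_sym => C D.
by rewrite /flag_rel /= /adjacent andbCA [in RHS](andbC (#|_| == 1)).
Qed.

Lemma connect_flags (A B : {set cover_face}) : A \in flags cover_face -> B \in flags cover_face ->
  connect flag_rel A B.
Proof.
have toB C : C \in flags cover_face -> connect flag_rel C (base_flag 1).
  move=> fC; have [v vC pv] := flag_proper fC; have [g gv] := coset_ex v.
  have gG := coset_sub gv; apply: (@connect_trans _ _ (base_flag g)).
    apply: joined_connect; apply: (@joined_star _ _ v) => //; first exact: base_flagP.
    by rewrite (cfaceE gv) cface_base ?idx_le.
  by rewrite flag_rel_sym; have := connect_base gG (group1 G); rewrite mulg1.
by move=> flA flB; apply: (connect_trans (toB _ flA)); rewrite flag_rel_sym toB.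
Qed.

(** If the common faces of [A] and [B] are all improper, every flag contains them, and plain
    connectedness is already strong connectedness. *)
Lemma cover_connected (A B : {set cover_face}) : A \in flags cover_face -> B \in flags cover_face ->
  strongly_joined A B.
Proof.
move=> flA flB.
have [/existsP[v /andP[/setIP[vA vB] pv]]|/existsPn no] := boolP [exists v, (v \in A :&: B) && proper v].
  exact: joined_star vA vB pv.
have sub C : C \in flags cover_face -> A :&: B \subset C.
  move=> fC; apply/subsetP => c cI; apply: (flag_max fC) => w _.
  by apply: improper_cmp; have := no c; rewrite cI.
apply: (@connect_homo _ _ _ _ id) (connect_flags flA flB) => C D /and3P[fC fD a].
by rewrite /= fC fD a !sub.
Qed.

Definition cover_polytope : polytope n :=
  @Polytope n cover_display cover_face cover_rank cover_rank_bounds cover_rank_lt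
    cover_least cover_greatest cover_card_flag cover_connected cover_diamond.

Notation P := cover_polytope.

(** * Base flags and right translations *)

Definition bflag g : {set P} := base_flag g.

Lemma bflagP g : g \in G -> bflag g \in flags P.
Proof. exact: base_flagP. Qed.

Lemma cface_bflag i g : i <= n.+1 -> (cface i g : P) \in bflag g.
Proof. exact: cface_base. Qed.

Lemma rk_cover (u : P) : rk u = idx u.
Proof. by rewrite /rk /= /cover_rank; lia. Qed.

Lemma cface_mul i k g : i <= n.+1 -> k \in K i -> g \in G -> cface i (k * g)%g = cface i g.
Proof.
move=> hi kK gG; have kG := subsetP (K_sub i) _ kK.
have kgG : (k * g)%g \in G by rewrite groupM.
apply: (@cover_face_eq _ _ (k * g)%g); first by rewrite !idx_cface.
  by rewrite cface_refl.
by rewrite (mem_coset _ (cface_refl hi gG)) mulgK idx_cface.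
Qed.

Lemma proj_cface i g : i <= n.+1 -> g \in G -> pi (cface i g) = f g (face i).
Proof. by move=> hi gG; rewrite (projE (cface_refl hi gG)) idx_cface. Qed.

Lemma flag_face_base i g : i <= n.+1 -> g \in G ->
  flag_face (bflag g) i = cface i g.
Proof.
move=> hi gG; have fg := bflagP gG.
have h : (cface i g : P) \in bflag g by apply: cface_bflag.
by rewrite -[RHS](flag_face_rk fg h) rk_cover idx_cface.
Qed.

(** Right multiplication by [h], made the identity outside [G] so that it is a permutation for every
    [h]. *)
Definition translate_fun h u : cover_face :=
  cface (idx u) (repr (coset u) * (if h \in G then h else 1))%g.

Lemma translate_funE h u g : h \in G -> g \in coset u ->
  translate_fun h u = cface (idx u) (g * h)%g.
Proof.
move=> hG gu; rewrite /translate_fun hG; have gG := coset_sub gu.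
have : repr (coset u) \in coset u by apply: mem_repr gu.
rewrite (mem_coset _ gu) => kK; set k := repr _ in kK *.
have -> : (k * h = (k * g^-1) * (g * h))%g by rewrite mulgA mulgKV.
by apply: cface_mul => //; [apply: idx_le | apply: groupM].
Qed.

Lemma translate_fun_out h u : h \notin G -> translate_fun h u = u.
Proof.
move=> hG; rewrite /translate_fun (negPf hG) mulg1 -cfaceE //.
by have [g gu] := coset_ex u; apply: mem_repr gu.
Qed.

Lemma mem_translate_fun h u x : h \in G ->
  (x \in coset (translate_fun h u)) = ((x * h^-1)%g \in coset u).
Proof.
move=> hG; have [g gu] := coset_ex u; have gG := coset_sub gu.
rewrite (translate_funE hG gu) (mem_coset _ gu).
have ghG : (g * h)%g \in G by apply: groupM.
rewrite (mem_coset _ (cface_refl (idx_le u) ghG)) (idx_cface (idx_le u) ghG).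
by rewrite invgM mulgA.
Qed.

Lemma idx_translate_fun h u : h \in G -> idx (translate_fun h u) = idx u.
Proof.
move=> hG; have [g gu] := coset_ex u; have gG := coset_sub gu.
by rewrite (translate_funE hG gu) idx_cface ?idx_le ?groupM.
Qed.

Lemma translate_fun_inj h : injective (translate_fun h : P -> P).
Proof.
have [hG|hG] := boolP (h \in G); last by move=> u v; rewrite !translate_fun_out.
move=> u v e; have [g gu] := coset_ex u.
apply: (@cover_face_eq u v g) => //.
  by rewrite -(idx_translate_fun u hG) e idx_translate_fun.
by rewrite -(mulgK h g) -mem_translate_fun // -e mem_translate_fun // mulgK.
Qed.

Definition translate h : {perm P} := perm (@translate_fun_inj h).
Notation tr := translate.

Lemma translate_cface h i g : i <= n.+1 -> g \in G -> h \in G ->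
  tr h (cface i g) = cface i (g * h)%g.
Proof.
move=> hi gG hG; rewrite permE (translate_funE hG (cface_refl hi gG)).
by rewrite idx_cface.
Qed.

Lemma translate_aut h : h \in G -> tr h \in Aut_polytope P.
Proof.
move=> hG; rewrite inE; apply/'forall_'forall_eqP => u v.
rewrite !permE !cover_leE !idx_translate_fun //; congr (_ && _).
apply/set0Pn/set0Pn => -[x /setIP[]].
  by rewrite !mem_translate_fun // => a b; exists (x * h^-1)%g; rewrite inE a b.
by move=> a b; exists (x * h)%g; rewrite inE !mem_translate_fun // mulgK a b.
Qed.

Lemma translateM : {in G &, {morph tr : x y / (x * y)%g}}.
Proof.
move=> x y xG yG; apply/permP => u; rewrite permM.
have [g gu] := coset_ex u; have gG := coset_sub gu.
by rewrite (cfaceE gu) !translate_cface ?idx_le ?groupM // mulgA.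
Qed.
Canonical translate_morphism := Morphism translateM.

Lemma translate_base h g : h \in G -> g \in G -> tr h @: bflag g = bflag (g * h)%g.
Proof.
move=> hG gG; apply/eqP; rewrite eqEcard card_imset; last exact: perm_inj.
rewrite !(@card_flag _ P) ?leqnn ?andbT //; try by apply: bflagP; rewrite ?groupM.
apply/subsetP => _ /imsetP[_ /imsetP[i _ ->] ->].
have hi : i <= n.+1 by rewrite -ltnS.
by rewrite translate_cface // cface_bflag.
Qed.

Lemma proj_base g : g \in G -> pi @: bflag g = f g @: Phi.
Proof.
move=> gG; have fA' := fA gG; apply/eqP; rewrite eqEcard.
rewrite (card_flag (proj_flag (bflagP gG))) (card_flag (aut_flag fA' fPhi)) leqnn andbT.
apply/subsetP => _ /imsetP[_ /imsetP[i _ ->] ->].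
have hi : i <= n.+1 by rewrite -ltnS.
by rewrite proj_cface // imset_f // flag_face_in.
Qed.

Implicit Types A B : {set P}.

Lemma flag_face_proj A i : A \in flags P -> i <= n.+1 ->
  flag_face (pi @: A) i = pi (flag_face A i).
Proof.
move=> flA hi; have h : pi (flag_face A i) \in pi @: A by rewrite imset_f // flag_face_in.
by rewrite -(flag_face_rk (proj_flag flA) h) rk_proj -rk_cover rk_flag_face.
Qed.

Lemma flag_proj_inj A B v : A \in flags P -> B \in flags P -> v \in A -> v \in B ->
  proper v -> pi @: A = pi @: B -> A = B.
Proof. by move=> flA flB vA vB pv e; rewrite -(lift_proj flA vA pv) e lift_proj. Qed.

Lemma flag_adj_common A l m : A \in flags P -> l < n -> m <= n.+1 -> m <> l.+1 ->
  flag_face A m \in adj l A.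
Proof.
move=> flA hl hm ne; rewrite -(flag_face_adj flA hl hm ne).
by apply: flag_face_in; rewrite ?adj_flag.
Qed.

Lemma proj_adj A l : A \in flags P -> l < n -> pi @: adj l A = adj l (pi @: A).
Proof.
move=> flA hl; have flB := adj_flag flA hl.
apply: adj_uniq; rewrite ?proj_flag //; last first.
  by move=> j hj ne; rewrite !flag_face_proj // flag_face_adj.
apply/eqP => e; have /eqP[] := adj_neq flA hl.
(* A proper index other than [l.+1]: [A] and [adj l A] share a proper face, above which a flag is
   determined by its projection. *)
pose m := if l == 0 then 2 else 1.
have [m1 m2 m3] : [/\ m <= n.+1, proper_idx m & m <> l.+1] by rewrite /m; case: eqP => ?; split; lia.
apply: (@flag_proj_inj _ _ (flag_face A m)) => //; first exact: flag_adj_common.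
  exact: flag_face_in.
by rewrite -rk_cover rk_flag_face.
Qed.

(** * The two classes of flags *)

Hypothesis K_triv : forall g, (forall i, proper_idx i -> g \in K i) -> g = 1%g.
(** By [adj_lift] two successive adjacencies at the base flag are realized by an element of [G]; by
    [f_even] a single one never is. This is what splits the flags into two classes. *)
Hypothesis adj_lift : forall l l', l < n -> l' < n -> exists m k,
  [/\ proper_idx m, m <> l.+1, m <> l'.+1, k \in K m & f k @: Phi = adj l' (adj l Phi)].
Hypothesis f_even : forall g l, g \in G -> l < n -> f g @: Phi <> adj l Phi.

Lemma injm_translate : ('injm tr)%g.
Proof.
apply/injmP => x y xG yG e; apply/eqP; rewrite eq_mulgV1; apply/eqP.
apply: K_triv => i pi; have hi : i <= n.+1 by lia.
have : tr x (cface i 1) = tr y (cface i 1) by rewrite e.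
rewrite !translate_cface // !mul1g => e2; have := cface_refl hi xG.
by rewrite e2 (mem_coset _ (cface_refl hi yG)) idx_cface.
Qed.

Lemma base_adj_lift l l' k m : l < n -> l' < n -> proper_idx m ->
  m <> l.+1 -> m <> l'.+1 -> k \in K m -> f k @: Phi = adj l' (adj l Phi) ->
  adj l' (adj l (bflag 1)) = bflag k.
Proof.
move=> hl hl' pm ml ml' kK e; have kG := subsetP (K_sub m) _ kK.
have hm : m <= n.+1 by lia.
have fb := bflagP (group1 G); have fk := bflagP kG.
have fl := adj_flag (fb) hl.
have f2 := adj_flag fl hl'.
apply: (@flag_proj_inj _ _ (cface m 1)) => //.
- have -> : cface m 1 = flag_face (adj l (bflag 1)) m.
    by rewrite flag_face_adj // flag_face_base.
  exact: flag_adj_common.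
- by rewrite -(cface_mul hm kK (group1 G)) mulg1 cface_bflag.
- by rewrite idx_cface.
by rewrite !proj_adj // !proj_base // cover_f1 imset_perm1.
Qed.

Lemma base_adj2 l l' g : l < n -> l' < n -> g \in G ->
  exists2 h, h \in G & adj l' (adj l (bflag g)) = bflag h.
Proof.
move=> hl hl' gG; have [m [k [pm ml ml' kK e]]] := adj_lift hl hl'.
have kG := subsetP (K_sub m) _ kK; exists (k * g)%g; first exact: groupM.
have fb := bflagP (group1 G).
rewrite -(translate_base gG kG) -(base_adj_lift hl hl' pm ml ml' kK e).
rewrite !(aut_adj (translate_aut gG)) ?adj_flag //.
by rewrite translate_base // mul1g.
Qed.

Lemma base_adj_odd l g h : l < n -> g \in G -> h \in G ->
  adj l (bflag g) <> bflag h.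
Proof.
move=> hl gG hG /(congr1 (fun A : {set P} => pi @: A)).
rewrite proj_adj ?bflagP // !proj_base // => e.
apply: (@f_even (h * g^-1)%g l) => //; first by rewrite groupM ?groupV.
rewrite fM imset_permM -e (aut_adj (fA (groupVr gG))) ?aut_flag ?fA //.
by rewrite -imset_permM -fM mulgV cover_f1 imset_perm1.
Qed.

Definition even_flag A := [exists g in G, A == bflag g].

Lemma even_flagP A : reflect (exists2 g, g \in G & A = bflag g) (even_flag A).
Proof. by apply: (iffP exists_inP) => -[g gG /eqP]; exists g => //; apply/eqP. Qed.

(** Two adjacencies lead from a translate of the base flag to a translate, one never does; the
    alternation then propagates along galleries. *)
Lemma flag_parity A l : A \in flags P -> l < n -> even_flag (adj l A) = ~~ even_flag A.
Proof.
move=> flA; pose T B := forall l, l < n -> even_flag (adj l B) = ~~ even_flag B.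
suff : T A by move=> h /h.
apply: (@flag_ind _ P T (bflag 1)) => //; first exact: bflagP.
  move=> k hk; have -> : even_flag (bflag 1) by apply/even_flagP; exists 1%g.
  by apply/negbTE/negP => /even_flagP[g gG e]; apply: (base_adj_odd hk _ gG e).
move=> B i flB hi TB k hk; rewrite (TB i) // negbK.
have [/even_flagP[g gG eB]|oB] := boolP (even_flag B).
  by rewrite eB; have [h hG ->] := base_adj2 hi hk gG; apply/even_flagP; exists h.
have /even_flagP[g gG eg] : even_flag (adj i B) by rewrite TB.
by apply/negbTE/negP => /even_flagP[h hG]; rewrite eg; apply: base_adj_odd.
Qed.

Lemma even_translate h A : h \in G -> even_flag (tr h @: A) = even_flag A.
Proof.
move=> hG; apply/even_flagP/even_flagP => -[g gG e]; last first.
  by exists (g * h)%g; rewrite ?groupM // e translate_base.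
exists (g * h^-1)%g; first by rewrite groupM ?groupV.
rewrite -translate_base ?groupV // -e -imset_permM -translateM ?groupV //.
by rewrite mulgV (morph1 translate_morphism) imset_perm1.
Qed.

(** * Conjugation by a hypothetical reflection of the cover *)

Lemma swap_even s l A : s \in Aut_polytope P -> l < n -> A \in flags P ->
  s @: bflag 1 = adj l (bflag 1) -> even_flag (s @: A) = ~~ even_flag A.
Proof.
move=> sA hl flA es; have fb := bflagP (group1 G).
apply: (@flag_ind _ P (fun A => even_flag (s @: A) = ~~ even_flag A) (bflag 1)) => //.
  by rewrite es flag_parity.
by move=> B i flB hi e; rewrite aut_adj // !flag_parity ?aut_flag // e.
Qed.

(** The reflection exchanges the two classes of flags, so its conjugates of translations preserve
    each class and are again translations. *)
Lemma swap_conj s l g : s \in Aut_polytope P -> l < n -> g \in G ->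
  s @: bflag 1 = adj l (bflag 1) ->
  exists2 h, h \in G & (tr g ^ s = tr h)%g.
Proof.
move=> sA hl gG es; have fb := bflagP (group1 G).
have fg := bflagP gG.
have : even_flag (adj l (s @: bflag g)).
  rewrite flag_parity ?aut_flag // (swap_even sA hl fg es) negbK.
  by apply/even_flagP; exists g.
case/even_flagP => h hG eh; exists h => //.
have e2 : s @: bflag g = adj l (bflag h) by rewrite -eh adjK ?aut_flag.
apply: (@aut_eq _ P _ _ (adj l (bflag 1))); rewrite ?adj_flag ?translate_aut //.
  by rewrite groupJ ?translate_aut.
rewrite -es /conjg !imset_permM -(imset_permM s) mulgV imset_perm1 translate_base //.
by rewrite mul1g e2 es aut_adj ?translate_aut // translate_base // mul1g.
Qed.

Lemma swap_conj_flag s l g : s \in Aut_polytope P -> l < n -> g \in G ->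
  s @: bflag 1 = adj l (bflag 1) ->
  (tr g ^ s)%g @: adj l (bflag 1) = s @: bflag g.
Proof.
move=> sA hl gG es; rewrite -es /conjg !imset_permM -(imset_permM s) mulgV imset_perm1.
by rewrite translate_base // mul1g.
Qed.

(** Adjacencies at ranks below [l - 1] commute with [adj l], hence the rotation [g] that they define
    commutes with [s]. *)
Lemma swap_commute s l i j g : s \in Aut_polytope P -> l < n -> g \in G ->
  s @: bflag 1 = adj l (bflag 1) -> i.+1 < l -> j.+1 < l ->
  adj i (adj j (bflag 1)) = bflag g -> (tr g ^ s = tr g)%g.
Proof.
move=> sA hl gG es il jl eg; have fb := bflagP (group1 G).
have [hi hj] : i < n /\ j < n by lia.
apply: (@aut_eq _ P _ _ (adj l (bflag 1))); rewrite ?adj_flag ?translate_aut //.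
  by rewrite groupJ ?translate_aut.
rewrite (swap_conj_flag sA hl gG es).
have -> : s @: bflag g = adj i (adj j (adj l (bflag 1))).
  by rewrite -eg !(aut_adj sA) ?adj_flag // es.
have -> : tr g @: adj l (bflag 1) = adj l (adj i (adj j (bflag 1))).
  by rewrite (aut_adj (translate_aut gG)) // translate_base // mul1g eg.
by rewrite (adjC fb jl hl) adjC ?adj_flag.
Qed.

(** Conjugation by [s] moves the starting flag to its [l]-adjacent flag, from which the two
    adjacencies defining [g] are met in the opposite order. *)
Lemma swap_invert s l j g : s \in Aut_polytope P -> l < n -> g \in G ->
  s @: bflag 1 = adj l (bflag 1) -> j < n ->
  adj j (adj l (bflag 1)) = bflag g -> (tr g ^ s = (tr g)^-1)%g.
Proof.
move=> sA hl gG es hj eg; have fb := bflagP (group1 G).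
apply: (@aut_eq _ P _ _ (adj l (bflag 1))); rewrite ?adj_flag ?groupV ?translate_aut //.
  by rewrite groupJ ?translate_aut.
rewrite (swap_conj_flag sA hl gG es).
have -> : s @: bflag g = adj j (bflag 1).
  by rewrite -eg !(aut_adj sA) ?adj_flag // es adjK.
have -> : adj l (bflag 1) = tr g @: adj j (bflag 1).
  by rewrite (aut_adj (translate_aut gG)) // translate_base // mul1g -eg adjK ?adj_flag.
by rewrite -imset_permM mulgV imset_perm1.
Qed.

Lemma cover_type ps : size ps = n.-1 ->
  (forall i, 0 < i < n -> exists2 g, g \in G &
     adj i.-1 (adj i (bflag 1)) = bflag g /\ #[g]%g = nth 0 ps i.-1) ->
  has_type P ps.
Proof.
move=> sps hps; split=> // A i flA hi; have [g gG [eg og]] := hps i hi.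
have fb := bflagP (group1 G).
have [hi1 hi2] : i < n /\ i.-1 < n by lia.
have rot B : even_flag B -> exists2 s, s \in Aut_polytope P &
    s @: B = adj i.-1 (adj i B) /\ #[s]%g = nth 0 ps i.-1.
  case/even_flagP => h hG ->; exists (tr (g ^ h)%g); first by rewrite translate_aut // groupJ.
  split; last first.
    by rewrite -og -(orderJ g h) (order_injm injm_translate) // groupJ.
  rewrite translate_base ?groupJ // -conjgC -translate_base // -eg.
  by rewrite !aut_adj ?adj_flag ?translate_aut // translate_base // mul1g.
have [ev|od] := boolP (even_flag A).
  have [s sA [es os]] := rot _ ev; exists s => //; rewrite /is_rotation sA /=.
  apply/existsP; exists (adj i A); rewrite !adjacent_atE ?adj_flag // es.
  by rewrite !eqxx.
(* At an odd flag, the inverse of the rotation at the even flag [adj i A] is the required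
   rotation. *)
have flB := adj_flag flA hi1.
have [|s sA [es os]] := rot (adj i A); first by rewrite flag_parity.
exists (s^-1)%g; last by rewrite orderV.
rewrite /is_rotation groupV sA /=; apply/existsP; exists (adj i A).
rewrite !adjacent_atE ?adj_flag // eqxx /=; rewrite adjK // in es.
apply/eqP; apply: (imset_inj (@perm_inj _ s)); rewrite -imset_permM mulVg imset_perm1.
by rewrite aut_adj // es adjK.
Qed.

(** * Automorphism group and chirality of the cover *)

Section Chiral.
Variable l0 : nat.
Hypothesis hl0 : l0 < n.
Hypothesis no_swap : forall s, s \in Aut_polytope P ->
  s @: bflag 1 <> adj l0 (bflag 1).

(** An automorphism sending the base flag to an odd flag would, after a translation, be the swap
    excluded by [no_swap]. *)
Lemma aut_even s : s \in Aut_polytope P -> even_flag (s @: bflag 1).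
Proof.
move=> sA; have fb := bflagP (group1 G).
case: (boolP (even_flag (s @: bflag 1))) => // od.
have : even_flag (adj l0 (s @: bflag 1)).
  by rewrite flag_parity ?aut_flag.
case/even_flagP => g gG e.
case: (@no_swap (s * (tr g)^-1)%g); first by rewrite groupM ?groupV ?translate_aut.
have -> : (s * (tr g)^-1)%g @: bflag 1 = ((tr g)^-1)%g @: (tr g @: adj l0 (bflag 1)).
  rewrite imset_permM (aut_adj (translate_aut gG)) // translate_base // mul1g -e.
  by rewrite adjK ?aut_flag.
by rewrite -imset_permM mulgV imset_perm1.
Qed.

Lemma aut_translate : Aut_polytope P = (tr @* G)%g.
Proof.
apply/setP => s; apply/idP/morphimP => [sA|[g _ gG ->]]; last exact: translate_aut.
have /even_flagP[g gG e] := aut_even sA; exists g => //.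
apply: (aut_eq sA (translate_aut gG) (bflagP (group1 G))).
by rewrite e translate_base ?mul1g.
Qed.

Lemma aut_isog : Aut_polytope P \isog G.
Proof.
rewrite aut_translate; apply: isog_symr; apply: sub_isog => //.
exact: injm_translate.
Qed.

Lemma aut_even_flag s A : s \in Aut_polytope P -> even_flag (s @: A) = even_flag A.
Proof. by rewrite aut_translate => /morphimP[g _ gG ->]; apply: even_translate. Qed.

(** The orbits are the two parity classes: translations act transitively on each of them, and
    adjacency changes the class. *)
Lemma cover_chiral : chiral P.
Proof.
have fb := bflagP (group1 G).
pose O A := orbit 'P^*%act (Aut_polytope P) A.
have Oev A B : B \in O A -> even_flag B = even_flag A.
  case/orbitP => s sA e; have -> : B = s @: A by rewrite -e; apply: setactE.
  exact: aut_even_flag.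
have OE A : even_flag A -> O A = O (bflag 1).
  case/even_flagP => g gG ->; apply/orbit_eqP; apply/orbitP; exists (tr g).
    exact: translate_aut.
  transitivity (tr g @: bflag 1); first exact: setactE.
  by rewrite translate_base // mul1g.
split; last first.
  move=> A B flA flB /(adjacent_adj flA flB)[i hi ->]; apply/negP => /Oev.
  by rewrite flag_parity //; case: even_flag.
have OO A : A \in flags P -> ~~ even_flag A -> O A = O (adj l0 (bflag 1)).
  move=> flA oA; have : even_flag (adj l0 A) by rewrite flag_parity.
  case/even_flagP => g gG e; apply/orbit_eqP; apply/orbitP; exists (tr g).
    exact: translate_aut.
  transitivity (tr g @: adj l0 (bflag 1)); first exact: setactE.
  by rewrite aut_adj ?translate_aut // translate_base // mul1g -e adjK.
have e1 : even_flag (bflag 1) by apply/even_flagP; exists 1%g.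
have -> : orbit 'P^*%act (Aut_polytope P) @: flags P = [set O (bflag 1); O (adj l0 (bflag 1))].
  apply/setP => X; rewrite !inE; apply/imsetP/orP => [[A flA ->]|[]/eqP->].
  - have [ev|od] := boolP (even_flag A); [left|right]; apply/eqP; first exact: OE.
    exact: OO.
  - by exists (bflag 1).
  by exists (adj l0 (bflag 1)); rewrite ?adj_flag.
rewrite cards2; case: eqP => // e.
have /Oev : bflag 1 \in O (adj l0 (bflag 1)) by rewrite -e orbit_refl.
by rewrite flag_parity // e1.
Qed.

End Chiral.

(** A proper end of the interval is comparable with everything inside it, so the interval lies in a
    star, where the projection is an isomorphism. *)
Lemma cover_section (u w : P) : proper u || proper w -> (u < w)%O ->
  [/\ {in [pred x : P | (u < x < w)%O] &, injective pi},
      forall x : P, (u < x < w)%O -> (pi u < pi x < pi w)%O,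
      forall F : Q, (pi u < F < pi w)%O -> exists2 x : P, (u < x < w)%O & pi x = F &
      {in [pred x : P | (u < x < w)%O] &, forall x y, (pi x >=< pi y)%O = (x >=< y)%O}].
Proof.
move=> puw uw.
have [v pv [uv wv h1 h2]] : exists2 v : cover_face, proper v & [/\ (u >=< v)%O, (w >=< v)%O,
  (forall x : cover_face, (u < x < w)%O -> (x >=< v)%O) &
  (forall F : Q, (pi u < F < pi w)%O -> (F >=< pi v)%O)].
  case/orP: puw => p; [exists u => //|exists w => //]; split; rewrite ?comparablexx //.
  - by rewrite comparable_sym /Order.comparable (ltW uw).
  - by move=> x /andP[ux _]; rewrite /Order.comparable (ltW ux) orbT.
  - by move=> x /andP[ux _]; rewrite /Order.comparable (ltW ux) orbT.
  - by rewrite /Order.comparable (ltW uw).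
  - by move=> x /andP[_ ux]; rewrite /Order.comparable (ltW ux).
  by move=> x /andP[_ ux]; rewrite /Order.comparable (ltW ux).
split.
- by move=> x y /h1 xv /h1 yv; apply: (star_inj pv).
- by move=> x /andP[a b]; rewrite !proj_lt.
- move=> F hF; have [x xv e] := star_surj pv (h2 _ hF); exists x => //.
  by rewrite -!(star_lt pv) // e.
move=> x y /h1 xv /h1 yv; apply/idP/idP; last exact: proj_comp.
exact: (star_comp pv).
Qed.

Definition rotation_lift m l l' k :=
  [/\ proper_idx m, m <> l.+1, m <> l'.+1, k \in K m & f k @: Phi = adj l' (adj l Phi)].

(** [alpha] is conjugation by [s], carried back from translations to [G] through the injective
    [tr]. *)
Lemma swap_automorphism s l : s \in Aut_polytope P -> l < n ->
  s @: bflag 1 = adj l (bflag 1) ->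
  exists alpha : {morphism G >-> gT}, [/\ ('injm alpha)%g, (alpha @* G)%g \subset G,
    forall i j m k, i.+1 < l -> j.+1 < l -> rotation_lift m j i k -> alpha k = k &
    forall j m k, j < n -> rotation_lift m l j k -> alpha k = (k^-1)%g].
Proof.
move=> sA hl es; pose inv := invm injm_translate.
pose alpha0 g := inv (tr g ^ s)%g.
have aP g : g \in G -> alpha0 g \in G /\ tr (alpha0 g) = (tr g ^ s)%g.
  move=> gG; have [h hG e] := swap_conj sA hl gG es.
  by rewrite /alpha0 e /inv invmE.
have inj x y : x \in G -> y \in G -> tr x = tr y -> x = y.
  by move=> xG yG; apply: (injmP injm_translate).
have aM : {in G &, {morph alpha0 : x y / (x * y)%g}}.
  move=> x y xG yG; have [a1 e1] := aP _ xG; have [a2 e2] := aP _ yG.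
  have [a3 e3] := aP _ (groupM xG yG); apply: inj; rewrite ?groupM //.
  by rewrite e3 translateM // conjMg -e1 -e2 translateM.
exists (Morphism aM); split.
- apply/injmP => x y xG yG /= e; have [_ e1] := aP _ xG; have [_ e2] := aP _ yG.
  by apply: inj => //; apply: (@conjg_inj _ s); rewrite -e1 -e2 e.
- by apply/subsetP => _ /morphimP[g _ gG ->] /=; case: (aP _ gG).
- move=> i j m k il jl [pm ml ml' kK e]; have kG := subsetP (K_sub m) _ kK.
  have [aG ea] := aP _ kG; apply: inj => //=; rewrite ea.
  apply: (swap_commute sA hl kG es il jl).
  by apply: (base_adj_lift _ _ pm) => //; lia.
move=> j m k hj [pm ml ml' kK e]; have kG := subsetP (K_sub m) _ kK.
have [aG ea] := aP _ kG; apply: inj; rewrite ?groupV //= ea.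
rewrite (swap_invert sA hl kG es hj) ?(morphV translate_morphism) //.
by apply: (base_adj_lift _ _ pm).
Qed.

(** Chirality is reduced to a statement about automorphisms of [G]: none may fix the rotations of
    ranks below [l0 - 1] while inverting those involving [l0]. The last clause transports properties
    of facets and vertex-figures from [Q]. *)
Theorem chiral_cover l0 ps : l0 < n ->
  (forall alpha : {morphism G >-> gT}, ('injm alpha)%g -> (alpha @* G)%g \subset G ->
    (forall i j m k, i.+1 < l0 -> j.+1 < l0 -> rotation_lift m j i k -> alpha k = k) ->
    (forall j m k, j < n -> rotation_lift m l0 j k -> alpha k = (k^-1)%g) -> False) ->
  size ps = n.-1 ->
  (forall i, 0 < i < n -> exists m k, rotation_lift m i i.-1 k /\ #[k]%g = nth 0 ps i.-1) ->
  exists (P : polytope n) (pi : P -> Q),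
    [/\ chiral P, has_type P ps, Aut_polytope P \isog G, forall u : P, rk (pi u) = rk u &
    forall u w : P, (0 < rk u <= n) || (0 < rk w <= n) -> (u < w)%O ->
    [/\ {in [pred x : P | (u < x < w)%O] &, injective pi},
      forall x : P, (u < x < w)%O -> (pi u < pi x < pi w)%O,
      forall F : Q, (pi u < F < pi w)%O -> exists2 x : P, (u < x < w)%O & pi x = F &
      {in [pred x : P | (u < x < w)%O] &, forall x y, (pi x >=< pi y)%O = (x >=< y)%O}]].
Proof.
move=> hl no sps hps.
have no_swap s : s \in Aut_polytope P -> s @: bflag 1 <> adj l0 (bflag 1).
  by move=> sA es; have [alpha []] := swap_automorphism sA hl es; apply: no.
exists P, pi; split.
- exact: (cover_chiral hl no_swap).
- apply: cover_type => // i hi; have [m [k [[pm ml ml' kK e] o]]] := hps i hi.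
  exists k; first exact: (subsetP (K_sub m)).
  by split=> //; apply: (base_adj_lift _ _ pm) => //; lia.
- exact: (aut_isog hl no_swap).
- by move=> u; rewrite rk_proj rk_cover.
by move=> u w; rewrite !rk_cover; apply: cover_section.
Qed.

End Cover.

(** * Spherical triangle groups *)

Section TriangleGroups.
Local Open Scope group_scope.
Variable gT : finGroupType.
Implicit Types (x c a b : gT).

Lemma gen_sub_closed (A X : {set gT}) : 1 \in X ->
  {in X & A, forall y a, y * a \in X} -> <<A>> \subset X.
Proof.
move=> X1 XA; pose H := [set y | [forall z in X, z * y \in X]].
have HP y : reflect (forall z, z \in X -> z * y \in X) (y \in H).
  by rewrite inE; apply: forall_inP.
have gH : group_set H.
  apply/group_setP; split; first by apply/HP => z zX; rewrite mulg1.
  by move=> y z /HP hy /HP hz; apply/HP => t tX; rewrite mulgA hz ?hy.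
have sH : <<A>> \subset Group gH.
  by rewrite gen_subG; apply/subsetP => a aA; apply/HP => z zX; apply: XA.
by apply/subsetP => y /(subsetP sH)/HP/(_ 1 X1); rewrite mul1g.
Qed.

Definition coset_union x (W : seq gT) : {set gT} := \bigcup_(w <- W) (<[x]> :* w).

Lemma coset_unionP x W y : reflect (exists2 w, w \in W & y \in <[x]> :* w) (y \in coset_union x W).
Proof.
rewrite /coset_union; elim: W => [|w W IH].
  by rewrite big_nil inE; constructor => -[].
rewrite big_cons inE; apply: (iffP orP) => [[yw|/IH[w' w'W yw']]|[w' ]].
- by exists w; rewrite // mem_head.
- by exists w'; rewrite // in_cons w'W orbT.
by rewrite in_cons => /predU1P[->|w'W] h; [left|right; apply/IH; exists w'].
Qed.

Lemma card_coset_union x W : #|coset_union x W| <= #[x] * size W.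
Proof.
rewrite /coset_union; elim: W => [|w W IH]; first by rewrite big_nil cards0.
rewrite big_cons (leq_trans (leq_card_setU _ _)) //= mulnS leq_add //.
by rewrite card_rcoset.
Qed.

Lemma coset_union_closed x W y : {in W, forall w, w * y \in coset_union x W} ->
  {in coset_union x W, forall z, z * y \in coset_union x W}.
Proof.
move=> hW z /coset_unionP[w wW /rcosetP[k kx ->]].
have /coset_unionP[w' w'W /rcosetP[k' k'x e]] := hW _ wW.
apply/coset_unionP; exists w' => //; rewrite -mulgA e mulgA.
by apply/rcosetP; exists (k * k') => //; rewrite groupM.
Qed.

Lemma coset_union1 x W (w : gT) k : k \in <[x]> -> w \in W -> k * w \in coset_union x W.
Proof.
by move=> kx wW; apply/coset_unionP; exists w => //; apply/rcosetP; exists k.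
Qed.

Section Relations.
Variables (x c : gT).
Hypothesis c2 : c * c = 1.
(** For an involution [c] this is [(c * x^-1) ^+ 3 = 1], oriented so that rewriting trades two
    occurrences of [c] for one. *)
Hypothesis cxc : c * x * c = x^-1 * c * x^-1.


Let cV : c^-1 = c. Proof. by apply/eqP; rewrite eq_sym eq_mulgV1 invgK c2. Qed.

Let cxVc : c * x^-1 * c = x * c * x.
Proof. by have := congr1 invg cxc; rewrite !invgM !invgK cV !mulgA. Qed.

Let cK y : y * c * c = y. Proof. by rewrite -mulgA c2 mulg1. Qed.

Let cxcK y : y * c * x * c = y * x^-1 * c * x^-1.
Proof. by rewrite -!mulgA; congr (y * _); rewrite !mulgA cxc. Qed.

Let cxVcK y : y * c * x^-1 * c = y * x * c * x.
Proof. by rewrite -!mulgA; congr (y * _); rewrite !mulgA cxVc. Qed.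

Let cx2cK y : y * c * x * x * c = y * x^-1 * c * x^-1 * x^-1 * c * x^-1.
Proof. by rewrite -(cK (y * c * x)) cxcK cxcK. Qed.

Let cxV2cK y : y * c * x^-1 * x^-1 * c = y * x * c * x * x * c * x.
Proof. by rewrite -(cK (y * c * x^-1)) cxVcK cxVcK. Qed.

Let cxc1 : c * x * c = x^-1 * (c * x^-1). Proof. by rewrite cxc mulgA. Qed.
Let cxVc1 : c * x^-1 * c = x * (c * x). Proof. by rewrite cxVc mulgA. Qed.
Let cx2c1 : c * x * x * c = x^-1 * c * x^-1 * x^-1 * c * x^-1.
Proof. by have := cx2cK 1; rewrite !mul1g. Qed.
Let cxV2c1 : c * x^-1 * x^-1 * c = x * c * x * x * c * x.
Proof. by have := cxV2cK 1; rewrite !mul1g. Qed.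

Let inW W y k w : k \in <[x]> -> w \in W -> y = k * w -> y \in coset_union x W.
Proof. by move=> kx wW ->; apply: coset_union1. Qed.

Ltac by_coset k w := apply: (inW (k := k) (w := w));
  [by rewrite ?groupV ?cycle_id ?group1 | by rewrite !inE eqxx ?orbT | ].

(* Coset enumeration: W lists representatives of the right cosets of <[x]>. *)
Lemma card_octahedral : x ^+ 4 = 1 -> #|<<[set x; c]>>| <= 24.
Proof.
move=> x4; have x3K y : y * x * x * x = y * x^-1.
  by rewrite -!mulgA; congr (y * _); apply: (mulgI x); rewrite mulgV -x4 !expgS expg0 mulg1.
have x2E y : y * x^-1 * x^-1 = y * x * x by rewrite -(x3K (y * x^-1)) mulgKV.
have x2E1 : x^-1 * x^-1 = x * x by have := x2E 1; rewrite !mul1g.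
pose W := [:: 1; c; c * x; c * x * x; c * x^-1; c * x * x * c].
have sub : <<[set x; c]>> \subset coset_union x W.
  apply: gen_sub_closed; first by by_coset (1 : gT) (1 : gT); rewrite mulg1.
  move=> z y zX; rewrite !inE => /orP[]/eqP->; move: z zX; apply: coset_union_closed => w;
    rewrite !inE => /or4P[/eqP->|/eqP->|/eqP->|/or3P[]/eqP->].
  - by by_coset x (1 : gT); rewrite mul1g mulg1.
  - by by_coset (1 : gT) (c * x); rewrite mul1g.
  - by by_coset (1 : gT) (c * x * x); rewrite mul1g.
  - by by_coset (1 : gT) (c * x^-1); rewrite mul1g x3K.
  - by by_coset (1 : gT) c; rewrite mul1g mulgKV.
  - by by_coset x^-1 (c * x * x * c); rewrite [in LHS]cx2c1 mulgKV x2E !mulgA.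
  - by by_coset (1 : gT) c; rewrite !mul1g.
  - by by_coset (1 : gT) (1 : gT); rewrite mulg1.
  - by by_coset x^-1 (c * x^-1); rewrite cxc1.
  - by by_coset (1 : gT) (c * x * x * c); rewrite mul1g.
  - by by_coset x (c * x); rewrite cxVc1.
  by by_coset (1 : gT) (c * x * x); rewrite mul1g cK.
apply: leq_trans (subset_leq_card sub) (leq_trans (card_coset_union _ _) _).
by rewrite (@leq_mul _ _ 4 6) // dvdn_leq // order_dvdn x4.
Qed.

(** The cosets of [<[x]>] correspond to the faces of a dodecahedron: the base face, five faces
    [c * x ^+ k] around it, five faces [c * x * x * c * x ^+ k], and the opposite face. *)
Lemma card_dodecahedral : x ^+ 5 = 1 -> #|<<[set x; c]>>| <= 60.
Proof.
move=> x5; have x3K y : y * x * x * x = y * x^-1 * x^-1.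
  rewrite -!mulgA; congr (y * _); apply: (mulgI x); rewrite [RHS]mulgA mulgV mul1g.
  by apply: (mulgI x); rewrite mulgV -x5 !expgS expg0 mulg1.
have xV3K y : y * x^-1 * x^-1 * x^-1 = y * x * x.
  by rewrite -(x3K y) mulgK.
pose W := [:: 1; c; c * x; c * x * x; c * x^-1; c * x^-1 * x^-1; c * x * x * c;
  c * x * x * c * x; c * x * x * c * x * x; c * x * x * c * x^-1;
  c * x * x * c * x^-1 * x^-1; c * x * x * c * x^-1 * x^-1 * c].
have sub : <<[set x; c]>> \subset coset_union x W.
  apply: gen_sub_closed; first by by_coset (1 : gT) (1 : gT); rewrite mulg1.
  move=> z y zX; rewrite !inE => /orP[]/eqP->; move: z zX; apply: coset_union_closed => w;
    rewrite !inE => /or4P[/eqP->|/eqP->|/eqP->|/or4P[/eqP->|/eqP->|/eqP->|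
      /or4P[/eqP->|/eqP->|/eqP->|/or3P[]/eqP->]]].
  - by by_coset x (1 : gT); rewrite mul1g mulg1.
  - by by_coset (1 : gT) (c * x); rewrite mul1g.
  - by by_coset (1 : gT) (c * x * x); rewrite mul1g.
  - by by_coset (1 : gT) (c * x^-1 * x^-1); rewrite mul1g x3K.
  - by by_coset (1 : gT) c; rewrite mul1g mulgKV.
  - by by_coset (1 : gT) (c * x^-1); rewrite mul1g mulgKV.
  - by by_coset (1 : gT) (c * x * x * c * x); rewrite mul1g.
  - by by_coset (1 : gT) (c * x * x * c * x * x); rewrite mul1g.
  - by by_coset (1 : gT) (c * x * x * c * x^-1 * x^-1); rewrite mul1g x3K.
  - by by_coset (1 : gT) (c * x * x * c); rewrite mul1g mulgKV.
  - by by_coset (1 : gT) (c * x * x * c * x^-1); rewrite mul1g mulgKV.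
  - by_coset x^-1 (c * x * x * c * x^-1 * x^-1 * c).
    by rewrite [in RHS]cxV2cK x3K cxV2c1 !mulgA mulVg mul1g x3K.
  - by by_coset (1 : gT) c; rewrite !mul1g.
  - by by_coset (1 : gT) (1 : gT); rewrite mulg1.
  - by by_coset x^-1 (c * x^-1); rewrite cxc1.
  - by by_coset (1 : gT) (c * x * x * c); rewrite mul1g.
  - by by_coset x (c * x); rewrite cxVc1.
  - by by_coset x (c * x * x * c * x); rewrite cxV2c1 !mulgA.
  - by by_coset (1 : gT) (c * x * x); rewrite mul1g cK.
  - by by_coset x^-1 (c * x^-1 * x^-1); rewrite cxcK mulgK cxc !mulgA.
  - by by_coset x^-1 (c * x * x * c * x^-1); rewrite cx2cK mulgK cxc xV3K !mulgA.
  - by by_coset x (c * x * x * c * x * x); rewrite cxVcK x3K cxV2c1 !mulgA.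
  - by by_coset (1 : gT) (c * x * x * c * x^-1 * x^-1 * c); rewrite mul1g.
  by by_coset (1 : gT) (c * x * x * c * x^-1 * x^-1); rewrite mul1g cK.
apply: leq_trans (subset_leq_card sub) (leq_trans (card_coset_union _ _) _).
by rewrite (@leq_mul _ _ 5 12) // dvdn_leq // order_dvdn x5.
Qed.

End Relations.

(** Distinct conjugates of a subgroup of prime order meet trivially, so their nontrivial elements
    can be counted conjugate by conjugate. *)
Lemma card_prime_support (H : {group gT}) y q : prime q -> #[y] = q -> y \in H ->
  q.-Sylow(H) <[y]> -> #|class_support <[y]>^# H| = ((q - 1) * #|'Syl_q(H)|)%N.
Proof.
move=> pq oy yH syl; rewrite (card_Syl syl).
have gen a : a \in <[y]>^# -> <[a]> = <[y]>.
  case/setD1P => na ay; have oa : #[a] = q.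
    by apply: nt_prime_order => //; apply/eqP; rewrite -order_dvdn -oy order_dvdG.
  by apply/eqP; rewrite eqEcard cycle_subG ay [#|<[y]>|]oy [#|<[a]>|]oa leqnn.
have ti : normedTI <[y]>^# H 'N_H(<[y]>).
  apply/normedTI_memJ_P; split; [| exact: subsetIl |].
    apply/set0Pn; exists y; rewrite !inE cycle_id andbT -order_eq1 oy; apply/eqP => e.
    by rewrite e in pq.
  move=> a g aA gH; rewrite !inE gH /= conjg_eq1 -(gen _ aA).
  have [na _] := setD1P aA; rewrite na /=.
  apply/idP/idP => [h|/subsetP]; first by rewrite -cycleJ cycle_subG.
  by apply; rewrite memJ_conjg cycle_id.
rewrite (card_support_normedTI ti); congr (_ * _)%N.
by rewrite -oy /order (cardsD1 1 <[y]>) group1 addKn.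
Qed.

Lemma order_prime_support (H : {group gT}) y q z : prime q -> #[y] = q ->
  z \in class_support <[y]>^# H -> #[z] = q.
Proof.
move=> pq oy /imset2P[a g aA gH ->]; rewrite orderJ; case/setD1P: aA => na ay.
by apply: nt_prime_order => //; apply/eqP; rewrite -order_dvdn -oy order_dvdG.
Qed.

Lemma card_Syl_gt1 (H : {group gT}) (P : {group gT}) q : prime q -> q.-Sylow(H) P ->
  ~~ (P <| H) -> #|'Syl_q(H)| != 1%N.
Proof.
move=> pq syl; apply: contra => /eqP e.
rewrite /normal (pHall_sub syl) /=; move: e; rewrite (card_Syl syl) => /eqP.
by rewrite indexg_eq1 subsetI => /andP[].
Qed.

(** With order 12 there would be four Sylow 3-subgroups, hence eight elements of order 3; the other
    four elements form [<[x]>]. Then [c], and with it [c * x^-1] of order 3, would lie in a group of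
    order 4. *)
Lemma card_neq_12 x c : c * c = 1 -> #[x] = 4 -> #[c * x^-1] = 3 ->
  #|<<[set x; c]>>| <> 12.
Proof.
move=> c2 ox oa; pose H := <<[set x; c]>>%G; rewrite -[<<_>>]/(gval H) => cH.
have xH : x \in H by rewrite mem_gen ?set21.
have cHm : c \in H by rewrite mem_gen ?set22.
set a := c * x^-1 in oa; have aH : a \in H by rewrite groupM ?groupV.
have oc : #[c] %| 2 by rewrite order_dvdn expgS expg1 c2.
have syl : 3.-Sylow(H) <[a]>.
  by rewrite pHallE cycle_subG aH [#|_|]oa cH p_part.
have nn : ~~ (<[a]> <| H).
  apply/negP => nA; have : x * x \in <[a]>.
    have -> : x * x = (a^-1 ^ x^-1) * a^-1.
      rewrite /a invgM invgK /conjg invgK.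
      have -> : c^-1 = c by apply/eqP; rewrite eq_sym eq_mulgV1 invgK c2.
      by rewrite !mulgA mulgKV -(mulgA _ c c) c2 mulg1.
    by rewrite groupM ?memJ_norm ?groupV ?cycle_id // (subsetP (normal_norm nA)) ?groupV.
  move/order_dvdG; rewrite [#|_|]oa.
  by rewrite -[x * x]/(x ^+ 2) (orderXgcd x 2) ox.
have n4 : #|'Syl_3(H)| = 4.
  have := card_Syl_gt1 (isT : prime 3) syl nn; have := card_Syl_mod H (isT : prime 3).
  have := card_Syl_dvd 3 H; rewrite cH => /[dup] /dvdn_leq => /(_ isT).
  by move: #|_|; do 13?case=> //.
have c8 := card_prime_support (isT : prime 3) oa aH syl; rewrite n4 /= in c8.
set T := class_support _ _ in c8.
have To z : z \in T -> #[z] = 3 by apply: order_prime_support.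
have dis : [disjoint T & (<[x]>)].
  apply/pred0P => z /=; apply/negP => /andP[/To oz /order_dvdG].
  by rewrite oz [#|_|]ox.
have cov : T :|: <[x]> = H.
  apply/eqP; rewrite eqEcard; apply/andP; split.
    rewrite subUset cycle_subG xH andbT class_support_subG //.
    by apply: subset_trans (subsetDl _ _) _; rewrite cycle_subG.
  by rewrite cardsU (eqP (_ : #|T :&: <[x]>| == 0)) ?cards_eq0 ?setI_eq0 // c8 [#|<[x]>|]ox cH.
have : c \in T :|: <[x]> by rewrite cov.
case/setUP => [/To e|cx]; first by rewrite e in oc.
have : a \in <[x]> by rewrite groupM ?groupV ?cycle_id.
by move/order_dvdG; rewrite oa [#|_|]ox.
Qed.

(** With order 30 neither Sylow subgroup would be normal, giving 20 elements of order 3 and 24 of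
    order 5, more than 30 in all. *)
Lemma card_neq_30 x c : c * c = 1 -> #[x] = 5 -> #[x^-1 * c] = 3 ->
  #|<<[set x; c]>>| <> 30.
Proof.
move=> c2 ox oa; pose H := <<[set x; c]>>%G; rewrite -[<<_>>]/(gval H) => cH.
have xH : x \in H by rewrite mem_gen ?set21.
have cHm : c \in H by rewrite mem_gen ?set22.
set a := x^-1 * c in oa; have aH : a \in H by rewrite groupM ?groupV.
have oc : #[c] %| 2 by rewrite order_dvdn expgS expg1 c2.
have syl3 : 3.-Sylow(H) <[a]> by rewrite pHallE cycle_subG aH [#|_|]oa cH p_part.
have syl5 : 5.-Sylow(H) <[x]> by rewrite pHallE cycle_subG xH [#|_|]ox cH p_part.
have xE : x = c * a^-1 by rewrite /a invgM invgK mulgA; rewrite (_ : c * c^-1 = 1) ?mul1g ?mulgV.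
have nn3 : ~~ (<[a]> <| H).
  apply/negP => nA; have : x * x \in <[a]>.
    have -> : x * x = (a^-1 ^ c^-1) * a^-1.
      rewrite {1 2}xE /conjg invgK !mulgA; congr (_ * _).
      have -> : c^-1 = c by apply/eqP; rewrite eq_sym eq_mulgV1 invgK c2.
      by [].
    by rewrite groupM ?memJ_norm ?groupV ?cycle_id // (subsetP (normal_norm nA)) ?groupV.
  move/order_dvdG; rewrite [#|_|]oa.
  by rewrite -[x * x]/(x ^+ 2) (orderXgcd x 2) ox.
(* Modulo a normal [<[x]>], the elements [a] and [c] agree, so their common image has order dividing
   both 3 and 2. *)
have nn5 : ~~ (<[x]> <| H).
  apply/negP => nA; have nX := subsetP (normal_norm nA).
  have ca : coset <[x]> a ^+ 3 = 1.
    by rewrite -morphX ?nX // -[a ^+ 3]/(a ^+ 3) -oa expg_order morph1.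
  have cc : coset <[x]> a = coset <[x]> c.
    have x1 : coset <[x]> x^-1 = 1 by apply: coset_id; rewrite groupV cycle_id.
    have -> : coset <[x]> a = coset <[x]> x^-1 * coset <[x]> c.
      by rewrite -morphM ?groupV ?nX.
    by rewrite x1 mul1g.
  have c1 : coset <[x]> c = 1.
    rewrite cc in ca; rewrite -ca !expgS expg0 mulg1 -{1}(mulg1 (coset _ c)); congr (_ * _).
    by rewrite -morphM ?nX // c2 morph1.
  have cx : c \in <[x]> by apply: coset_idr; rewrite ?nX.
  have : a \in <[x]> by rewrite groupM ?groupV ?cycle_id.
  by move/order_dvdG; rewrite oa [#|_|]ox.
have n10 : #|'Syl_3(H)| = 10.
  have := card_Syl_gt1 (isT : prime 3) syl3 nn3; have := card_Syl_mod H (isT : prime 3).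
  have := card_Syl_dvd 3 H; rewrite cH => /[dup] /dvdn_leq => /(_ isT).
  by move: #|_|; do 31?case=> //.
have n6 : #|'Syl_5(H)| = 6.
  have := card_Syl_gt1 (isT : prime 5) syl5 nn5; have := card_Syl_mod H (isT : prime 5).
  have := card_Syl_dvd 5 H; rewrite cH => /[dup] /dvdn_leq => /(_ isT).
  by move: #|_|; do 31?case=> //.
have c20 := card_prime_support (isT : prime 3) oa aH syl3; rewrite n10 /= in c20.
have c24 := card_prime_support (isT : prime 5) ox xH syl5; rewrite n6 /= in c24.
set T := class_support _ _ in c20; set V := class_support _ _ in c24.
have dis : T :&: V = set0.
  apply/setP => z; rewrite !inE; apply/negP => /andP[/(order_prime_support (isT : prime 3) oa) e].
  by move/(order_prime_support (isT : prime 5) ox); rewrite e.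
have sub : T :|: V \subset H.
  by rewrite subUset !class_support_subG // (subset_trans (subsetDl _ _)) ?cycle_subG.
by have := subset_leq_card sub; rewrite cardsU dis cards0 c20 c24 cH.
Qed.

End TriangleGroups.

(** * Injectivity of morphisms on spherical triangle groups *)

Section TriangleQuotients.
Local Open Scope group_scope.
Variables (gT rT : finGroupType) (x c : gT) (f : {morphism <<[set x; c]>> >-> rT}).

Let xK : x \in <<[set x; c]>>. Proof. by rewrite mem_gen ?set21. Qed.
Let cK : c \in <<[set x; c]>>. Proof. by rewrite mem_gen ?set22. Qed.

Let im_gen : f @* <<[set x; c]>> = <<[set f x; f c]>>.
Proof.
rewrite morphim_gen ?subset_gen // morphimU !morphim_set1 //.
Qed.

(** The order of the image is a multiple of [m] other than [m], hence at least twice [m], which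
    bounds the order of the source. *)
Let inj_of_card m : #|<<[set x; c]>>| <= (2 * m)%N -> m %| #|f @* <<[set x; c]>>| ->
  #|f @* <<[set x; c]>>| <> m -> 'injm f.
Proof.
move=> leK /dvdnP[q e] ne; rewrite -card_im_injm eqn_leq leq_morphim /=.
apply: leq_trans leK _; rewrite e leq_mul2r.
case: q e => [|[|q]] e; rewrite ?orbT //; last by rewrite e mul1n in ne.
by have := cardG_gt0 (f @* <<[set x; c]>>); rewrite e.
Qed.

Hypothesis c2 : c * c = 1.

Lemma injm_octahedral : c * x * c = x^-1 * c * x^-1 -> x ^+ 4 = 1 ->
  #[f x] = 4 -> #[f (c * x^-1)] = 3 -> 'injm f.
Proof.
move=> cxc x4 ox oa; have fa : f (c * x^-1) = f c * (f x)^-1.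
  by rewrite morphM ?groupV // morphV.
have fc2 : f c * f c = 1 by rewrite -morphM // c2 morph1.
apply: (inj_of_card (m := 12)) => //.
- exact: card_octahedral.
- have d4 : 4 %| #|f @* <<[set x; c]>>| by rewrite -ox order_dvdG ?mem_morphim.
  have d3 : 3 %| #|f @* <<[set x; c]>>| by rewrite -oa order_dvdG ?mem_morphim ?groupM ?groupV.
  by rewrite (@Gauss_dvd 4 3) // d4.
by rewrite im_gen; apply: card_neq_12; rewrite // -fa.
Qed.

Lemma injm_dodecahedral : c * x * c = x^-1 * c * x^-1 -> x ^+ 5 = 1 ->
  #[f x] = 5 -> #[f (x^-1 * c)] = 3 -> 'injm f.
Proof.
move=> cxc x5 ox oa; have fa : f (x^-1 * c) = (f x)^-1 * f c.
  by rewrite morphM ?groupV // morphV.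
have fc2 : f c * f c = 1 by rewrite -morphM // c2 morph1.
have oc : #[f c] = 2.
  apply: nt_prime_order => //; apply/eqP => e.
  by move: oa; rewrite fa e mulg1 orderV ox.
apply: (inj_of_card (m := 30)) => //.
- exact: card_dodecahedral.
- have d5 : 5 %| #|f @* <<[set x; c]>>| by rewrite -ox order_dvdG ?mem_morphim.
  have d3 : 3 %| #|f @* <<[set x; c]>>| by rewrite -oa order_dvdG ?mem_morphim ?groupM ?groupV.
  have d2 : 2 %| #|f @* <<[set x; c]>>| by rewrite -oc order_dvdG ?mem_morphim.
  by rewrite (@Gauss_dvd 2 15) // d2 (@Gauss_dvd 3 5) // d3.
by rewrite im_gen; apply: card_neq_30; rewrite // -?fa.
Qed.

Lemma injm_dihedral m : c * x * c = x^-1 -> x ^+ m = 1 -> #[f x] = m ->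
  f c \notin <[f x]> -> 'injm f.
Proof.
move=> cxc xm ox nc.
have in1 k : k \in <[x]> -> k \in coset_union x [:: 1; c].
  by move=> kx; apply/coset_unionP; exists 1; rewrite ?inE ?eqxx // mem_rcoset invg1 mulg1.
have sub : <<[set x; c]>> \subset coset_union x [:: 1; c].
  apply: gen_sub_closed; first by rewrite in1 ?group1.
  move=> z y zX; rewrite !inE => /orP[]/eqP->; move: z zX; apply: coset_union_closed => w;
    rewrite !inE => /orP[]/eqP->.
  - by rewrite mul1g in1 ?cycle_id.
  - have -> : c * x = x^-1 * c by rewrite -cxc -mulgA c2 mulg1.
    by rewrite coset_union1 ?groupV ?cycle_id ?inE ?eqxx ?orbT.
  - by rewrite coset_union1 ?group1 ?inE ?eqxx ?orbT.
  by rewrite c2 in1 ?group1.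
apply/subsetP => y /[dup] /dom_ker yK /morphpreP[_ /set1P fy]; apply/set1P.
have /coset_unionP[w] := subsetP sub _ yK; rewrite !inE => /orP[]/eqP-> /rcosetP[k /cycleP[i ->] ey].
  move: fy; rewrite ey mulg1 morphX // => /eqP; rewrite -order_dvdn ox => /dvdnP[q ->].
  by rewrite mulnC expgM xm expg1n.
(* A kernel element in the other coset of [<[x]>] would make [f c] a power of [f x]. *)
case/negP: nc; move: fy; rewrite ey morphM ?groupX // morphX // => e.
have -> : f c = (f x ^+ i)^-1 by apply: (mulgI (f x ^+ i)); rewrite e mulgV.
by rewrite groupV mem_cycle.
Qed.

End TriangleQuotients.

(** * Squares in finite fields *)

Section FiniteFieldSquares.
Local Open Scope ring_scope.

(** The squares and their reflections [-1 - y] each fill more than half of [F], so they meet. The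
    identity splits the quaternion algebra, which makes quaternions into 2 by 2 matrices. *)
Lemma sum_squares_N1 (F : finFieldType) : (2%:R : F) != 0 ->
  exists a b : F, a ^+ 2 + b ^+ 2 = -1.
Proof.
move=> n2; pose A := [set x ^+ 2 | x : F]; pose B := [set -1 - y | y in A].
have cB : #|B| = #|A| by apply: card_imset => x y /addrI/oppr_inj.
(* Squaring has one preimage over 0 and at most two over any other square. *)
have cF : (#|F| <= (2 * #|A|).-1)%N.
  have A0 : 0 \in A by apply/imsetP; exists 0; rewrite ?expr0n.
  have -> : #|F| = (\sum_(y in A) \sum_(x | x ^+ 2 == y) 1)%N.
    rewrite -sum1_card (partition_big (fun x => x ^+ 2) (mem A)) /=.
      by apply: eq_bigr => y _; apply: eq_bigl.
    by move=> x _; apply: imset_f.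
  rewrite (bigD1 0) //= (eq_bigl (pred1 0)); last by move=> x; rewrite /= sqrf_eq0.
  rewrite big_pred1_eq.
  have : (\sum_(y in A | y != 0%R) \sum_(x | x ^+ 2 == y) 1 <= \sum_(y in A | y != 0%R) 2)%N.
    apply: leq_sum => _ /andP[/imsetP[z _ ->] _]; rewrite sum1dep_card.
    have sub : [set x | x ^+ 2 == z ^+ 2] \subset [set z; - z].
      by apply/subsetP => x; rewrite !inE eqf_sqr.
    by rewrite (leq_trans (subset_leq_card sub)) // cards2; case: eqP.
  have -> : (\sum_(y in A | y != 0%R) 2 = 2 * #|A|.-1)%N.
    rewrite sum_nat_const mulnC; congr (_ * _)%N.
    by rewrite (cardsD1 0 A) A0 /=; apply: eq_card => y; rewrite !inE andbC.
  have : (0 < #|A|)%N by apply/card_gt0P; exists 0.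
  by case: #|A| => // m _ h; rewrite mulnS add1n.
have [/existsP[z /setIP[/imsetP[a _ ->] /imsetP[_ /imsetP[b _ ->] e]]]|] :=
  boolP [exists z, z \in A :&: B]; first by exists a, b; rewrite e; ring.
move/existsPn => no; have d0 : A :&: B = set0.
  by apply/setP => z; rewrite [RHS]inE; apply/negbTE/no.
have hU : (#|A| + #|A| <= #|F|)%N.
  by have := max_card (mem (A :|: B)); rewrite cardsU d0 cards0 cB subn0.
have A0 : (0 < #|A|)%N by apply/card_gt0P; exists 0; apply/imsetP; exists 0; rewrite ?expr0n.
by have := leq_trans hU cF; lia.
Qed.

Lemma pchar_natr_inj (R : nzRingType) p (a b : nat) : p \in [pchar R] ->
  (a < p)%N -> (b < p)%N -> a%:R = b%:R :> R -> a = b.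
Proof.
move=> ch; wlog le : a b / (a <= b)%N => [W|] ha hb e.
  by case/orP: (leq_total a b) => h; [apply: W | apply/esym/W].
have : (p %| b - a)%N by rewrite (dvdn_pcharf ch) natrB // e subrr.
by move/dvdn_leq; lia.
Qed.

(* If z is a primitive 8th root of unity in the field of order p^2, then
   z + 1/z squares to 2 and is fixed by Frobenius when p = 1, 7 mod 8. *)
Lemma sqrt2_Fp p : prime p -> (p %% 8 == 1)%N || (p %% 8 == 7)%N ->
  exists r : 'F_p, r ^+ 2 = 2%:R.
Proof.
move=> pr p8; have p_gt2 : (2 < p)%N.
  by have := prime_gt1 pr; case: (p =P 2) p8 => [->//|]; lia.
have [L chL cL] := pPrimePowerField pr (isT : 0 < 2)%N.
have /cyclicP[g gE] := field_unit_group_cyclic [set: {unit L}]%G.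
have og : #[g]%g = (p ^ 2).-1%N by rewrite /order -gE /= card_finField_unit cL.
have d8 : (8 %| #[g]%g)%N.
  have pE := divn_eq p 8; rewrite og; set k := (p %/ 8)%N in pE.
  by case/orP: p8 => /eqP e; rewrite e in pE; rewrite pE; apply/dvdnP;
    [exists (8 * k * k + 2 * k)%N | exists (8 * k * k + 14 * k + 6)%N]; rewrite expnS expn1; lia.
have og0 : (0 < #[g]%g)%N by apply: order_gt0.
pose z := (g ^+ (#[g] %/ 8))%g; have oz : #[z]%g = 8%N.
  by rewrite /z orderXdiv ?dvdn_div // divnA // mulKn.
pose y := FinRing.uval z; have yX n : FinRing.uval (z ^+ n)%g = y ^+ n by apply: FinRing.val_unitX.
have y8 : y ^+ 8 = 1 by rewrite -yX -oz expg_order.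
have y4 : y ^+ 4 = -1.
  have : (y ^+ 4 - 1) * (y ^+ 4 + 1) = 0.
    by transitivity (y ^+ 8 - 1); [ring | rewrite y8 subrr].
  move/eqP; rewrite mulf_eq0 subr_eq0 addr_eq0 => /orP[/eqP e|/eqP//].
  have /eqP : (z ^+ 4 = 1)%g by apply: val_inj; exact: etrans (yX 4%N) e.
  by rewrite -order_dvdn oz.
(* [y ^+ 7] is the inverse of [y]. *)
pose s := y + y ^+ 7.
have s2 : s ^+ 2 = 2%:R.
  transitivity (y ^+ 2 * (1 + y ^+ 4) + 2%:R * y ^+ 8 + (y ^+ 8 - 1) * y ^+ 6); first by rewrite /s; ring.
  by rewrite y4 y8; ring.
have yp k : y ^+ (8 * k) = 1 by rewrite exprM y8 expr1n.
have sp : s ^+ p = s.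
  have -> : s ^+ p = y ^+ p + (y ^+ p) ^+ 7.
    have := pFrobenius_autD_comm chL (commrX 7 (erefl (y * y))).
    by rewrite !pFrobenius_autE => ->; rewrite -!exprM mulnC.
  rewrite /s (divn_eq p 8) mulnC exprD yp mul1r.
  case/orP: p8 => /eqP ->; first by rewrite expr1.
  have -> : (y ^+ 7) ^+ 7 = y by rewrite -exprM -[(7 * 7)%N]/((8 * 6).+1)%N exprS yp mulr1.
  by rewrite addrC.
(* An element fixed by Frobenius is a root of ['X^p - 'X], and the integers below [p] already
   account for its [p] roots. *)
have [n ns] : exists n : nat, s = n%:R.
  pose P : {poly L} := 'X^p - 'X.
  have sP : size P = p.+1 by rewrite size_polyDl ?size_polyXn // size_polyN size_polyX ltnS; lia.
  have P0 : P != 0 by rewrite -size_poly_gt0 sP.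
  have [/mapP[n _ ->]|nin] := boolP (s \in [seq i%:R | i <- iota 0 p]); first by exists n.
  have := @max_poly_roots _ P (s :: [seq i%:R | i <- iota 0 p]) P0.
  rewrite /= size_map size_iota sP ltnn => h; exfalso; apply: (negP (isT : ~~ false)).
  apply: h; last first.
    rewrite nin map_inj_in_uniq ?iota_uniq // => i j; rewrite !mem_iota !add0n /= => hi hj.
    exact: pchar_natr_inj chL hi hj.
  apply/andP; split; first by rewrite /root !hornerE sp subrr.
  apply/allP => _ /mapP[i _ ->]; rewrite /root !hornerE.
  have := pFrobenius_aut_nat chL i; rewrite pFrobenius_autE => ->.
  by rewrite subrr.
exists n%:R.
(* Divisibility of a natural number carries [n ^ 2 = 2] from [L] to ['F_p]; adding [p] keeps the
   subtraction of 2 honest. *)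
have : (p %| n ^ 2 + (p - 2))%N.
  rewrite (dvdn_pcharf chL) natrD natrB ?natrX -?ns ?s2 //; last by lia.
  by rewrite (pcharf0 chL) sub0r subrr.
rewrite (dvdn_pcharf (pchar_Fp pr)) natrD natrB; last by lia.
rewrite natrX (pcharf0 (pchar_Fp pr)) sub0r subr_eq0 => /eqP.
by [].
Qed.

End FiniteFieldSquares.

(** * Two-dimensional special linear groups *)

Lemma even_ge6 n : (2 %| n)%N -> (4 <= n)%N -> n != 4%N -> (6 <= n)%N.
Proof. by case/dvdnP => k ->; lia. Qed.

(** * Matrices of size two *)

Section Matrix2.
Local Open Scope ring_scope.
Variable F : fieldType.

Lemma ord2P (i : 'I_2) : i = 0 \/ i = 1.
Proof. by case: i => [[|[|//]] h]; [left|right]; apply: val_inj. Qed.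

Definition mx2 (a b c d : F) : 'M[F]_2 :=
  \matrix_(i, j) (if i == 0 then if j == 0 then a else b else if j == 0 then c else d).

Lemma mx2E (M : 'M[F]_2) : M = mx2 (M 0 0) (M 0 1) (M 1 0) (M 1 1).
Proof.
apply/matrixP => i j; rewrite mxE.
by case: (ord2P i) => ->; case: (ord2P j) => ->.
Qed.

Lemma mx2M a b c d a' b' c' d' :
  mx2 a b c d *m mx2 a' b' c' d' =
  mx2 (a * a' + b * c') (a * b' + b * d') (c * a' + d * c') (c * b' + d * d').
Proof.
apply/matrixP => i j; rewrite !mxE big_ord_recl big_ord1 !mxE /=.
by case: (ord2P i) => ->; case: (ord2P j) => ->.
Qed.

Lemma mx2_det a b c d : \det (mx2 a b c d) = a * d - b * c.
Proof.
rewrite (expand_det_row _ 0) big_ord_recl big_ord1 /cofactor !det_mx11 !mxE /=.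
by rewrite expr0 expr1; ring.
Qed.

Lemma mx2_tr a b c d : \tr (mx2 a b c d) = a + d.
Proof. by rewrite /mxtrace big_ord_recl big_ord1 !mxE. Qed.

Lemma mx2_inj a b c d a' b' c' d' : mx2 a b c d = mx2 a' b' c' d' ->
  [/\ a = a', b = b', c = c' & d = d'].
Proof.
move/matrixP => h; split.
- by have := h 0 0; rewrite !mxE.
- by have := h 0 1; rewrite !mxE.
- by have := h 1 0; rewrite !mxE.
by have := h 1 1; rewrite !mxE.
Qed.

Lemma mx2_1 : 1%:M = mx2 1 0 0 1.
Proof.
apply/matrixP => i j; rewrite !mxE.
by case: (ord2P i) => ->; case: (ord2P j) => ->.
Qed.

End Matrix2.

(* GL2(F) is given abstractly, by a faithful representation mxv of gT onto the
   invertible matrices. *)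
Section SpecialLinear.
Local Open Scope ring_scope.
Variables (F : fieldType) (gT : finGroupType) (mxv : gT -> 'M[F]_2).
Hypotheses (mxv1 : mxv 1%g = 1%:M) (mxvM : forall g h, mxv (g * h)%g = mxv g *m mxv h).
Hypotheses (mxv_inj : injective mxv) (mxv_surj : forall M, \det M != 0 -> exists g, mxv g = M).
Implicit Types (u v g h : gT) (a b c d x y : F).

Definition SL2_of : {set gT} := [set g | \det (mxv g) == 1].
Notation SL := SL2_of.

Lemma SL2_of_group_set : group_set SL.
Proof.
apply/group_setP; split=> [|A B]; first by rewrite inE mxv1 det1.
by rewrite !inE mxvM det_mulmx => /eqP-> /eqP->; rewrite mulr1.
Qed.
Canonical SL2_of_group := Group SL2_of_group_set.

Fact gl_key : unit. Proof. by []. Qed.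
(** Locked so that the choice does not unfold in computations; [glK] characterizes it. *)
Definition gl (M : 'M[F]_2) : gT := locked_with gl_key (odflt 1%g [pick g | mxv g == M]).

Lemma glK M : \det M != 0 -> mxv (gl M) = M.
Proof.
move=> /mxv_surj[g eg]; rewrite /gl unlock; case: pickP => [h /eqP //|/(_ g)].
by rewrite eg eqxx.
Qed.

Definition sl a b c d : gT := gl (mx2 a b c d).
Arguments sl (a b c d)%_R.

Lemma sl_eq a b c d a' b' c' d' : a = a' -> b = b' -> c = c' -> d = d' ->
  sl a b c d = sl a' b' c' d'.
Proof. by move=> -> -> -> ->. Qed.

Lemma slE a b c d : a * d - b * c = 1 -> mxv (sl a b c d) = mx2 a b c d.
Proof. by move=> e; rewrite glK // mx2_det e oner_eq0. Qed.

Lemma mem_sl a b c d : a * d - b * c = 1 -> sl a b c d \in SL.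
Proof. by move=> e; rewrite inE slE // mx2_det e. Qed.

Lemma slP u : u \in SL -> exists a b c d, a * d - b * c = 1 /\ u = sl a b c d.
Proof.
rewrite inE => /eqP e; have eM := mx2E (mxv u).
exists (mxv u 0 0), (mxv u 0 1), (mxv u 1 0), (mxv u 1 1).
have e1 : mxv u 0 0 * mxv u 1 1 - mxv u 0 1 * mxv u 1 0 = 1.
  by rewrite -mx2_det -eM.
by split=> //; apply: mxv_inj; rewrite slE // -eM.
Qed.

Lemma sl_inj a b c d a' b' c' d' : a * d - b * c = 1 -> a' * d' - b' * c' = 1 ->
  sl a b c d = sl a' b' c' d' -> [/\ a = a', b = b', c = c' & d = d'].
Proof. by move=> e e' /(congr1 mxv); rewrite !slE // => /mx2_inj. Qed.

Lemma sl_det a b c d a' b' c' d' : a * d - b * c = 1 -> a' * d' - b' * c' = 1 ->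
  (a * a' + b * c') * (c * b' + d * d') - (a * b' + b * d') * (c * a' + d * c') = 1.
Proof.
move=> e e'; transitivity ((a * d - b * c) * (a' * d' - b' * c')); first by ring.
by rewrite e e' mulr1.
Qed.

Lemma slM a b c d a' b' c' d' : a * d - b * c = 1 -> a' * d' - b' * c' = 1 ->
  (sl a b c d * sl a' b' c' d')%g =
  sl (a * a' + b * c') (a * b' + b * d') (c * a' + d * c') (c * b' + d * d').
Proof.
by move=> e e'; apply: mxv_inj; rewrite mxvM !slE ?mx2M // sl_det.
Qed.

Lemma sl1 : 1%g = sl 1 0 0 1.
Proof. by apply: mxv_inj; rewrite slE ?mxv1 -?mx2_1 //; ring. Qed.

Lemma slV a b c d : a * d - b * c = 1 -> ((sl a b c d)^-1)%g = sl d (- b) (- c) a.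
Proof.
move=> e; have e' : d * a - - b * - c = 1 by rewrite -e; ring.
apply: (mulgI (sl a b c d)); rewrite mulgV slM // sl1.
by apply: sl_eq; rewrite -?e; ring.
Qed.

Definition m1 : gT := sl (-1) 0 0 (-1).

Lemma det_m1 : (-1 : F) * -1 - 0 * 0 = 1. Proof. by ring. Qed.

Lemma m1_sl : m1 \in SL. Proof. by rewrite mem_sl ?det_m1. Qed.

Lemma m1_mul a b c d : a * d - b * c = 1 ->
  (m1 * sl a b c d)%g = sl (- a) (- b) (- c) (- d).
Proof. by move=> e; rewrite slM ?det_m1 //; apply: sl_eq; ring. Qed.

Lemma m1_comm u : u \in SL -> (u * m1 = m1 * u)%g.
Proof.
case/slP => a [b [c [d [e ->]]]]; rewrite m1_mul // slM ?det_m1 //.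
by apply: sl_eq; ring.
Qed.

Lemma m1J g : (m1 ^ g)%g = m1.
Proof.
apply: (mulgI g); rewrite -conjgC; apply: mxv_inj; rewrite !mxvM slE ?det_m1 //.
by rewrite (mx2E (mxv g)) !mx2M; f_equal; ring.
Qed.

Lemma m1_sqr : (m1 * m1)%g = 1%g.
Proof. by rewrite slM ?det_m1 // sl1; apply: sl_eq; ring. Qed.

Definition tr u : F := \tr (mxv u).

Lemma tr_sl a b c d : a * d - b * c = 1 -> tr (sl a b c d) = a + d.
Proof. by move=> e; rewrite /tr slE // mx2_tr. Qed.

Lemma trJ u g : tr (u ^ g)%g = tr u.
Proof.
rewrite /tr /conjg !mxvM mxtrace_mulC -mulmxA -mxvM.
by rewrite mulgV mxv1 mulmx1.
Qed.

Lemma tr_m1M u : u \in SL -> tr (m1 * u)%g = - tr u.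
Proof.
case/slP => a [b [c [d [e ->]]]]; rewrite m1_mul // !tr_sl ?opprD //.
by rewrite -e; ring.
Qed.

(** The trace form of Cayley-Hamilton, [v + v^-1 = tr v]. *)
Lemma tr_mulV u v : u \in SL -> v \in SL -> tr (u * v^-1)%g = tr u * tr v - tr (u * v)%g.
Proof.
case/slP => a [b [c [d [e ->]]]] /slP[a' [b' [c' [d' [e' ->]]]]].
have e2 : d' * a' - - b' * - c' = 1 by rewrite -e'; ring.
by rewrite slV // !slM // !tr_sl ?sl_det //; ring.
Qed.

Lemma SL_norm g u : (u ^ g \in SL)%g = (u \in SL).
Proof.
rewrite !inE /conjg !mxvM !det_mulmx mulrCA mulrA -mulrA -det_mulmx -mxvM.
by rewrite mulVg mxv1 det1 mulr1.
Qed.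

Lemma SL_conj g : (SL :^ g)%g = SL.
Proof.
apply/setP => u; rewrite mem_conjg -(SL_norm g) conjgKV //.
Qed.

(** * Transvections and generation of SL2 *)

Definition U x : gT := sl 1 x 0 1.
Definition L x : gT := sl 1 0 x 1.
Definition w : gT := sl 0 1 (-1) 0.
Arguments U x%_R.
Arguments L x%_R.

Lemma det_U x : (1 : F) * 1 - x * 0 = 1. Proof. by ring. Qed.
Lemma det_L x : (1 : F) * 1 - 0 * x = 1. Proof. by ring. Qed.
Lemma det_w : (0 : F) * 0 - 1 * -1 = 1. Proof. by ring. Qed.

Lemma U_sl x : U x \in SL. Proof. exact/mem_sl/det_U. Qed.
Lemma L_sl x : L x \in SL. Proof. exact/mem_sl/det_L. Qed.
Lemma w_sl : w \in SL. Proof. exact/mem_sl/det_w. Qed.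

Lemma UD x y : (U x * U y)%g = U (x + y).
Proof. by rewrite slM ?det_U //; apply: sl_eq; ring. Qed.

Lemma LD x y : (L x * L y)%g = L (x + y).
Proof. by rewrite slM ?det_L //; apply: sl_eq; ring. Qed.

Lemma U0 : U 0 = 1%g. Proof. by rewrite sl1. Qed.
Lemma L0 : L 0 = 1%g. Proof. by rewrite sl1. Qed.

Lemma UX x n : (U x ^+ n)%g = U (x *+ n).
Proof. by elim: n => [|n IH]; rewrite ?mulr0n ?U0 // expgS IH UD mulrS. Qed.

Lemma LX x n : (L x ^+ n)%g = L (x *+ n).
Proof. by elim: n => [|n IH]; rewrite ?mulr0n ?L0 // expgS IH LD mulrS. Qed.

(** [F] is a prime field: any nonzero element generates it additively, so one transvection yields
    its whole root subgroup. *)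
Hypothesis F_prime : forall x y, x != 0 -> exists n, x *+ n = y.

Lemma U_all (H : {group gT}) x : x != 0 -> U x \in H -> forall y, U y \in H.
Proof. by move=> nz xH y; have [n <-] := F_prime y nz; rewrite -UX groupX. Qed.

Lemma L_all (H : {group gT}) x : x != 0 -> L x \in H -> forall y, L y \in H.
Proof. by move=> nz xH y; have [n <-] := F_prime y nz; rewrite -LX groupX. Qed.

(** If [c != 0] the matrix factors as upper, lower, upper transvection; if [c = 0], multiplying by
    [L 1] turns the lower left entry into [d], which is nonzero. *)
Lemma SL_gen (H : {group gT}) : (forall x, U x \in H) -> (forall x, L x \in H) -> SL \subset H.
Proof.
move=> hU hL.
have nz a b c d : c != 0 -> a * d - b * c = 1 -> sl a b c d \in H.
  move=> nc e; suff -> : sl a b c d = (U ((a - 1) / c)%R * L c * U ((d - 1) / c)%R)%g.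
    by rewrite !groupM.
  have hb : b = (a * d - 1) / c by rewrite -e; field.
  by rewrite !slM ?sl_det ?det_U ?det_L //; apply: sl_eq; rewrite ?hb; field.
apply/subsetP => u /slP[a [b [c [d [e ->]]]]].
have [c0|nc] := eqVneq c 0; last exact: nz.
have d0 : d != 0.
  by apply/eqP => d0; move: e; rewrite c0 d0 !mulr0 subr0 => /eqP; rewrite eq_sym oner_eq0.
suff : (sl a b c d * L 1)%g \in H by rewrite groupMr.
rewrite slM ?det_L //; apply: nz; last by apply: sl_det; rewrite ?det_L.
by apply: contraNneq d0 => h; apply/eqP; rewrite -[RHS]h c0; ring.
Qed.

Lemma w_conjU x : (U x ^ w^-1)%g = L (- x).
Proof.
have e : (0 : F) * 0 - -1 * - -1 = 1 by ring.
by rewrite /conjg invgK slV ?det_w // !slM ?sl_det ?det_U ?det_w //; apply: sl_eq; ring.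
Qed.

Lemma SL_gen_Uw (H : {group gT}) : U 1 \in H -> w \in H -> SL \subset H.
Proof.
move=> UH wH; have hU := U_all (oner_neq0 _) UH; apply: SL_gen => // x.
by rewrite -[x]opprK -w_conjU groupJ ?groupV.
Qed.

(** Upper transvections on both sides clear the diagonal; the antidiagonal matrix so obtained
    conjugates the upper transvections to the lower ones. *)
Lemma SL_gen_U (H : {group gT}) a b c d : U 1 \in H -> a * d - b * c = 1 -> c != 0 ->
  sl a b c d \in H -> SL \subset H.
Proof.
move=> UH e nc hH; have hU := U_all (oner_neq0 _) UH; apply: SL_gen => // x.
have hb : b = (a * d - 1) / c by rewrite -e; field.
have ew : 0 * 0 - - c^-1 * c = 1 by field.
have wE : (U (- (a / c)) * sl a b c d * U (- (d / c)))%g = sl 0 (- c^-1) c 0.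
  by rewrite !slM ?sl_det ?det_U //; apply: sl_eq; rewrite ?hb; field.
have wH : sl 0 (- c^-1) c 0 \in H by rewrite -wE !groupM.
suff -> : L x = (U (- x / c ^+ 2)%R ^ (sl 0 (- c^-1) c 0)^-1)%g by rewrite groupJ ?groupV.
have ew' : 0 * 0 - - - c^-1 * - c = 1 by field.
by rewrite /conjg invgK slV // !slM ?sl_det ?det_U //; apply: sl_eq; field.
Qed.

Lemma unipotent_conj u : u \in SL -> u != 1%g -> tr u = 2%:R -> exists g, (u ^ g)%g = U 1.
Proof.
case/slP => a [b [c [d [e ->]]]] n1; rewrite tr_sl // => t2.
have hd : d = 2%:R - a by rewrite -t2; ring.
suff [M dM eM] : exists2 M : 'M[F]_2, \det M != 0 & mx2 a b c d *m M = M *m mx2 1 1 0 1.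
  exists (gl M); apply: (mulgI (gl M)); rewrite -conjgC; apply: mxv_inj.
  by rewrite !mxvM glK // !slE ?det_U.
have [c0|nc] := eqVneq c 0.
  have a1 : a = 1.
    apply/eqP; rewrite -subr_eq0 -sqrf_eq0; apply/eqP.
    transitivity (1 - (a * d - b * c)); last by rewrite e subrr.
    by rewrite c0 hd; ring.
  have d1 : d = 1 by rewrite hd a1; ring.
  have nb : b != 0.
    by apply: contraNneq n1 => b0; rewrite b0 c0 a1 d1 -sl1.
  exists (mx2 b 0 0 1); first by rewrite mx2_det mulr1 mulr0 subr0.
  by rewrite !mx2M a1 c0 d1; f_equal; ring.
(* A Jordan basis: the columns are the image of the first basis vector under [u - 1] and that vector
   itself. *)
exists (mx2 (a - 1) 1 c 0); first by rewrite mx2_det mulr0 mul1r sub0r oppr_eq0.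
have hbc : b * c = a * d - 1 by rewrite -e; ring.
rewrite !mx2M; f_equal; rewrite ?hbc ?hd; ring.
Qed.

Lemma val_X u n : mxv (u ^+ n)%g = mxv u ^+ n.
Proof. by elim: n => [|n IH]; rewrite ?expg0 ?mxv1 // expgS exprS mxvM IH mulmxE. Qed.

(** Cayley-Hamilton: [u ^+ 2 = t u - 1] and [u ^+ 3 = (t ^+ 2 - 1) u - t], with [t] the trace. *)
Lemma sl_sqr a b c d : a * d - b * c = 1 ->
  (sl a b c d ^+ 2)%g = sl ((a + d) * a - 1) ((a + d) * b) ((a + d) * c) ((a + d) * d - 1).
Proof. by move=> e; rewrite expgS expg1 slM //; apply: sl_eq; rewrite -?e; ring. Qed.

Lemma sl_cube a b c d : a * d - b * c = 1 ->
  (sl a b c d ^+ 3)%g = sl (((a + d) ^+ 2 - 1) * a - (a + d)) (((a + d) ^+ 2 - 1) * b)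
                           (((a + d) ^+ 2 - 1) * c) (((a + d) ^+ 2 - 1) * d - (a + d)).
Proof.
move=> e; rewrite 2!expgS expg1 !slM ?sl_det //.
have hbc : b * c = a * d - 1 by rewrite -e; ring.
apply: sl_eq.
- transitivity (a * a * a + 2%:R * a * (b * c) + d * (b * c)); first by ring.
  by rewrite hbc; ring.
- transitivity (b * (a * a + a * d + d * d + b * c)); first by ring.
  by rewrite hbc; ring.
- transitivity (c * (a * a + a * d + d * d + b * c)); first by ring.
  by rewrite hbc; ring.
transitivity (d * d * d + 2%:R * d * (b * c) + a * (b * c)); first by ring.
by rewrite hbc; ring.
Qed.

(** * Centre, elements of order p and normal subgroups of SL2(p) *)

Section PrimeField.
Variables (p : nat) (p_pr : prime p) (p_char : p \in [pchar F]) (p_gt30 : (30 < p)%N).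

(** Applied to the integers 2, 4 and 15. *)
Lemma natF_neq0 n : (0 < n <= 30)%N -> n%:R != 0 :> F.
Proof.
by move=> hn; rewrite -(dvdn_pcharf p_char); apply/negP => /dvdn_leq; lia.
Qed.

Let n2 : 2%:R != 0 :> F. Proof. exact: natF_neq0. Qed.

Lemma m1_neq1 : m1 != 1%g.
Proof.
apply/eqP; rewrite sl1 => /sl_inj[].
- exact: det_m1.
- by ring.
move=> h _ _ _; case/eqP: n2; transitivity (1 - (-1 : F)); first by ring.
by rewrite h subrr.
Qed.

Lemma sl_scalar a b c d : a * d - b * c = 1 -> b = 0 -> c = 0 -> a = d ->
  sl a b c d = 1%g \/ sl a b c d = m1.
Proof.
move=> e b0 c0 ad; have : (a - 1) * (a + 1) = 0.
  transitivity (a * d - b * c - 1); last by rewrite e subrr.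
  by rewrite b0 c0 -ad; ring.
move/eqP; rewrite mulf_eq0 => /orP[]; rewrite ?subr_eq0 ?addr_eq0 => /eqP a1.
  by left; rewrite b0 c0 -ad a1 sl1.
by right; rewrite b0 c0 -ad a1.
Qed.

Lemma SL_centerP u : reflect (u = 1%g \/ u = m1) (u \in 'Z(SL))%g.
Proof.
apply: (iffP (centerP _ _)) => [[uS cu]|[->|->]]; last first.
- by split; [exact: m1_sl | move=> v vS; rewrite /commute m1_comm].
- by split; [exact: group1 | move=> v vS; rewrite /commute mulg1 mul1g].
have [a [b [c [d [e eu]]]]] := slP uS; rewrite eu in cu *.
have := cu _ (U_sl 1); rewrite /commute !slM ?det_U // => /sl_inj[].
- exact/sl_det/det_U.
- exact/(sl_det (det_U 1)).
move=> h1 _ _ h4.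
have := cu _ (L_sl 1); rewrite /commute !slM ?det_L // => /sl_inj[].
- exact/sl_det/det_L.
- exact/(sl_det (det_L 1)).
move=> h5 _ h7 _.
have c0 : c = 0.
  have -> : c = (1 * a + 1 * c) - (a * 1 + b * 0) by ring.
  by rewrite -h1 subrr.
have b0 : b = 0.
  have -> : b = (a * 1 + b * 1) - (1 * a + 0 * c) by ring.
  by rewrite h5 subrr.
apply: sl_scalar => //.
transitivity (1 * a + 1 * c - c); first by ring.
by rewrite -h7; ring.
Qed.

Lemma card_center : #|'Z(SL)%g| = 2%N.
Proof.
suff -> : ('Z(SL) = [set 1; m1])%g by rewrite cards2 eq_sym m1_neq1.
by apply/setP => u; apply/SL_centerP/set2P.
Qed.

Lemma order_U x : x != 0 -> #[U x]%g = p.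
Proof.
move=> nx; apply: nt_prime_order => //.
  by rewrite UX -mulr_natr (pcharf0 p_char) mulr0 U0.
rewrite sl1; apply/eqP => /sl_inj[]; [exact: det_U | by ring |].
by move=> _ h _ _; rewrite h eqxx in nx.
Qed.

(** In characteristic [p], [(u - 1) ^+ p = u ^+ p - 1 = 0], so [u - 1] is singular, and its
    determinant is [2 - tr u]. *)
Lemma tr_order_p u : u \in SL -> (u ^+ p = 1)%g -> tr u = 2%:R.
Proof.
move=> uS up; have [a [b [c [d [e eu]]]]] := slP uS.
have pM : p \in [pchar 'M[F]_2] by rewrite pchar_lalg.
have h0 : (mxv u - 1) ^+ p = 0.
  rewrite -(pFrobenius_autE pM) pFrobenius_autB_comm; last exact: commr1.
  by rewrite !pFrobenius_autE expr1n -val_X up mxv1 subrr.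
have : \det (mxv u - 1) = 0.
  apply/eqP; apply: contraT => nz.
  have h1 : mxv u - 1 \in unitmx by rewrite unitmxE unitfE.
  by have := @unitrX _ (mxv u - 1) p h1; rewrite h0 unitr0.
rewrite eu slE // -[1]/(1%:M) mx2_1.
have -> : mx2 a b c d - mx2 1 0 0 1 = mx2 (a - 1) b c (d - 1).
  apply/matrixP => i j; rewrite !mxE.
  by case: (ord2P i) => ->; case: (ord2P j) => -> /=; rewrite ?subr0.
rewrite mx2_det tr_sl // => h.
transitivity (1 + (a * d - b * c) - ((a - 1) * (d - 1) - b * c)); first by ring.
by rewrite h e subr0.
Qed.

Lemma order_tr2 u : u \in SL -> u != 1%g -> tr u = 2%:R -> #[u]%g = p.
Proof.
by move=> uS u1 /(unipotent_conj uS u1)[g e]; rewrite -(orderJ u g) e order_U ?oner_eq0.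
Qed.

Lemma upper_comm_tr a b d a' b' d' : a * d = 1 -> a' * d' = 1 ->
  tr [~ sl a b 0 d, sl a' b' 0 d']%g = 2%:R.
Proof.
move=> e e'; have e1 : a * d - b * 0 = 1 by rewrite mulr0 subr0.
have e2 : a' * d' - b' * 0 = 1 by rewrite mulr0 subr0.
have e1' : d * a - - b * - 0 = 1 by rewrite -e; ring.
have e2' : d' * a' - - b' * - 0 = 1 by rewrite -e'; ring.
rewrite /commg /conjg !slV // !slM ?sl_det // tr_sl ?sl_det //.
transitivity ((a * d) * (a' * d') + (a * d) * (a' * d')); first by ring.
by rewrite e e'; ring.
Qed.

(** By Cauchy, [H] contains an element of order [p], conjugate to [U 1]. Unless [H] is everything,
    it is then upper triangular up to conjugation, and all its commutators have trace 2. *)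
Lemma SL_gen_p (H : {group gT}) (x y : gT) : H \subset SL -> (p %| #|H|)%N ->
  x \in H -> y \in H -> tr [~ x, y]%g <> 2%:R -> SL \subset H.
Proof.
move=> sH pH xH yH ntr; have [u uH ou] := Cauchy p_pr pH.
have uS := subsetP sH _ uH.
have u1 : u != 1%g by rewrite -order_eq1 ou; apply/eqP => e; move: p_pr; rewrite e.
have [|g eg] := unipotent_conj uS u1.
  by apply: tr_order_p => //; rewrite -ou expg_order.
have sHg : (H :^ g \subset SL)%g by rewrite -(SL_conj g) conjSg.
have UH : U 1 \in (H :^ g)%G by rewrite -eg memJ_conjg.
suff : (SL \subset (H :^ g)%G)%g by rewrite /= -{1}(SL_conj g) conjSg.
apply/negPn/negP => nS; apply: ntr; rewrite -(trJ _ g) conjRg.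
have up z : z \in H -> exists a b d, a * d = 1 /\ (z ^ g)%g = sl a b 0 d.
  move=> zH; have zHg : (z ^ g)%g \in (H :^ g)%G by rewrite memJ_conjg.
  have [a [b [c [d [e ez]]]]] := slP (subsetP sHg _ zHg).
  have [c0|nc] := eqVneq c 0; last first.
    by case/negP: nS; apply: (@SL_gen_U _ a b c d) => //; rewrite -ez.
  by exists a, b, d; rewrite -e c0 mulr0 subr0 -c0.
have [a [b [d [e ->]]]] := up _ xH; have [a' [b' [d' [e' ->]]]] := up _ yH.
exact: upper_comm_tr.
Qed.

(** A noncentral element gives one with [c != 0], conjugate in GL2 to a companion matrix. Two
    successive commutators with fixed elements of SL2 turn it into a nontrivial transvection
    whatever its trace. *)
Lemma SL_normal_gen (N : {group gT}) u : N \subset SL -> (SL \subset 'N(N))%g ->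
  u \in N -> u \notin 'Z(SL)%g -> SL \subset N.
Proof.
move=> sN nN uN nz.
have Nconj v g : v \in N -> g \in SL -> (v ^ g \in N)%g.
  by move=> vN gS; rewrite memJ_norm // (subsetP nN).
have [a [b [c [d [e nc aN]]]]] : exists a b c d, [/\ a * d - b * c = 1, c != 0 & sl a b c d \in N].
  have [a [b [c [d [e eu]]]]] := slP (subsetP sN _ uN).
  have [c0|nc] := eqVneq c 0; last by exists a, b, c, d; rewrite -eu.
  have [b0|nb] := eqVneq b 0; last first.
    exists d, (- c), (- b), a; split; [by rewrite -e; ring | by rewrite oppr_eq0 |].
    have e3 : (0 : F) * 0 - -1 * - -1 = 1 by ring.
    suff <- : (u ^ w)%g = sl d (- c) (- b) a by apply: Nconj => //; apply: w_sl.
    by rewrite eu /conjg slV ?det_w // !slM ?sl_det ?det_w //; apply: sl_eq; ring.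
  have nad : d - a != 0.
    apply/eqP => /eqP; rewrite subr_eq0 => /eqP ad; case/negP: nz.
    by apply/SL_centerP; rewrite eu; apply: sl_scalar.
  exists a, 0, (d - a), d; split=> //; first by rewrite -e b0; ring.
  have e3 : (1 : F) * 1 - - 0 * - 1 = 1 by ring.
  suff <- : (u ^ L 1)%g = sl a 0 (d - a) d by apply: Nconj => //; apply: L_sl.
  have e0 : a * d - 0 * 0 = 1 by rewrite -[RHS]e b0 c0.
  by rewrite eu b0 c0 /conjg slV ?det_L // !slM ?sl_det ?det_L //; apply: sl_eq; ring.
pose t := a + d; pose M := mx2 1 a 0 c; pose g := gl M.
have dM : \det M != 0 by rewrite mx2_det mul1r mulr0 subr0.
have e1 : 0 * t - -1 * 1 = 1 by ring.
have A'E : (sl a b c d ^ g)%g = sl 0 (-1) 1 t.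
  apply: (mulgI g); rewrite -conjgC; apply: mxv_inj.
  have gE : mxv g = M by apply: glK.
  rewrite !mxvM gE !slE // !mx2M; have hbc : b * c = a * d - 1 by rewrite -e; ring.
  by f_equal; rewrite ?hbc /t; ring.
pose N' := (N :^ g)%G.
have A'N : sl 0 (-1) 1 t \in N' by rewrite -A'E memJ_conjg.
have N'conj v h : v \in N' -> h \in SL -> (v ^ h \in N')%g.
  move=> vN hS; rewrite memJ_norm // (subsetP _ _ hS) //= -(SL_conj g).
  by rewrite normJ conjSg.
have eD : 2%:R * (2%:R)^-1 - 0 * 0 = 1 :> F by rewrite divff // mulr0 subr0.
have eD' : (2%:R)^-1 * 2%:R - - 0 * - 0 = 1 :> F by field.
pose D := sl 2%:R 0 0 (2%:R)^-1; have DS : D \in SL by apply: mem_sl.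
have e1' : t * 0 - - -1 * - 1 = 1 by ring.
pose s := 3%:R * t / 4%:R.
have n4 : 4%:R != 0 :> F by apply: natF_neq0.
have eE : (4%:R)^-1 * 4%:R - 0 * s = 1 :> F by field.
(* The commutator of the companion matrix with diag(2, 1/2) is lower triangular with diagonal 1/4,
   4. *)
have EN : sl (4%:R)^-1 0 s 4%:R \in N'.
  have -> : sl (4%:R)^-1 0 s 4%:R = (sl 0 (-1) 1 t * ((sl 0 (-1) 1 t)^-1 ^ D^-1))%g.
    by rewrite /conjg invgK !slV // !slM ?sl_det //; apply: sl_eq; rewrite /s; field; rewrite ?n2 ?n4.
  by apply: groupM => //; apply: N'conj; rewrite groupV.
have eE' : 4%:R * (4%:R)^-1 - - 0 * - s = 1 :> F by field.
(* Conjugating [L 1] by that element gives [L 16], whence the commutator [L 15]. *)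
have LN : L 15%:R \in N'.
  have -> : L 15%:R = (sl (4%:R)^-1 0 s 4%:R * ((sl (4%:R)^-1 0 s 4%:R)^-1 ^ (L 1)^-1))%g.
    have e3 : (1 : F) * 1 - - 0 * - 1 = 1 by ring.
    by rewrite /conjg invgK !slV ?det_L // !slM ?sl_det ?det_L //; apply: sl_eq; field.
  by apply: groupM => //; apply: N'conj; rewrite groupV //; apply: L_sl.
have hL := L_all (natF_neq0 (isT : 0 < 15 <= 30)%N) LN.
suff : SL \subset N' by rewrite /= -{1}(SL_conj g) conjSg.
apply: SL_gen => // x; have -> : U x = (L (- x) ^ w)%g.
  by rewrite -w_conjU -conjgM mulVg conjg1.
by apply: N'conj => //; apply: w_sl.
Qed.

(** For nonscalar [u], the square [t u - 1] is scalar only if the trace [t] vanishes. *)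
Lemma sl_trace_eq0 u : u \in SL -> u \notin 'Z(SL)%g -> (u ^+ 2 \in 'Z(SL))%g -> tr u = 0.
Proof.
case/slP => a [b [c [d [e ->]]]] nz; rewrite tr_sl // sl_sqr // => h.
have eq1 : ((a + d) * a - 1) * ((a + d) * d - 1) - (a + d) * b * ((a + d) * c) = 1.
  have hbc : b * c = a * d - 1 by rewrite -e; ring.
  transitivity (((a + d) * a - 1) * ((a + d) * d - 1) - (a + d) ^+ 2 * (b * c)); first by ring.
  by rewrite hbc; ring.
have [b0 [c0 ad]] : (a + d) * b = 0 /\ (a + d) * c = 0 /\ (a + d) * a - 1 = (a + d) * d - 1.
  by case/SL_centerP: h; rewrite ?sl1 => /sl_inj[] //; [ring | | ring |] => -> -> -> ->.
apply/eqP; apply: contraNT nz => t0; apply/SL_centerP; apply: sl_scalar => //.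
- by apply: (mulfI t0); rewrite b0 mulr0.
- by apply: (mulfI t0); rewrite c0 mulr0.
by apply: (mulfI t0); apply: (addIr (-1)).
Qed.

Lemma sl_trace_sqr1 u : u \in SL -> u \notin 'Z(SL)%g -> (u ^+ 3 \in 'Z(SL))%g ->
  tr u ^+ 2 = 1.
Proof.
case/slP => a [b [c [d [e ->]]]] nz h; have uS := mem_sl e.
rewrite tr_sl //; set t := a + d; have hbc : b * c = a * d - 1 by rewrite -e; ring.
have eq1 : ((t ^+ 2 - 1) * a - t) * ((t ^+ 2 - 1) * d - t) -
    (t ^+ 2 - 1) * b * ((t ^+ 2 - 1) * c) = 1.
  transitivity (((t ^+ 2 - 1) * a - t) * ((t ^+ 2 - 1) * d - t) -
    (t ^+ 2 - 1) ^+ 2 * (b * c)); first by ring.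
  by rewrite hbc /t; ring.
rewrite sl_cube // in h.
have [b0 [c0 ad]] : (t ^+ 2 - 1) * b = 0 /\ (t ^+ 2 - 1) * c = 0 /\
    (t ^+ 2 - 1) * a - t = (t ^+ 2 - 1) * d - t.
  by case/SL_centerP: h; rewrite ?sl1 => /sl_inj[] //; [ring | | ring |] => -> -> -> ->.
apply/eqP; rewrite -subr_eq0; apply: contraNT nz => t0; apply/SL_centerP; apply: sl_scalar => //.
- by apply: (mulfI t0); rewrite b0 mulr0.
- by apply: (mulfI t0); rewrite c0 mulr0.
by apply: (mulfI t0); apply: (addIr (- t)).
Qed.

(** * Automorphisms of PSL2(p) *)

Section Automorphism.
Local Notation Z := ('Z(SL))%g.
Local Notation q := (coset Z).
Variable beta : {morphism (SL / Z)%g >-> coset_of Z}.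
Hypotheses (beta_inj : ('injm beta)%g) (beta_im : (beta @* (SL / Z) \subset SL / Z)%g).

Lemma Z_norm u : u \in SL -> (u \in 'N(Z))%g.
Proof. by apply: (subsetP (normal_norm (center_normal SL2_of_group))). Qed.

Lemma mem_coset_SL u : u \in SL -> (q u \in SL / Z)%g.
Proof. by move=> uS; rewrite mem_quotient. Qed.

Lemma coset_eq u v : u \in SL -> v \in SL -> q u = q v -> u = v \/ u = (m1 * v)%g.
Proof.
move=> uS vS e; have : (u * v^-1 \in Z)%g.
  apply: coset_idr; first by rewrite Z_norm // groupM ?groupV.
  by rewrite morphM ?morphV ?groupV ?Z_norm //= e mulgV.
case/SL_centerP => h; [left|right]; last by rewrite -h mulgKV.
by apply/eqP; rewrite eq_mulgV1 h.
Qed.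

Lemma coset_m1 u : u \in SL -> q (m1 * u)%g = q u.
Proof.
move=> uS; rewrite morphM ?Z_norm ?m1_sl //= coset_id ?mul1g //.
by apply/SL_centerP; right.
Qed.

Lemma beta_lift u : u \in SL -> exists2 v, v \in SL & beta (q u) = q v.
Proof.
move=> uS; have : beta (q u) \in (SL / Z)%g.
  by apply: (subsetP beta_im); rewrite mem_morphim ?mem_coset_SL.
by case/morphimP => v _ vS ->; exists v.
Qed.

Lemma beta_coset1 u v : u \in SL -> v \in SL -> beta (q u) = q v ->
  (v \in Z) = (u \in Z).
Proof.
move=> uS vS e; apply/idP/idP => h.
  apply: coset_idr; first exact: Z_norm.
  apply: (injmP beta_inj); rewrite ?mem_coset_SL ?group1 //.
  by rewrite e morph1 coset_id.
apply: coset_idr; first exact: Z_norm.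
by rewrite -e (coset_id h) morph1.
Qed.

Lemma U_notin_Z : U 1 \notin Z.
Proof.
apply/negP => /SL_centerP[]; rewrite ?sl1 => /sl_inj[];
  try (by rewrite ?det_U ?det_m1); try ring; move=> _ /eqP; by rewrite oner_eq0.
Qed.

Lemma w_notin_Z : w \notin Z.
Proof.
apply/negP => /SL_centerP[]; rewrite ?sl1 => /sl_inj[];
  try (by rewrite ?det_w ?det_m1); try ring; move=> _ /eqP; by rewrite oner_eq0.
Qed.

Lemma w_sqr : (w ^+ 2)%g = m1.
Proof. by rewrite sl_sqr ?det_w //; apply: sl_eq; ring. Qed.

Lemma Uw_cube : ((U 1 * w) ^+ 3)%g = 1%g.
Proof.
rewrite slM ?det_U ?det_w // sl_cube ?sl_det ?det_U ?det_w // sl1.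
by apply: sl_eq; ring.
Qed.

Lemma odd_p : odd p.
Proof. by case/even_prime: p_pr => // e; move: p_gt30; rewrite e. Qed.

(* U 1 and w generate SL2(p), and the relations U^p = 1, w^2 = -1, (U w)^3 = 1
   determine their images under beta up to a common conjugation and signs. *)
Lemma SL_automorphism : exists g, forall u, u \in SL -> beta (q u) = q (u ^ g)%g.
Proof.
have qX n u : u \in SL -> q (u ^+ n)%g = (q u ^+ n)%g by move=> uS; rewrite morphX ?Z_norm.
have bX n u v : u \in SL -> v \in SL -> beta (q u) = q v -> beta (q (u ^+ n)%g) = q (v ^+ n)%g.
  by move=> uS vS e; rewrite !qX // morphX ?mem_coset_SL // e.
have qM u v : u \in SL -> v \in SL -> q (u * v)%g = (q u * q v)%g.
  by move=> uS vS; apply: morphM; apply: Z_norm.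
have bM u v : u \in SL -> v \in SL -> beta (q (u * v)%g) = (beta (q u) * beta (q v))%g.
  by move=> uS vS; rewrite qM //; apply: morphM; apply: mem_coset_SL.
have [V [VS eV Vp V1]] : exists V, [/\ V \in SL, beta (q (U 1)) = q V, (V ^+ p = 1)%g & V != 1%g].
  have [V VS eV] := beta_lift (U_sl 1).
  have nV : V \notin Z by rewrite (beta_coset1 (U_sl 1) VS eV) U_notin_Z.
  have : (V ^+ p \in Z)%g.
    have -> : (V ^+ p \in Z)%g = (U 1 ^+ p \in Z)%g.
      by apply: beta_coset1 (bX p _ _ (U_sl 1) VS eV); apply: groupX => //; apply: U_sl.
    by rewrite -(order_U (oner_neq0 _)) expg_order group1.
  (* As [p] is odd, one of the two lifts [V] and [m1 * V] has [p]-th power 1. *)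
  case/SL_centerP => h; [exists V|exists (m1 * V)%g]; split; rewrite ?coset_m1 //; try exact: groupM m1_sl VS.
  - by apply: contraNneq nV => ->; rewrite group1.
  - rewrite expgMn; last by rewrite /commute m1_comm.
    rewrite h -(odd_double_half p) odd_p -muln2 mulnC add1n expgS expgM.
    by rewrite [(m1 ^+ 2)%g]expgS expg1 m1_sqr expg1n mulg1 m1_sqr.
  apply: contraNneq nV => e; apply/SL_centerP; right.
  by apply: (mulgI m1); rewrite e m1_sqr.
have [g0 eg0] := unipotent_conj VS V1 (tr_order_p VS Vp).
have [W0 W0S eW0] := beta_lift w_sl.
have nW0 : W0 \notin Z by rewrite (beta_coset1 w_sl W0S eW0) w_notin_Z.
have tW0 : tr W0 = 0.
  apply: sl_trace_eq0 => //.
  have -> : (W0 ^+ 2 \in Z)%g = (w ^+ 2 \in Z)%g.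
    by apply: beta_coset1 (bX 2 _ _ w_sl W0S eW0); apply: groupX => //; apply: w_sl.
  by apply/SL_centerP; right; apply: w_sqr.
have VW3 : ((V * W0) ^+ 3 \in Z)%g.
  have e3 : beta (q (U 1 * w)%g) = q (V * W0)%g.
    by rewrite (bM _ _ (U_sl 1) w_sl) (qM _ _ VS W0S) eV eW0.
  have UwS : (U 1 * w)%g \in SL := groupM (U_sl 1) w_sl.
  have VWS : (V * W0)%g \in SL by rewrite groupM.
  have -> : ((V * W0) ^+ 3 \in Z)%g = ((U 1 * w) ^+ 3 \in Z)%g.
    by apply: beta_coset1 (bX 3 _ _ UwS VWS e3); rewrite groupX.
  by rewrite Uw_cube group1.
(* After conjugation by [g0], the image of [U 1] is [U 1] itself and [W] has trace 0. The cube
   relation forces the lower left entry of [W] to be 1 or -1, so up to sign [W] is the conjugate of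
   [w] by some [U x], which centralizes [U 1]. *)
pose W := (W0 ^ g0)%g.
have WS : W \in SL by rewrite SL_norm.
have [a [b [c [d [e eW]]]]] := slP WS.
have ad : d = - a.
  apply/eqP; rewrite -addr_eq0 addrC -(tr_sl e) -eW trJ; exact/eqP.
have Zg v : (v ^ g0 \in Z)%g -> v \in Z.
  move/SL_centerP => h; apply/SL_centerP; case: h => h; [left|right].
    by apply/eqP; rewrite -(conjg_eq1 v g0) h.
  by rewrite -(m1J g0^-1) -h conjgK.
have c1 : c ^+ 2 = 1.
  have UWE : (U 1 * W)%g = ((V * W0) ^ g0)%g by rewrite conjMg eg0.
  have tUW : tr (U 1 * W)%g = c.
    by rewrite eW slM ?det_U // tr_sl ?sl_det ?det_U // ad; ring.
  rewrite -tUW; apply: sl_trace_sqr1; first by apply: groupM => //; apply: U_sl.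
    apply/negP; rewrite UWE => /Zg h.
    have : tr W0 = 0 by []; have [a' [b' [c' [d' [e' eV']]]]] := slP VS.
    have tV : tr V^-1 = 2%:R.
      by rewrite eV' slV // tr_sl -?(tr_order_p VS Vp) ?eV' ?tr_sl //; [ring | rewrite -e'; ring].
    case/SL_centerP: h => h.
      have -> : W0 = V^-1%g by apply: (mulgI V); rewrite h mulgV.
      by rewrite tV => /eqP; rewrite (negPf n2).
    have -> : W0 = (m1 * V^-1)%g.
      by apply: (mulgI V); rewrite h mulgA (m1_comm VS) mulgK.
    by rewrite tr_m1M ?groupV // tV => /eqP; rewrite oppr_eq0 (negPf n2).
  rewrite UWE -conjXg; case/SL_centerP: VW3 => ->; first by rewrite conj1g group1.
  by rewrite m1J; apply/SL_centerP; right.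
have hb : b * c = - a ^+ 2 - 1 by rewrite -e ad; ring.
have wU x : (w ^ U x)%g = sl x (1 + x ^+ 2) (-1) (- x).
  have e4 : (1 : F) * 1 - - x * - 0 = 1 by ring.
  by rewrite /conjg slV ?det_U // !slM ?sl_det ?det_U ?det_w //; apply: sl_eq; ring.
have [x qW] : exists x, W = (w ^ U x)%g \/ W = (m1 * (w ^ U x))%g.
  have dw x : x * - x - (1 + x ^+ 2) * -1 = 1 by ring.
  have : (c - 1) * (c + 1) = 0 by transitivity (c ^+ 2 - 1); [ring | rewrite c1 subrr].
  move/eqP; rewrite mulf_eq0 subr_eq0 addr_eq0 => /orP[]/eqP ec.
    exists (- a); right; rewrite wU m1_mul // eW; apply: sl_eq; rewrite ?ec ?ad //; try ring.
    by transitivity (b * c); [rewrite ec mulr1 | rewrite hb; ring].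
  exists a; left; rewrite wU eW; apply: sl_eq; rewrite ?ec ?ad //; try ring.
  by transitivity (- (b * c)); [rewrite ec; ring | rewrite hb; ring].
have WS' : (w ^ U x)%g \in SL by rewrite SL_norm w_sl.
pose g := (U x * g0^-1)%g.
have gU : (U 1 ^ g)%g = V.
  rewrite conjgM; have -> : (U 1 ^ U x)%g = U 1.
    by apply: (mulgI (U x)); rewrite -conjgC !UD addrC.
  by rewrite -eg0 conjgK.
have gw : q W0 = q (w ^ g)%g.
  have W0E : W0 = (W ^ g0^-1)%g by rewrite conjgK.
  rewrite W0E conjgM; case: qW => ->; first by [].
  by rewrite conjMg m1J coset_m1 // SL_norm.
exists g; pose H := [set u in SL | beta (q u) == q (u ^ g)%g].
have gH : group_set H.
  apply/group_setP; split; first by rewrite inE group1 conj1g !morph1 eqxx.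
  move=> u1 u2 /setIdP[u1S /eqP h1] /setIdP[u2S /eqP h2]; rewrite inE groupM //=.
  by apply/eqP; rewrite conjMg bM // qM ?SL_norm // h1 h2.
have sSH : SL \subset Group gH.
  apply: SL_gen_Uw; apply/setIdP; split; [exact: U_sl | by rewrite gU eV | exact: w_sl |].
  by rewrite eW0 gw.
by move=> u /(subsetP sSH); rewrite inE => /andP[_ /eqP].
Qed.

End Automorphism.


(** * Subgroups of SL2(p) of order prime to p *)

Section Dickson.
Variable H : {group gT}.
Hypotheses (sHS : H \subset SL) (p'H : ~~ (p %| #|H|)%N).
Variables S1 S2 S3 : gT.
Hypotheses (S1H : S1 \in H) (S2H : S2 \in H) (S3H : S3 \in H).
Hypotheses (S1X : (S1 ^+ 5 = m1)%g) (S2X : (S2 ^+ 3 = m1)%g) (S3X : (S3 ^+ 4 = m1)%g).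
Hypothesis S12 : ~ commute S1 S2.

Local Notation Z := ('Z(SL))%g.
Local Notation C x := ('C_H[x])%g.
(** For noncentral [u], [C u] is a maximal abelian subgroup of [H]; the tori are the blocks of a
    partition of the noncentral elements. *)
Definition torus u : {set gT} := C u :\: Z.
Definition torus_class u : {set gT} := class_support (torus u) H.

(** The equations say that the traceless parts, with coordinates [(b, c, a - d)], are
    proportional. *)
Lemma sl_comm a b c d a' b' c' d' : a * d - b * c = 1 -> a' * d' - b' * c' = 1 ->
  commute (sl a b c d) (sl a' b' c' d') <->
  [/\ b * c' = c * b', (a - d) * b' = b * (a' - d') & (a - d) * c' = c * (a' - d')].
Proof.
move=> e e'; rewrite /commute !slM //; split.
  case/sl_inj; try exact: sl_det.
  move=> h1 h2 h3 h4; split.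
  - transitivity (a * a' + b * c' - a * a'); first by ring.
    by rewrite h1; ring.
  - transitivity (a * b' + b * d' - (b * d' + d * b')); first by ring.
    by rewrite h2; ring.
  transitivity (a * c' - (c * a' + d * c') + c * a'); first by ring.
  by rewrite h3; ring.
case=> h1 h2 h3; apply: sl_eq.
- by rewrite h1; ring.
- transitivity ((a - d) * b' + d * b' + b * d'); first by ring.
  by rewrite h2; ring.
- transitivity (c * (a' - d') + c * d' + d * c'); first by ring.
  by rewrite -h3; ring.
by rewrite -h1; ring.
Qed.

Lemma sl_comm_scal a b c d a' b' c' d' : a * d - b * c = 1 -> a' * d' - b' * c' = 1 ->
  sl a b c d \notin Z -> commute (sl a b c d) (sl a' b' c' d') ->
  exists k, [/\ b' = k * b, c' = k * c & a' - d' = k * (a - d)].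
Proof.
move=> e e' nZ /(sl_comm e e')[h1 h2 h3].
have [b0|nb] := eqVneq b 0; last first.
  exists (b' / b); split; first by rewrite divfK.
    by apply: (mulfI nb); rewrite h1; field.
  by apply: (mulfI nb); rewrite -h2; field.
have [c0|nc] := eqVneq c 0; last first.
  exists (c' / c); split; last 1 first.
  - by apply: (mulfI nc); rewrite -h3; field.
  - by apply: (mulfI nc); rewrite -h1; field.
  by rewrite divfK.
have nf : a - d != 0.
  apply: contraNneq nZ => /eqP; rewrite subr_eq0 => /eqP ad.
  by apply/SL_centerP; apply: sl_scalar.
exists ((a' - d') / (a - d)); split; last by rewrite divfK.
  by apply: (mulfI nf); rewrite h2; field.
by apply: (mulfI nf); rewrite h3; field.
Qed.

Lemma comm_trans u v g : u \in SL -> v \in SL -> g \in SL -> u \notin Z ->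
  commute u v -> commute u g -> commute v g.
Proof.
case/slP => a [b [c [d [e ->]]]] /slP[a' [b' [c' [d' [e' ->]]]]].
case/slP => a'' [b'' [c'' [d'' [e'' ->]]]] nZ.
move=> /(sl_comm_scal e e' nZ)[k [h1 h2 h3]] /(sl_comm_scal e e'' nZ)[l [k1 k2 k3]].
by apply/(sl_comm e' e''); rewrite h3 k3 h1 h2 k1 k2; split; ring.
Qed.

(** The traceless part of [v] is [k] times that of [u]; equal determinants and a nonzero
    discriminant force [k ^+ 2 = 1]. *)
Lemma comm_same_tr u v : u \in SL -> v \in SL -> u \notin Z -> commute u v ->
  tr u = tr v -> tr u ^+ 2 != 4%:R -> v = u \/ v = u^-1%g.
Proof.
case/slP => a [b [c [d [e ->]]]] /slP[a' [b' [c' [d' [e' ->]]]]] nZ.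
move=> /(sl_comm_scal e e' nZ)[k [h1 h2 h3]]; rewrite !tr_sl // => t dz.
have a'E : a' = 2%:R^-1 * ((a + d) + k * (a - d)).
  by rewrite -h3 t; field.
have d'E : d' = 2%:R^-1 * ((a + d) - k * (a - d)).
  by rewrite -h3 t; field.
have : (k - 1) * (k + 1) = 0.
  have nd : (a + d) ^+ 2 - 4%:R != 0 by rewrite subr_eq0.
  apply: (mulfI nd); rewrite mulr0.
  transitivity ((k * (a - d)) ^+ 2 + 4%:R * (k * b) * (k * c) -
      ((a - d) ^+ 2 + 4%:R * b * c) +
      (k ^+ 2 - 1) * 4%:R * ((a * d - b * c) - 1)); first by ring.
  rewrite -h3 -h1 -h2 e subrr mulr0 addr0.
  transitivity ((a' + d') ^+ 2 - 4%:R * (a' * d' - b' * c') -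
      ((a + d) ^+ 2 - 4%:R * (a * d - b * c))); first by ring.
  by rewrite -t e e' subrr.
move/eqP; rewrite mulf_eq0 subr_eq0 addr_eq0 => /orP[]/eqP ek; [left|right; rewrite slV //].
  apply: sl_eq; [rewrite a'E | rewrite h1 | rewrite h2 | rewrite d'E]; rewrite ek ?mul1r //;
    by field.
apply: sl_eq; [rewrite a'E | rewrite h1 | rewrite h2 | rewrite d'E]; rewrite ek ?mulN1r //;
  by field.
Qed.

Lemma m1H : m1 \in H. Proof. by rewrite -S1X groupX. Qed.

Lemma Z_sub : Z \subset H.
Proof. by apply/subsetP => u /SL_centerP[]->; rewrite ?group1 ?m1H. Qed.

(** A noncentral element of trace 2 or -2 is, up to sign, unipotent of order [p]. *)
Lemma tr_p' u : u \in H -> u \notin Z -> tr u ^+ 2 != 4%:R.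
Proof.
move=> uH nZ; have uS := subsetP sHS _ uH; apply/eqP => h.
have : (tr u - 2%:R) * (tr u + 2%:R) = 0.
  by transitivity (tr u ^+ 2 - 4%:R); [ring | rewrite h subrr].
move/eqP; rewrite mulf_eq0 subr_eq0 addr_eq0 => /orP[]/eqP ht; case/negP: p'H.
  rewrite -(@order_tr2 u) ?order_dvdG //.
  by apply: contraNneq nZ => ->; rewrite group1.
rewrite -(@order_tr2 (m1 * u)%g) ?order_dvdG ?groupM ?m1H ?m1_sl //.
- by apply: contraNneq nZ => e; apply/SL_centerP; right; apply: (mulgI m1); rewrite e m1_sqr.
by rewrite tr_m1M // ht opprK.
Qed.

Lemma torusP u v : v \in torus u -> [/\ v \in H, v \notin Z & commute v u].
Proof. by case/setDP => /setIP[vH /cent1P vu] nZ; split. Qed.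

Lemma mem_torus u : u \in H -> u \notin Z -> u \in torus u.
Proof. by move=> uH nZ; apply/setDP; split=> //; rewrite inE uH cent1id. Qed.

Lemma cent_torus u v : u \in H -> u \notin Z -> v \in torus u -> C v = C u.
Proof.
move=> uH nu /torusP[vH nv cvu]; have S := subsetP sHS.
apply/setP => g; apply/setIP/setIP => -[gH /cent1P h]; split=> //; apply/cent1P.
  by apply: (@comm_trans v) => //; rewrite ?S //; apply: commute_sym.
by apply: (@comm_trans u) => //; rewrite ?S //; apply: commute_sym.
Qed.

Lemma torusJ u g : g \in H -> (torus u :^ g)%g = torus (u ^ g)%g.
Proof.
move=> gH; rewrite /torus conjDg conjIg conjGid // -cent1J; congr (_ :\: _).
apply/setP => v; rewrite mem_conjg; apply/SL_centerP/SL_centerP => -[].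
- by move/eqP; rewrite conjg_eq1 => /eqP; left.
- by move/(congr1 (fun x : gT => x ^ g)%g); rewrite conjgKV m1J; right.
- by move=> ->; left; rewrite conj1g.
by move=> ->; right; rewrite m1J.
Qed.

Lemma torus_cent_eq u v : C u = C v -> torus u = torus v.
Proof. by rewrite /torus => ->. Qed.

Lemma torus_normedTI u : u \in H -> u \notin Z -> normedTI (torus u) H 'N_H(torus u)%g.
Proof.
move=> uH nu; apply/normedTI_memJ_P; split; last 1 first.
- move=> a g aT gH; apply/idP/setIP => [agT|[_ gN]]; last by rewrite memJ_norm.
  split=> //; apply/normP; rewrite torusJ //; apply: torus_cent_eq.
  have [aH na _] := torusP aT.
  have ca := cent_torus uH nu aT; have cag := cent_torus uH nu agT.
  rewrite -[RHS]cag; apply/setP => z; have := congr1 (fun X => z \in (X :^ g)%g) ca.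
  by rewrite /= !conjIg -!cent1J (conjGid gH).
- by apply/set0Pn; exists u; apply: mem_torus.
exact: subsetIl.
Qed.

Lemma cent_sub_norm u : u \in H -> u \notin Z -> C u \subset 'N_H(torus u)%g.
Proof.
move=> uH nu; apply/subsetP => g /setIP[gH cg]; rewrite inE gH; apply/normP.
by rewrite torusJ // /conjg -(cent1P cg) mulKg.
Qed.

Lemma norm_torusP u g : u \in H -> u \notin Z -> g \in 'N_H(torus u)%g ->
  (u ^ g = u \/ u ^ g = u^-1)%g.
Proof.
move=> uH nu /setIP[gH gN].
have : (u ^ g)%g \in torus u by rewrite memJ_norm // mem_torus.
case/torusP => ugH ng cu; have S := subsetP sHS.
exact: (comm_same_tr (S _ uH) (S _ ugH) nu (commute_sym cu) (esym (trJ _ _)) (tr_p' uH nu)).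
Qed.

(** The normalizer can move [u] only to [u] or [u^-1], and [C u] is the stabilizer of [u]. *)
Lemma card_norm_torus u : u \in H -> u \notin Z ->
  exists2 f, (f == 1)%N || (f == 2)%N & (#|'N_H(torus u)%g| = f * #|C u|)%N.
Proof.
move=> uH nu; set N := 'N_H(torus u)%g; have sub := cent_sub_norm uH nu.
have cE : C u = 'C_N[u]%g.
  by apply/setP => g; rewrite inE [in RHS]inE; apply/andP/andP => -[h1 h2]; split=> //;
    [apply: (subsetP sub); rewrite inE h1 | case/setIP: h1].
exists #|(u ^: N)%g|; last by rewrite -index_cent1 -cE mulnC Lagrange.
have : (u ^: N \subset [set u; u^-1])%g.
  apply/subsetP => _ /imsetP[g gN ->]; rewrite !inE.
  by case: (norm_torusP uH nu gN) => ->; rewrite eqxx ?orbT.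
move/subset_leq_card; rewrite cards2.
have : (0 < #|(u ^: N)%g|)%N by apply/card_gt0P; exists u; apply: class_refl.
by case: (_ != _); move: #|_| => [|[|[|?]]].
Qed.

(** If [H] normalized the torus, all squares would centralize [u]. Since [S1 ^+ 6 = S1 * m1] and
    [S2 ^+ 4 = S2 * m1], so would [S1] and [S2], which would then commute. *)
Lemma norm_torus_proper u : u \in H -> u \notin Z -> (2 * #|'N_H(torus u)%g| <= #|H|)%N.
Proof.
move=> uH nu; have sNH : 'N_H(torus u)%g \subset H by apply: subsetIl.
rewrite -(Lagrange sNH) mulnC leq_pmul2l ?cardG_gt0 //.
rewrite ltn_neqAle indexg_gt0 andbT eq_sym indexg_eq1; apply/negP => sH.
have sq g : g \in H -> (g ^+ 2)%g \in C u.
  move=> gH; rewrite inE groupX //=; apply/cent1P; rewrite /commute [RHS]conjgC.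
  suff -> : (u ^ (g ^+ 2) = u)%g by [].
  rewrite expgS expg1 conjgM; have gN := subsetP sH _ gH.
  case: (norm_torusP uH nu gN) => e; first by rewrite e e.
  by rewrite e conjVg e invgK.
have m1C : m1 \in C u.
  by rewrite inE m1H; apply/cent1P; rewrite /commute m1_comm ?(subsetP sHS).
have S1C : S1 \in C u.
  have := groupX 3 (sq _ S1H); rewrite -expgM (expgS S1 5) S1X m1_comm ?(subsetP sHS) //.
  by rewrite groupMl.
have S2C : S2 \in C u.
  have := groupX 2 (sq _ S2H); rewrite -expgM (expgS S2 3) S2X m1_comm ?(subsetP sHS) //.
  by rewrite groupMl.
apply: S12; case/setIP: S1C => _ /cent1P c1; case/setIP: S2C => _ /cent1P c2.
by apply: (@comm_trans u) => //; rewrite ?(subsetP sHS).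
Qed.

(** The torus has [#|C u| - 2] elements, its conjugates are pairwise equal or disjoint, and its
    normalizer has order [f * #|C u|]. *)
Lemma card_torus_class u : u \in H -> u \notin Z ->
  exists2 f, (f == 1)%N || (f == 2)%N &
    (#|torus_class u| * (f * #|C u|) = (#|C u| - 2) * #|H|)%N /\ (2 * (f * #|C u|) <= #|H|)%N.
Proof.
move=> uH nu; have [f hf cN] := card_norm_torus uH nu; exists f => //.
rewrite -cN; split; last exact: norm_torus_proper.
rewrite /torus_class (card_support_normedTI (torus_normedTI uH nu)) -mulnA.
rewrite [(#|H : _|%g * _)%N]mulnC Lagrange ?subsetIl //; congr (_ * _)%N.
rewrite cardsD; congr (_ - _)%N; rewrite -card_center; congr #|pred_of_set _|.
apply/setIidPr/subsetP => z zZ; rewrite inE (subsetP Z_sub) //=.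
by apply/cent1P; case/centerP: zZ => _; apply; rewrite (subsetP sHS).
Qed.

Lemma card_cent_even u : u \in H -> u \notin Z -> (2 %| #|C u|)%N /\ (4 <= #|C u|)%N.
Proof.
move=> uH nu.
have sZ : Z \subset C u.
  apply/subsetP => z zZ; rewrite inE (subsetP Z_sub) //=.
  by apply/cent1P; case/centerP: zZ => _; apply; rewrite (subsetP sHS).
have d2 : (2 %| #|C u|)%N by rewrite -card_center cardSg.
split=> //; have : (2 < #|C u|)%N.
  rewrite -card_center; apply: proper_card; rewrite properE sZ /=.
  by apply/subsetPn; exists u => //; rewrite inE uH cent1id.
by case/dvdnP: d2 => q ->; lia.
Qed.

Lemma torus_class_cent u v : u \in H -> u \notin Z -> v \in torus_class u -> #|C v| = #|C u|.
Proof.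
move=> uH nu /imset2P[a g aT gH ->]; rewrite -(cent_torus uH nu aT).
by rewrite -(conjGid gH) cent1J -conjIg cardJg conjGid.
Qed.

Lemma torus_class_sub u : u \in H -> u \notin Z -> torus_class u \subset H :\: Z.
Proof.
move=> uH nu; apply/subsetP => _ /imset2P[a g aT gH ->].
have [aH na _] := torusP aT; have : (a ^ g)%g \in (torus u :^ g)%g by rewrite memJ_conjg.
by rewrite torusJ // => /torusP[h1 h2 _]; rewrite inE h1 h2.
Qed.

Lemma torus_class_disjoint u v : u \in H -> u \notin Z -> v \in H -> v \notin Z ->
  v \notin torus_class u -> torus_class v :&: torus_class u = set0.
Proof.
move=> uH nu vH nv nvu; apply/setP => z; rewrite [RHS]inE; apply/negP => /setIP[].
case/imset2P => a g aT gH ez /imset2P[b h bT hH ez']; case/negP: nvu.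
have [bH nb _] := torusP bT; have [aH na _] := torusP aT.
have av : v \in torus a by rewrite (torus_cent_eq (cent_torus vH nv aT)) mem_torus.
have ub : torus b = torus u by apply: torus_cent_eq; apply: cent_torus.
have eab : a = (b ^ (h * g^-1))%g by rewrite conjgM -ez' ez conjgK.
rewrite eab -torusJ ?groupM ?groupV // ub in av.
case/imsetP: av => t tT ->; apply/imset2P; exists t (h * g^-1)%g => //.
by rewrite groupM ?groupV.
Qed.

(** Stands for a union of torus classes, in the form needed to add disjoint classes one by one. *)
Definition torus_closed (D : {set gT}) :=
  D \subset H :\: Z /\ forall z, z \in H -> z \notin Z -> z \notin D -> torus_class z :&: D = set0.

Lemma card_HZ : (#|H :\: Z| = #|H| - 2)%N.
Proof. by rewrite cardsD (setIidPr Z_sub) card_center. Qed.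

Lemma torus_closed_class u : u \in H -> u \notin Z -> torus_closed (torus_class u).
Proof.
move=> uH nu; split; first exact: torus_class_sub.
by move=> z zH nz; apply: torus_class_disjoint.
Qed.

Lemma torus_closed_add D u : torus_closed D -> u \in H -> u \notin Z -> u \notin D ->
  torus_closed (torus_class u :|: D) /\ (#|torus_class u :|: D| = #|torus_class u| + #|D|)%N.
Proof.
move=> [sD cD] uH nu nuD; split; last by rewrite cardsU cD // cards0 subn0.
split; first by rewrite subUset sD torus_class_sub.
move=> z zH nz; rewrite inE negb_or => /andP[n1 n2'].
by rewrite setIUr cD // torus_class_disjoint // setU0.
Qed.

Lemma torus_closed_cover D : torus_closed D ->
  #|D| = (#|H| - 2)%N \/ exists z, [/\ z \in H, z \notin Z & z \notin D].
Proof.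
move=> [sD _]; have [/eqP e|ne] := boolP (D == H :\: Z); first by left; rewrite e card_HZ.
right; have /subsetPn[z] : ~~ (H :\: Z \subset D).
  by apply: contra ne => h; rewrite eqEsubset sD.
by case/setDP => zH nz nD; exists z.
Qed.

(** Cardinals are scaled by [#|H|]: a torus class has density [(1 - 2 * kap u) / f] with [f] equal
    to 1 or 2, and all noncentral elements together have density [1 - 2 * nu]. *)
Let nu : rat := (#|H|%:R)^-1.
Let kap u : rat := (#|C u|%:R)^-1.
Let sg (D : {set gT}) : rat := #|D|%:R / #|H|%:R.

Let H_neq0 : (#|H|%:R : rat) != 0.
Proof. by rewrite pnatr_eq0 -lt0n cardG_gt0. Qed.

Let nu_gt0 : 0 < nu.
Proof. by rewrite invr_gt0 ltr0n cardG_gt0. Qed.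

Let kap_le u k : (0 < k)%N -> (k %| #|C u|)%N -> kap u <= (k%:R)^-1.
Proof.
move=> k0 /dvdn_leq => /(_ (cardG_gt0 _)) le.
by rewrite lef_pV2 ?posrE ?ltr0n ?cardG_gt0 // ler_nat.
Qed.

Let profile u : u \in H -> u \notin Z ->
  [/\ (sg (torus_class u) = 1 - 2 * kap u /\ 2 * nu <= kap u) \/
      (sg (torus_class u) = 2^-1 - kap u /\ 4 * nu <= kap u),
      kap u = 4^-1 \/ kap u <= 6^-1 & 0 < kap u].
Proof.
move=> uH nu'; have [f hf [e le]] := card_torus_class uH nu'.
have [ev c4] := card_cent_even uH nu'.
have c0 : (#|C u|%:R : rat) != 0 by rewrite pnatr_eq0 -lt0n cardG_gt0.
have cp : 0 < (#|C u|%:R : rat) by rewrite ltr0n cardG_gt0.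
have Hp : 0 < (#|H|%:R : rat) by rewrite ltr0n cardG_gt0.
split; last by rewrite invr_gt0.
  have e' : (#|torus_class u|%:R * (f%:R * #|C u|%:R) = (#|C u|%:R - 2) * #|H|%:R :> rat).
    by rewrite -!natrM e natrM natrB //; apply: leq_trans c4.
  have le' : 2 * (f%:R * #|C u|%:R) <= #|H|%:R :> rat by rewrite -!natrM ler_nat.
  have sE : sg (torus_class u) * f%:R = 1 - 2 * kap u.
    apply: (mulIf c0); apply: (mulIf H_neq0); rewrite /sg /kap.
    transitivity (#|torus_class u|%:R * (f%:R * #|C u|%:R) : rat); first by field.
    by rewrite e'; field.
  have kE : 2 * f%:R * nu <= kap u.
    rewrite -(ler_pM2r (mulr_gt0 cp Hp)).
    have -> : 2 * f%:R * nu * (#|C u|%:R * #|H|%:R) = 2 * (f%:R * #|C u|%:R) by rewrite /nu; field.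
    by have -> : kap u * (#|C u|%:R * #|H|%:R) = #|H|%:R by rewrite /kap; field.
  case/orP: hf => /eqP ef; [left|right]; rewrite ef in sE kE; split.
  - by rewrite mulr1 in sE.
  - by rewrite mulr1 in kE.
  - by apply: (mulIf (_ : (2 : rat) != 0)) => //; rewrite sE; field.
  by rewrite -natrM in kE.
have [e4|ne] := eqVneq #|C u| 4%N; first by left; rewrite /kap e4.
right; rewrite lef_pV2 ?posrE ?ltr0n ?cardG_gt0 //.
by rewrite ler_nat; apply: even_ge6.
Qed.

Let sg_le D : torus_closed D -> sg D <= 1 - 2 * nu.
Proof.
move=> [/subset_leq_card]; rewrite card_HZ => le _.
have h2 : (2 <= #|H|)%N by rewrite -card_center; apply: subset_leq_card; apply: Z_sub.
rewrite /sg /nu ler_pdivrMr ?ltr0n ?cardG_gt0 // mulrBl mul1r -mulrA mulVf // mulr1.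
by rewrite -natrB // ler_nat.
Qed.

Let sg_cover D : torus_closed D ->
  sg D = 1 - 2 * nu \/ exists z, [/\ z \in H, z \notin Z & z \notin D].
Proof.
case/torus_closed_cover => [e|]; [left|by right].
have h2 : (2 <= #|H|)%N by rewrite -card_center; apply: subset_leq_card; apply: Z_sub.
by rewrite /sg e natrB // mulrBl divff.
Qed.

Let sg_add D u : torus_closed D -> u \in H -> u \notin Z -> u \notin D ->
  torus_closed (torus_class u :|: D) /\
  sg (torus_class u :|: D) = sg (torus_class u) + sg D.
Proof.
move=> cD uH nu' nD; have [h1 h2] := torus_closed_add cD uH nu' nD; split=> //.
by rewrite /sg h2 natrD mulrDl.
Qed.

Let sg_ge u : u \in H -> u \notin Z ->
  2^-1 - kap u <= sg (torus_class u) /\ 4^-1 <= sg (torus_class u).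
Proof.
move=> uH nu'; have [pu qu ku] := profile uH nu'.
by split; case: qu => ?; case: pu => -[? ?]; lra.
Qed.

(** The two classes together exceed density 3/4, while any third has at least 1/4. They cannot
    exhaust [1 - 2 * nu] either: with [f = 2] for both, [kap u + kap v] would be [2 * nu], but each
    is at least [4 * nu]. *)
Let two_classes u v : u \in H -> u \notin Z -> v \in H -> v \notin Z ->
  v \notin torus_class u -> kap u + kap v < 4^-1 -> False.
Proof.
move=> uH nu' vH nv nvu k; have cu := torus_closed_class uH nu'.
have np := nu_gt0.
have [cD eD] := sg_add cu vH nv nvu; have leD := sg_le cD.
have [gu _] := sg_ge uH nu'; have [gv _] := sg_ge vH nv.
have [eq|[z [zH nz nD]]] := sg_cover cD.
  have [pu _ ku] := profile uH nu'; have [pv _ kv] := profile vH nv.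
  by case: pu => -[? ?]; case: pv => -[? ?]; lra.
have [cE eE] := sg_add cD zH nz nD; have := sg_le cE.
by have [_ gz] := sg_ge zH nz; lra.
Qed.

(** Such a class has density near 1/2, with [f = 2]. There is room for at most two more classes, and
    two must have density exactly 1/4 each; in every case the total differs from [1 - 2 * nu]. *)
Let one_class u : u \in H -> u \notin Z -> kap u <= 120^-1 -> False.
Proof.
move=> uH nu' k; have cu := torus_closed_class uH nu'; have leu := sg_le cu.
have np := nu_gt0; have [gu _] := sg_ge uH nu'; have [pu _ ku] := profile uH nu'.
have [eq|[v [vH nv nD]]] := sg_cover cu; first by case: pu => -[? ?]; lra.
have [cD eD] := sg_add cu vH nv nD; have leD := sg_le cD.
have [gv gv'] := sg_ge vH nv; have [pv qv kv] := profile vH nv.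
have eu : sg (torus_class u) = 2^-1 - kap u /\ 4 * nu <= kap u.
  by case: pu => // -[? ?]; lra.
have [eq|[z [zH nz nE]]] := sg_cover cD.
  by case: eu => ? ?; case: pv => -[? ?]; case: qv => ?; lra.
have [cE eE] := sg_add cD zH nz nE; have leE := sg_le cE.
have [gz gz'] := sg_ge zH nz; have [pz qz kz] := profile zH nz.
have [eq|[t [tH nt nF]]] := sg_cover cE.
  have ev : sg (torus_class v) = 4^-1 by case: pv => -[? ?]; case: qv => ?; lra.
  have ez : sg (torus_class z) = 4^-1 by case: pz => -[? ?]; case: qz => ?; lra.
  by case: eu => ? ?; lra.
have [cF eF] := sg_add cE tH nt nF; have leF := sg_le cF.
by have [_ gt] := sg_ge tH nt; lra.
Qed.

Let S1Z : S1 \notin Z.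
Proof.
apply/negP => /centerP[_ c]; apply: S12; apply: c; exact: (subsetP sHS).
Qed.

Let S2Z : S2 \notin Z.
Proof.
apply/negP => /centerP[_ c]; apply: S12; apply/commute_sym; apply: c; exact: (subsetP sHS).
Qed.

Let S3Z : S3 \notin Z.
Proof.
apply/negP => h; have : (S3 ^+ 4 = 1)%g.
  rewrite (expgM S3 2 2) [(S3 ^+ 2)%g]expgS expg1.
  by case/SL_centerP: h => ->; rewrite ?mulg1 ?m1_sqr expg1n.
by rewrite S3X => e; move: m1_neq1; rewrite e eqxx.
Qed.

Let cent_dvd10 : (10 %| #|C S1|)%N.
Proof.
have [d2 _] := card_cent_even S1H S1Z.
suff d5 : (5 %| #|C S1|)%N by rewrite (@Gauss_dvd 2 5) // d2.
have <- : #[S1 ^+ 2]%g = 5%N.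
  apply: nt_prime_order => //.
    by rewrite -expgM (expgM S1 5 2) S1X expgS expg1 m1_sqr.
  apply: contraNneq S1Z => e; apply/SL_centerP; right.
  by rewrite -S1X (expgD S1 1 4) (expgM S1 2 2) e expg1n mulg1 expg1.
by rewrite order_dvdG // groupX // inE S1H cent1id.
Qed.

Let cent_dvd6 : (6 %| #|C S2|)%N.
Proof.
have [d2 _] := card_cent_even S2H S2Z.
suff d3 : (3 %| #|C S2|)%N by rewrite (@Gauss_dvd 2 3) // d2.
have <- : #[S2 ^+ 2]%g = 3%N.
  apply: nt_prime_order => //.
    by rewrite -expgM (expgM S2 3 2) S2X expgS expg1 m1_sqr.
  apply: contraNneq S2Z => e; apply/SL_centerP; right.
  by rewrite -S2X (expgD S2 1 2) e mulg1 expg1.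
by rewrite order_dvdG // groupX // inE S2H cent1id.
Qed.

Let cent_dvd8 : (8 %| #|C S3|)%N.
Proof.
suff <- : #[S3]%g = 8%N by rewrite order_dvdG // inE S3H cent1id.
have : (#[S3]%g %| 2 ^ 3)%N.
  by rewrite order_dvdn (expgM S3 4 2) S3X expgS expg1 m1_sqr.
case/(dvdn_pfactor _ _ (isT : prime 2)) => k hk ok.
have : ~~ (#[S3]%g %| 4)%N by rewrite order_dvdn S3X m1_neq1.
by rewrite ok; case: k hk ok => [|[|[|[|]]]].
Qed.

(* A subgroup of order prime to p is partitioned, outside the centre, by the
   conjugates of its maximal abelian subgroups; weighing the classes of the tori
   through S1, S2 and S3 (Dickson) leaves no room for such a subgroup. *)
Lemma Dickson_p' : False.
Proof.
have h1 := kap_le (isT : 0 < 10)%N cent_dvd10.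
have h2 := kap_le (isT : 0 < 6)%N cent_dvd6.
have h3 := kap_le (isT : 0 < 8)%N cent_dvd8.
have kapE u v : u \in H -> u \notin Z -> v \in torus_class u -> #|C v| = #|C u|.
  exact: torus_class_cent.
(* Elements in a common torus class have centralizers of equal order, which is then divisible by the
   least common multiple of the respective bounds 10, 6 and 8. *)
have [i12|n12] := boolP (S2 \in torus_class S1).
  have e2 := kapE _ _ S1H S1Z i12; have d6 := cent_dvd6; rewrite e2 in d6.
  have [i13|n13] := boolP (S3 \in torus_class S1).
    have e3 := kapE _ _ S1H S1Z i13; have d8 := cent_dvd8; rewrite e3 in d8.
    apply: (one_class S1H S1Z); apply: (kap_le (isT : 0 < 120)%N).
    by rewrite -[120%N]/(lcmn 10 (lcmn 6 8)) !dvdn_lcm cent_dvd10 d6 d8.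
  apply: (two_classes S1H S1Z S3H S3Z n13).
  have : (30 %| #|C S1|)%N.
    by rewrite -[30%N]/(lcmn 10 6) dvdn_lcm cent_dvd10 d6.
  by move/(kap_le (isT : 0 < 30)%N); lra.
have [i13|n13] := boolP (S3 \in torus_class S1).
  have e3 := kapE _ _ S1H S1Z i13; have d8 := cent_dvd8; rewrite e3 in d8.
  apply: (two_classes S1H S1Z S2H S2Z n12).
  have : (40 %| #|C S1|)%N.
    by rewrite -[40%N]/(lcmn 10 8) dvdn_lcm cent_dvd10 d8.
  by move/(kap_le (isT : 0 < 40)%N); lra.
have [i23|n23] := boolP (S3 \in torus_class S2).
  have e3 := kapE _ _ S2H S2Z i23; have d8 := cent_dvd8; rewrite e3 in d8.
  apply: (two_classes S1H S1Z S2H S2Z n12).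
  have : (24 %| #|C S2|)%N.
    by rewrite -[24%N]/(lcmn 6 8) dvdn_lcm cent_dvd6 d8.
  by move/(kap_le (isT : 0 < 24)%N); lra.
(* Three distinct classes: the densities are at least 2/5, 1/3 and 3/8, whose sum exceeds 1. *)
have c1 := torus_closed_class S1H S1Z.
have [c2 e2] := sg_add c1 S2H S2Z n12.
have n3 : S3 \notin torus_class S2 :|: torus_class S1 by rewrite inE negb_or n23.
have [c3 e3] := sg_add c2 S3H S3Z n3; have le3 := sg_le c3.
have [g1 _] := sg_ge S1H S1Z; have [g2 _] := sg_ge S2H S2Z.
by have [g3 _] := sg_ge S3H S3Z; have np := nu_gt0; lra.
Qed.

End Dickson.

Lemma pow2_tr0 u : u \in SL -> tr u = 0 -> (u ^+ 2)%g = m1.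
Proof.
case/slP => a [b [c [d [e ->]]]]; rewrite tr_sl // => t; rewrite sl_sqr // t.
by apply: sl_eq; ring.
Qed.

Lemma pow3_tr1 u : u \in SL -> tr u = 1 -> (u ^+ 3)%g = m1.
Proof.
case/slP => a [b [c [d [e ->]]]]; rewrite tr_sl // => t; rewrite sl_cube // t.
by apply: sl_eq; ring.
Qed.

Lemma tr1 : tr 1%g = 2%:R.
Proof. by rewrite sl1 tr_sl; ring. Qed.

Lemma tr_sqr u : u \in SL -> tr (u * u)%g = tr u ^+ 2 - 2%:R.
Proof.
move=> uS; have := tr_mulV uS uS; rewrite mulgV tr1 => ->; ring.
Qed.

Lemma pow4_trsqr2 u : u \in SL -> tr u ^+ 2 = 2%:R -> (u ^+ 4)%g = m1.
Proof.
move=> uS t; rewrite (expgM u 2 2); apply: pow2_tr0; first exact: groupX.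
by rewrite expgS expg1 tr_sqr // t subrr.
Qed.

(** The equation characterizes 2cos of pi/5 and of 3pi/5, the traces of elements whose fifth power
    is -1 without being -1 themselves. *)
Lemma pow5_golden u : u \in SL -> tr u ^+ 2 = tr u + 1 -> (u ^+ 5)%g = m1.
Proof.
case/slP => a [b [c [d [e ->]]]]; rewrite tr_sl // => t.
have e2 : ((a + d) * a - 1) * ((a + d) * d - 1) - (a + d) * b * ((a + d) * c) = 1.
  transitivity ((a * d - b * c) * (a + d) ^+ 2 - (a + d) ^+ 2 + 1); first by ring.
  by rewrite e; ring.
have e3 : (((a + d) ^+ 2 - 1) * a - (a + d)) * (((a + d) ^+ 2 - 1) * d - (a + d)) -
    ((a + d) ^+ 2 - 1) * b * (((a + d) ^+ 2 - 1) * c) = 1.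
  transitivity ((a * d - b * c) * ((a + d) ^+ 2 - 1) ^+ 2 -
    ((a + d) ^+ 2 - 1) * (a + d) ^+ 2 + (a + d) ^+ 2); first by ring.
  by rewrite e; ring: t.
have hbc : b * c = a * d - 1 by rewrite -e; ring.
rewrite (expgD _ 2 3) sl_sqr // sl_cube // slM //; move: t hbc; set t := a + d => ht.
have ed : d = t - a by rewrite /t; ring.
by rewrite ed => hbc; apply: sl_eq; ring: ht hbc.
Qed.

Lemma trC u v : tr (u * v)%g = tr (v * u)%g.
Proof. by rewrite /tr !mxvM mxtrace_mulC. Qed.

Lemma trV u : u \in SL -> tr u^-1%g = tr u.
Proof.
move=> uS; have := tr_mulV (group1 _) uS; rewrite !mul1g tr1 => ->; ring.
Qed.

(** The Fricke identity, by repeated use of [tr_mulV]. *)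
Lemma tr_commg u v : u \in SL -> v \in SL ->
  tr [~ u, v]%g = tr u ^+ 2 + tr v ^+ 2 + tr (u * v)%g ^+ 2 - tr u * tr v * tr (u * v)%g - 2%:R.
Proof.
move=> uS vS; have uvS : (u * v)%g \in SL by rewrite groupM.
have conjS : (u ^ v)%g \in SL by rewrite SL_norm.
have uVS : u^-1%g \in SL by rewrite groupV.
have uvuS : (u * v * u)%g \in SL by rewrite groupM.
have t3 : tr (u * v * u)%g = tr (u * v)%g * tr u - tr v.
  have := tr_mulV uvS uVS; rewrite invgK trV // => ->; congr (_ - _).
  by rewrite -(trJ v u^-1%g) conjgE invgK mulgA.
have t4 : tr (u ^ v * u)%g = tr (u * v * u)%g * tr v - tr (u * v * (u * v))%g.
  have -> : tr (u ^ v * u)%g = tr (u * v * u * v^-1)%g by rewrite conjgE -mulgA trC !mulgA.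
  by rewrite tr_mulV // !mulgA.
rewrite commgEl (trC u^-1%g) (tr_mulV conjS uS) trJ t4 t3 (tr_sqr uvS); ring.
Qed.

(** * Unit quaternions generating SL2(p) *)

Section Generators.
Variables (al be r f s : F).
Hypotheses (hab : al ^+ 2 + be ^+ 2 = -1) (hr : r ^+ 2 = 2%:R).
Hypotheses (hf : 4%:R * f ^+ 2 = 2%:R * f + 1) (hs : 4%:R * s ^+ 2 = 1 - 2%:R * f).

(* The quaternion x0 + x1 i + x2 j + x3 k as a matrix, with
   i = [[al, be], [be, - al]], j = [[0, -1], [1, 0]] and k = i j. *)
Definition quat x0 x1 x2 x3 := sl (x0 + x1 * al + x3 * be) (x1 * be - x2 - x3 * al)
  (x1 * be + x2 - x3 * al) (x0 - x1 * al - x3 * be).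

Lemma quat_det x0 x1 x2 x3 : x0 ^+ 2 + x1 ^+ 2 + x2 ^+ 2 + x3 ^+ 2 = 1 ->
  (x0 + x1 * al + x3 * be) * (x0 - x1 * al - x3 * be) -
  (x1 * be - x2 - x3 * al) * (x1 * be + x2 - x3 * al) = 1.
Proof.
move=> e; transitivity (x0 ^+ 2 + x2 ^+ 2 - (x1 ^+ 2 + x3 ^+ 2) * (al ^+ 2 + be ^+ 2)); first by ring.
by rewrite hab -[RHS]e; ring.
Qed.

Lemma quat_sl x0 x1 x2 x3 : x0 ^+ 2 + x1 ^+ 2 + x2 ^+ 2 + x3 ^+ 2 = 1 -> quat x0 x1 x2 x3 \in SL.
Proof. by move=> e; apply: mem_sl; apply: quat_det. Qed.

Lemma quat_tr x0 x1 x2 x3 : x0 ^+ 2 + x1 ^+ 2 + x2 ^+ 2 + x3 ^+ 2 = 1 ->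
  tr (quat x0 x1 x2 x3) = 2%:R * x0.
Proof. by move=> e; rewrite tr_sl ?quat_det //; ring. Qed.

Lemma quatM x0 x1 x2 x3 y0 y1 y2 y3 :
  x0 ^+ 2 + x1 ^+ 2 + x2 ^+ 2 + x3 ^+ 2 = 1 -> y0 ^+ 2 + y1 ^+ 2 + y2 ^+ 2 + y3 ^+ 2 = 1 ->
  (quat x0 x1 x2 x3 * quat y0 y1 y2 y3)%g =
  quat (x0 * y0 - x1 * y1 - x2 * y2 - x3 * y3) (x0 * y1 + x1 * y0 + x2 * y3 - x3 * y2)
       (x0 * y2 - x1 * y3 + x2 * y0 + x3 * y1) (x0 * y3 + x1 * y2 - x2 * y1 + x3 * y0).
Proof.
move=> ex ey; rewrite slM ?quat_det //.
have ha : al ^+ 2 = - 1 - be ^+ 2 by rewrite -hab; ring.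
by apply: sl_eq; ring: ha.
Qed.

Lemma quatM_norm x0 x1 x2 x3 y0 y1 y2 y3 :
  x0 ^+ 2 + x1 ^+ 2 + x2 ^+ 2 + x3 ^+ 2 = 1 -> y0 ^+ 2 + y1 ^+ 2 + y2 ^+ 2 + y3 ^+ 2 = 1 ->
  (x0 * y0 - x1 * y1 - x2 * y2 - x3 * y3) ^+ 2 + (x0 * y1 + x1 * y0 + x2 * y3 - x3 * y2) ^+ 2 +
  (x0 * y2 - x1 * y3 + x2 * y0 + x3 * y1) ^+ 2 + (x0 * y3 + x1 * y2 - x2 * y1 + x3 * y0) ^+ 2 = 1.
Proof.
move=> ex ey; transitivity ((x0 ^+ 2 + x1 ^+ 2 + x2 ^+ 2 + x3 ^+ 2) *
  (y0 ^+ 2 + y1 ^+ 2 + y2 ^+ 2 + y3 ^+ 2)); first by ring.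
by rewrite ex ey mulr1.
Qed.

Let h : F := 2%:R^-1.

(** The real parts play the roles of cos(pi/5), cos(pi/3) and cos(pi/4), which fixes the orders. The
    vector parts are chosen so that the products [gen1 * gen2], [gen2 * gen3] and
    [gen1 * gen2 * gen3] have real part 0, hence square to -1. *)
Definition gen1 := quat f s (- s) f.
Definition gen2 := quat h h h h.
Definition gen3 := quat (r * h) (r * h) 0 0.

Let norm1 : f ^+ 2 + s ^+ 2 + (- s) ^+ 2 + f ^+ 2 = 1.
Proof.
apply: (mulfI n2); transitivity (4%:R * f ^+ 2 + 4%:R * s ^+ 2); first by ring.
by rewrite hf hs; ring.
Qed.

Let norm2 : h ^+ 2 + h ^+ 2 + h ^+ 2 + h ^+ 2 = 1.
Proof. by rewrite /h; field. Qed.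

Let norm3 : (r * h) ^+ 2 + (r * h) ^+ 2 + 0 ^+ 2 + 0 ^+ 2 = 1.
Proof. by transitivity (2%:R * r ^+ 2 * h ^+ 2); [ring | rewrite hr /h; field]. Qed.

Lemma gen1_sl : gen1 \in SL. Proof. exact: quat_sl. Qed.
Lemma gen2_sl : gen2 \in SL. Proof. exact: quat_sl. Qed.
Lemma gen3_sl : gen3 \in SL. Proof. exact: quat_sl. Qed.

Lemma tr_gen1 : tr gen1 = 2%:R * f. Proof. exact: quat_tr. Qed.
Lemma tr_gen2 : tr gen2 = 1. Proof. by rewrite quat_tr // /h; field. Qed.
Lemma tr_gen3 : tr gen3 = r. Proof. by rewrite quat_tr // /h; field. Qed.

Lemma tr_gen12 : tr (gen1 * gen2)%g = 0.
Proof. by rewrite quatM // quat_tr ?quatM_norm //; ring. Qed.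

Lemma tr_gen23 : tr (gen2 * gen3)%g = 0.
Proof. by rewrite quatM // quat_tr ?quatM_norm //; ring. Qed.

Lemma tr_gen123 : tr (gen1 * gen2 * gen3)%g = 0.
Proof. by rewrite !quatM ?quatM_norm // quat_tr ?quatM_norm //; ring. Qed.

Lemma tr_gen13 : tr (gen1 * gen3)%g = r * (f - s).
Proof. by rewrite quatM // quat_tr ?quatM_norm // /h; field. Qed.

Lemma gen1_pow : (gen1 ^+ 5)%g = m1.
Proof.
apply: pow5_golden; rewrite ?gen1_sl // tr_gen1.
by transitivity (4%:R * f ^+ 2); [ring | rewrite hf].
Qed.

Lemma gen2_pow : (gen2 ^+ 3)%g = m1.
Proof. by apply: pow3_tr1; rewrite ?gen2_sl ?tr_gen2. Qed.

Lemma gen3_pow : (gen3 ^+ 4)%g = m1.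
Proof. by apply: pow4_trsqr2; rewrite ?gen3_sl ?tr_gen3. Qed.

Lemma gen12_pow : ((gen1 * gen2) ^+ 2)%g = m1.
Proof. by apply: pow2_tr0; [apply: groupM gen1_sl gen2_sl | apply: tr_gen12]. Qed.

Lemma gen23_pow : ((gen2 * gen3) ^+ 2)%g = m1.
Proof. by apply: pow2_tr0; [apply: groupM gen2_sl gen3_sl | apply: tr_gen23]. Qed.

Lemma gen123_pow : ((gen1 * gen2 * gen3) ^+ 2)%g = m1.
Proof.
apply: pow2_tr0; last exact: tr_gen123.
exact: groupM (groupM gen1_sl gen2_sl) gen3_sl.
Qed.

Lemma tr_comm12 : tr [~ gen1, gen2]%g <> 2%:R.
Proof.
rewrite tr_commg ?gen1_sl ?gen2_sl // tr_gen1 tr_gen2 tr_gen12 => e.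
have f1 : 2%:R * f = 2%:R.
  rewrite -[RHS]e; transitivity (4%:R * f ^+ 2 - 1); last by ring.
  by rewrite hf; ring.
have : (1 : F) = 0; last by move/eqP; rewrite oner_eq0.
transitivity (4%:R * f ^+ 2 - (2%:R * f + 1)); last by rewrite hf subrr.
transitivity ((2%:R * f) ^+ 2 - 2%:R * f - 1); last by ring.
by rewrite f1; ring.
Qed.

Lemma gens_SL : <<[set gen1; gen2; gen3]>>%g = SL.
Proof.
set H := <<_>>%g; have i1 : gen1 \in H by rewrite mem_gen ?inE ?eqxx.
have i2 : gen2 \in H by rewrite mem_gen ?inE ?eqxx ?orbT.
have i3 : gen3 \in H by rewrite mem_gen ?inE ?eqxx ?orbT.
have sHS : H \subset SL.
  by rewrite gen_subG; apply/subsetP => u /setUP[/set2P[]|/set1P] ->;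
    [apply: gen1_sl | apply: gen2_sl | apply: gen3_sl].
apply/eqP; rewrite eqEsubset sHS /=.
have [pH|p'H] := boolP (p %| #|H|)%N.
  by apply: (SL_gen_p sHS pH i1 i2); apply: tr_comm12.
case: (Dickson_p' sHS p'H i1 i2 i3 gen1_pow gen2_pow gen3_pow).
by move=> /commgP/eqP e; apply: tr_comm12; rewrite e tr1.
Qed.

Lemma gens_chiral (beta : {morphism (SL / 'Z(SL))%g >-> coset_of ('Z(SL))%g}) :
  ('injm beta)%g -> (beta @* (SL / 'Z(SL)) \subset SL / 'Z(SL))%g ->
  beta (coset ('Z(SL))%g gen1) = coset ('Z(SL))%g gen1 ->
  beta (coset ('Z(SL))%g gen3) = ((coset ('Z(SL))%g gen3)^-1)%g -> False.
Proof.
move=> inj im b1 b3; have [g hg] := SL_automorphism inj im.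
have g1S := gen1_sl; have g3S := gen3_sl; have g3VS : gen3^-1%g \in SL by rewrite groupV.
have e1 : coset ('Z(SL))%g (gen1 ^ g)%g = coset ('Z(SL))%g gen1 by rewrite -hg.
have e3 : coset ('Z(SL))%g (gen3 ^ g)%g = coset ('Z(SL))%g gen3^-1%g.
  by rewrite -hg // b3 -morphV ?Z_norm.
have c1 : (gen1 ^ g)%g \in SL by rewrite SL_norm.
have c3 : (gen3 ^ g)%g \in SL by rewrite SL_norm.
have t2 : tr (gen1 * gen3)%g ^+ 2 = tr (gen1 * gen3^-1)%g ^+ 2.
  have prodS : (gen1 * gen3^-1)%g \in SL by rewrite groupM.
  rewrite -(trJ _ g) conjMg.
  case: (coset_eq c1 g1S e1) => ->; case: (coset_eq c3 g3VS e3) => ->.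
  - by [].
  - by rewrite mulgA m1_comm // -mulgA tr_m1M // sqrrN.
  - by rewrite -mulgA tr_m1M // sqrrN.
  by rewrite -(m1_comm g1S) -mulgA (mulgA m1) m1_sqr mul1g.
rewrite tr_mulV // tr_gen13 tr_gen1 tr_gen3 in t2.
(* The traces [r * (f - s)] and [r * (f + s)] have equal squares, so [f] or [s] vanishes; [s = 0]
   means [2 f = 1], and both contradict [hf]. *)
have : r ^+ 2 * (4%:R * (f * s)) = 0.
  transitivity ((2%:R * f * r - r * (f - s)) ^+ 2 - (r * (f - s)) ^+ 2); first by ring.
  by rewrite t2 subrr.
have n4 : 4%:R != 0 :> F by apply: natF_neq0.
move/eqP; rewrite hr !mulf_eq0 (negPf n2) (negPf n4) /= => /orP[]/eqP z0.
  have /eqP : (1 : F) = 0.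
    transitivity (2%:R * f + 1 - 2%:R * f); first by ring.
    by rewrite -hf z0; ring.
  by rewrite oner_eq0.
have f1 : 2%:R * f = 1.
  by apply/eqP; rewrite eq_sym -subr_eq0 -hs z0; apply/eqP; ring.
have /eqP : (1 : F) = 0.
  transitivity (2%:R * f + 1 - (2%:R * f) ^+ 2); first by rewrite f1; ring.
  by rewrite -hf; ring.
by rewrite oner_eq0.
Qed.

End Generators.

(** The preimage of [N] in SL2 is normal and noncentral, so [SL_normal_gen] applies. *)
Lemma PSL_normal_full (N : {group coset_of ('Z(SL))%g}) :
  (N <| SL / 'Z(SL))%g -> N :!=: 1%g -> N :=: (SL / 'Z(SL))%g.
Proof.
move=> /andP[sN nN] ntN; apply/eqP; rewrite eqEsubset sN /=.
have [y yN y1] := trivgPn _ ntN.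
have /morphimP[u uZ uS ey] := subsetP sN _ yN.
pose M := (SL2_of_group :&: coset ('Z(SL)) @*^-1 N)%G.
have uM : u \in M by rewrite inE uS /=; apply/morphpreP; rewrite -ey.
have nu : u \notin 'Z(SL)%g by apply: contra y1 => h; apply/eqP; rewrite ey; apply: coset_id.
have sM : M \subset SL by apply: subsetIl.
have nM : (SL \subset 'N(M))%g.
  apply/subsetP => g gS; apply/normP; apply/eqP; rewrite eqEcard cardJg leqnn andbT.
  apply/subsetP => _ /imsetP[v /setIP[vS /morphpreP[vZ vN]] ->].
  rewrite inE groupJ //; apply/morphpreP; split; first by rewrite groupJ ?Z_norm.
  rewrite /= morphJ ?Z_norm //= memJ_norm //; apply: (subsetP nN).
  exact: mem_quotient.
have sSM := SL_normal_gen sM nM uM nu.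
apply/subsetP => _ /morphimP[v vZ vS ->].
by have /setIP[_ /morphpreP[]] := subsetP sSM _ vS.
Qed.

Lemma PSL_generators (al be r f s : F) : al ^+ 2 + be ^+ 2 = -1 -> r ^+ 2 = 2%:R ->
  4%:R * f ^+ 2 = 2%:R * f + 1 -> 4%:R * s ^+ 2 = 1 - 2%:R * f ->
  exists s1 s2 s3 : coset_of ('Z(SL))%g,
  [/\ (<<[set s1; s2; s3]>> = SL / 'Z(SL))%g,
      [/\ s1 ^+ 5 = 1, s2 ^+ 3 = 1 & s3 ^+ 4 = 1]%g,
      [/\ (s1 * s2) ^+ 2 = 1, (s2 * s3) ^+ 2 = 1 & (s1 * s2 * s3) ^+ 2 = 1]%g &
      forall beta : {morphism (SL / 'Z(SL))%g >-> coset_of ('Z(SL))%g},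
        ('injm beta)%g -> (beta @* (SL / 'Z(SL)) \subset SL / 'Z(SL))%g ->
        beta s1 = s1 -> beta s3 = (s3^-1)%g -> False].
Proof.
move=> hab hr hf hs; pose q := coset ('Z(SL))%g.
have g1 := gen1_sl hab hf hs; have g2 := gen2_sl hab; have g3 := gen3_sl hab hr.
have qm1 : q m1 = 1%g by apply: coset_id; apply/SL_centerP; right.
have qX u n : u \in SL -> (u ^+ n)%g = m1 -> (q u ^+ n)%g = 1%g.
  by move=> uS e; rewrite -morphX ?Z_norm //= e.
have qM u v : u \in SL -> v \in SL -> (q u * q v)%g = q (u * v)%g.
  by move=> uS vS; rewrite -morphM ?Z_norm.
exists (q (gen1 al be f s)), (q (gen2 al be)), (q (gen3 al be r)); split.
- transitivity (coset ('Z(SL)) @* <<[set gen1 al be f s; gen2 al be; gen3 al be r]>>)%g.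
    rewrite morphim_gen ?morphimU ?morphim_set1 ?Z_norm //.
    by apply/subsetP => z; case/setUP => [/set2P[]|/set1P]->; apply: Z_norm.
  by rewrite (gens_SL hab hr hf hs).
- by split; apply: qX => //; [exact: gen1_pow | exact: gen2_pow | exact: gen3_pow].
- rewrite (qM _ _ g1 g2) (qM _ _ g2 g3) (qM _ _ (groupM g1 g2) g3).
  split; apply: qX.
  + exact: groupM g1 g2.
  + exact: gen12_pow.
  + exact: groupM g2 g3.
  + exact: gen23_pow.
  + exact: groupM (groupM g1 g2) g3.
  exact: gen123_pow.
by move=> beta; apply: (gens_chiral hab hr hf hs).
Qed.

End PrimeField.
End SpecialLinear.

(** The fibres of the determinant over nonzero scalars are cosets of SL2. *)
Lemma card_GL_SL2 (F : finFieldType) (gT : finGroupType) (mxv : gT -> 'M[F]_2) :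
  (forall g h, mxv (g * h)%g = mxv g *m mxv h)%R -> mxv 1%g = 1%:M%R ->
  (forall M, \det M != 0 -> exists g, mxv g = M)%R ->
  #|[set: gT]| = (#|SL2_of mxv| * #|F|.-1)%N.
Proof.
move=> mM m1 surj; pose D (g : gT) := (\det (mxv g))%R.
have DM g h : D (g * h)%g = (D g * D h)%R by rewrite /D mM det_mulmx.
have D1 : D 1%g = 1%R by rewrite /D m1 det1.
have D0 g : D g != 0%R.
  by apply/eqP => e; have /eqP := oner_neq0 F; apply; rewrite -D1 -(mulgV g) DM e mul0r.
rewrite -sum1_card (partition_big D (fun d => d != 0%R)) //=.
rewrite -(cardC1 (0%R : F)) mulnC -sum_nat_const; apply: eq_big => [d|d nd]; first by rewrite !inE.
have [h hd] : exists h, mxv h = mx2 d 0%R 0%R 1%R.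
  by apply: surj; rewrite mx2_det mulr1 mulr0 subr0.
have Dh : D h = d by rewrite /D hd mx2_det mulr1 mulr0 subr0.
rewrite sum1dep_card -(card_rcoset (SL2_of mxv) h); apply: eq_card => g.
rewrite mem_rcoset !inE /=.
have e : D g = (D (g * h^-1)%g * d)%R by rewrite -Dh -DM mulgKV.
rewrite e -[(\det _)%R]/(D _); apply/eqP/eqP => [h1|->]; last by rewrite mul1r.
by apply: (mulIf nd); rewrite mul1r.
Qed.

(** * The mix of L2(p) with the rotation group *)

Section DirectProducts.
Local Open Scope group_scope.
Variables (sT rT : finGroupType) (S : {group sT}) (A : {group rT}).
Hypothesis simpleS : forall N : {group sT}, N <| S -> N :!=: 1 -> N :=: S.
Hypothesis not_dvd : ~~ (#|S| %| #|A|).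
Implicit Types (H : {group sT * rT}) (z : sT * rT).

Lemma pair_eq1 z : z.1 = 1 -> z.2 = 1 -> z = 1.
Proof. by case: z => a b /= -> ->. Qed.

Lemma fstX z n : (z ^+ n).1 = z.1 ^+ n.
Proof. by rewrite (morphX (fst_morphism sT rT)) ?inE. Qed.

Lemma sndX z n : (z ^+ n).2 = z.2 ^+ n.
Proof. by rewrite (morphX (snd_morphism sT rT)) ?inE. Qed.

(* The kernel of the second projection on H is normal in S; were it trivial, H
   would embed in A and #|S| would divide #|A|. *)
Lemma normal_fiber H : H \subset setX S A ->
  (forall x h, (x, 1) \in H -> h \in S -> (x ^ h, 1) \in H) ->
  #|S| %| #|H| -> forall x, x \in S -> (x, 1) \in H.
Proof.
move=> sH nH dvH.
have sA : snd_morphism sT rT @* H \subset A.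
  apply/subsetP => _ /morphimP[z _ zH ->] /=.
  by have := subsetP sH _ zH; rewrite inE => /andP[].
pose N := (pairg1_morphism sT rT @*^-1 H)%G.
have NE x : (x \in N) = ((x, 1) \in H) by rewrite !inE.
have nN : N <| S.
  apply/normalP; split.
    by apply/subsetP => x; rewrite NE => /(subsetP sH); rewrite inE => /andP[].
  move=> h hS; apply/setP => x; rewrite mem_conjg !NE; apply/idP/idP => hx.
    by have := nH _ _ hx hS; rewrite conjgKV.
  by apply: nH => //; rewrite groupV.
have [N1|N1] := boolP (N :==: 1); last first.
  by move=> x xS; rewrite -NE (simpleS nN N1).
case/negP: not_dvd; apply: dvdn_trans dvH _.
rewrite -(card_injm (f := restrm (subsetT H) (snd_morphism sT rT)) _ (subxx H)).
  rewrite cardSg //= morphim_restrm setIid; exact: sA.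
apply/injmP => u v uH vH /= e; apply/eqP; rewrite eq_mulgV1; apply/eqP.
have h : (u * v^-1).2 = 1 by rewrite /= [u.2]e mulgV.
have : (u * v^-1).1 \in N.
  rewrite NE; suff -> : ((u * v^-1).1, 1) = u * v^-1 by rewrite groupM ?groupV.
  by rewrite -h; case: (u * v^-1).
rewrite (eqP N1) => /set1P h1; exact: pair_eq1.
Qed.

(** By [normal_fiber], [H] contains the whole first factor, since its fibre over 1 is normalized by
    the projection of [H] onto [S]; surjectivity onto [A] does the rest. *)
Lemma goursat H : H \subset setX S A ->
  (forall x, x \in S -> exists a, (x, a) \in H) ->
  (forall a, a \in A -> exists x, (x, a) \in H) -> setX S A \subset H.
Proof.
move=> sH h1 h2.
have full x : x \in S -> (x, 1) \in H.
  apply: normal_fiber => //.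
    move=> y h yH hS; have [a ha] := h1 _ hS.
    suff -> : (y ^ h, 1) = (y, 1) ^ (h, a) by rewrite groupJ.
    by rewrite /conjg; congr pair; rewrite /= ?mul1g ?mulVg.
  suff <- : fst_morphism sT rT @* H = S by exact: dvdn_morphim.
  apply/setP => y; apply/morphimP/idP => [[z _ zH ->] /=|yS].
    by have := subsetP sH _ zH; rewrite inE => /andP[].
  by have [a aH] := h1 _ yS; exists (y, a); rewrite ?inE.
apply/subsetP => -[x a]; rewrite inE /= => /andP[xS aA].
have [y yH] := h2 _ aA; have yS : y \in S.
  by have := subsetP sH _ yH; rewrite inE => /andP[].
have -> : (x, a) = (x * y^-1, 1) * (y, a).
  by congr pair; rewrite /= ?mulgKV ?mul1g.
by rewrite groupM // full // groupM ?groupV.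
Qed.

(** The image of the first factor is normal of order [#|S|], so [normal_fiber] identifies it with
    the first factor. The image of [(1, a)] commutes with it, so its first component is central in
    [S], hence trivial. *)
Lemma prod_automorphism (alpha : {morphism setX S A >-> sT * rT}) :
  'Z(S) = 1 -> 'injm alpha -> alpha @* setX S A \subset setX S A ->
  exists beta : {morphism S >-> sT}, [/\ 'injm beta, beta @* S \subset S &
    forall x a, x \in S -> a \in A -> beta x = (alpha (x, a)).1].
Proof.
move=> Z1 inj sub.
have imG : alpha @* setX S A = setX S A by apply/eqP; rewrite eqEcard sub card_injm ?leqnn.
have inG x a : x \in S -> a \in A -> (x, a) \in setX S A by move=> xS aA; rewrite inE /= xS.
have S1sub : setX S 1 \subset setX S A.
  by apply/subsetP => z; rewrite !inE => /andP[-> /eqP->]; rewrite group1.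
pose H := (alpha @* setX S 1)%G.
have sH : H \subset setX S A by apply: subset_trans sub; apply: morphimS.
have cH : #|H| = #|S| by rewrite card_injm // cardsX cards1 muln1.
have full x : x \in S -> (x, 1) \in H.
  apply: normal_fiber => //.
    move=> y h yH hS.
    suff -> : (y ^ h, 1) = (y, 1) ^ (h, 1) :> sT * rT.
      have : (h, 1) \in alpha @* setX S A by rewrite imG inG ?group1.
      case/morphimP => w wG _ ->; case/morphimP: yH => v vG v1 ->.
      rewrite -morphJ //; apply: mem_morphim; first by rewrite groupJ.
      move: v1 wG; rewrite !inE => /andP[vS /eqP v2] /andP[w1 w2].
      rewrite -[(v ^ w).1]/(v.1 ^ w.1) -[(v ^ w).2]/(v.2 ^ w.2).
      by rewrite v2 conj1g eqxx groupJ.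
    by rewrite /conjg; congr pair; rewrite /= ?mul1g ?mulg1 ?mulVg ?invg1.
  by rewrite cH.
have HE : H :=: setX S 1.
  apply/esym/eqP; rewrite eqEcard cH cardsX cards1 muln1 leqnn andbT.
  by apply/subsetP => -[x a]; rewrite inE => /andP[/= xS /set1P ->]; apply: full.
have a1 x : x \in S -> alpha (x, 1) \in setX S 1.
  move=> xS; rewrite -HE; apply: mem_morphim; first exact: inG.
  by rewrite inE /= xS group1.
pose beta x := (alpha (x, 1)).1.
have bM : {in S &, {morph beta : x y / x * y}}.
  move=> x y xS yS; rewrite /beta.
  have -> : (x * y, 1) = (x, 1) * (y, 1) :> sT * rT by congr pair; rewrite /= mulg1.
  by rewrite morphM ?inG.
exists (Morphism bM); split.
- apply/injmP => x y xS yS /= e; suff : (x, 1 : rT) = (y, 1) by case.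
  apply: (injmP inj); rewrite ?inG //.
  move: (a1 _ xS) (a1 _ yS) e; rewrite !inE /beta.
  by case: (alpha _) => ? ?; case: (alpha _) => ? ? /= /andP[_ /eqP->] /andP[_ /eqP->] ->.
- by apply/subsetP => _ /morphimP[x _ xS ->] /=; have := a1 _ xS; rewrite inE => /andP[].
move=> x a xS aA /=; rewrite /beta.
have -> : (x, a) = (x, 1) * (1, a) by congr pair; rewrite /= ?mulg1 ?mul1g.
rewrite morphM ?inG //=; suff -> : (alpha (1, a)).1 = 1 by rewrite mulg1.
have aG : alpha (1, a) \in setX S A by rewrite (subsetP sub) // mem_morphim ?inG.
suff : (alpha (1, a)).1 \in 'Z(S) by rewrite Z1 => /set1P.
apply/centerP; split; first by move: aG; rewrite inE => /andP[].
move=> y yS; have : (y, 1) \in H by apply: full.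
case/morphimP => v vG; rewrite inE => /andP[v1 /set1P v2] e.
have ey : y = (alpha v).1 by rewrite -e.
rewrite ey /commute; have : alpha (1, a) * alpha v = alpha v * alpha (1, a).
  rewrite -!morphM ?inG //; congr (alpha _).
  case: v v2 {vG v1 e ey} => v1 v2 /= ->; congr pair; rewrite /= ?mulg1 ?mul1g //.
by move/(congr1 fst).
Qed.

End DirectProducts.

(** * The mix as a coset geometry over [Q] *)

Section Mix.
Variables (sT : finGroupType) (S : {group sT}) (s1 s2 s3 : sT).
Variables (Q : polytope 4) (Phi : {set Q}).
Hypotheses (regQ : regular Q) (fPhi : Phi \in flags Q).
Notation r := (rho Phi).
Notation Gp := (rotation_group Phi).
Notation face i := (flag_face Phi i).
Hypothesis index_rot : #|Aut_polytope Q : Gp|%g = 2.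
Hypotheses (o1 : #[r 0 * r 1]%g = 5) (o2 : #[r 1 * r 2]%g = 3) (o3 : #[r 2 * r 3]%g = 4).
Hypothesis simpleS : forall N : {group sT}, (N <| S)%g -> N :!=: 1%g -> N :=: S.
Hypothesis not_dvd : ~~ (#|S| %| #|Gp|).
Hypothesis genS : <<[set s1; s2; s3]>>%g = S.
Local Open Scope group_scope.
Hypotheses (s1_5 : s1 ^+ 5 = 1) (s2_3 : s2 ^+ 3 = 1) (s3_4 : s3 ^+ 4 = 1).
Hypotheses (s12_2 : (s1 * s2) ^+ 2 = 1) (s23_2 : (s2 * s3) ^+ 2 = 1)
  (s123_2 : (s1 * s2 * s3) ^+ 2 = 1).
Hypothesis no_aut : forall beta : {morphism S >-> sT}, 'injm beta -> beta @* S \subset S ->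
  beta s1 = s1 -> beta s3 = s3^-1 -> False.

Let gT : finGroupType := (sT * {perm Q})%type.
Let G : {group gT} := setX_group S Gp.

(* The sigma_i of the cover are t 0 / t 1, t 1 / t 2 and t 2 / t 3. *)
Definition tau j : sT := nth 1 [:: s1 * s2 * s3; s2 * s3; s3] j.
(** The odd [r j] is paired with the reference reflection [r 3], which cancels in quotients:
    [t j / t k] projects to [r j * r k]. *)
Definition mix_gen j : gT := (tau j, r j * r 3).
Notation t := mix_gen.

(* For 0 < i <= 4, mix_x i and mix_c i generate all t j / t k with j, k <> i - 1:
   mix_stab i is the stabilizer of the base face of rank i - 1 of the cover. *)
Definition mix_x i : gT := if (i <= 2)%N then t 2 else t 0 * (t 1)^-1.
Definition mix_c i : gT := if odd i then t 1 else t 0 * (t 2)^-1.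

Definition mix_stab i : {group gT} :=
  if 0 < i <= 4 then <<[set mix_x i; mix_c i]>>%G else G.
Notation K := mix_stab.

Lemma s_in : [/\ s1 \in S, s2 \in S & s3 \in S].
Proof. by rewrite -genS !mem_gen // !inE eqxx ?orbT. Qed.

Lemma t3 : t 3 = 1.
Proof. by rewrite /mix_gen rho2. Qed.

Lemma t_div i j : i < 4 -> j < 4 -> (t i * (t j)^-1).2 = r i * r j.
Proof.
move=> hi hj; rewrite /= invgM !rhoV // -mulgA (mulgA (r 3)) rho2 // mul1g.
by [].
Qed.

Lemma t_in j : j < 4 -> t j \in G.
Proof.
move=> hj; have [i1 i2 i3] := s_in; rewrite inE /= rho_pair // andbT.
by case: j hj => [|[|[|[|]]]] //= _; rewrite ?group1 // ?groupM // groupM.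
Qed.

Lemma t1_2 : t 1 * t 1 = 1.
Proof.
apply: pair_eq1; rewrite /= -?[_ * _ * (_ * _)]expg2 //.
by rewrite expg2 {2}rhoC // mulgA -(mulgA (r 1)) rho2 // mulg1 rho2.
Qed.

Lemma t0_2 : t 0 * t 0 = 1.
Proof.
apply: pair_eq1; rewrite /= -?[_ * _ * (_ * _)]expg2 //.
by rewrite expg2 {2}rhoC // mulgA -(mulgA (r 0)) rho2 // mulg1 rho2.
Qed.

Lemma t02_2 : (t 0 * (t 2)^-1) * (t 0 * (t 2)^-1) = 1.
Proof.
apply: pair_eq1; first by rewrite /= mulgK -expg2.
rewrite -[LHS]/((t 0 * (t 2)^-1).2 * (t 0 * (t 2)^-1).2) t_div //.
by rewrite {2}rhoC // mulgA -(mulgA (r 0)) rho2 // mulg1 rho2.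
Qed.

Lemma t2_4 : t 2 ^+ 4 = 1.
Proof. by apply: pair_eq1; rewrite ?fstX ?sndX //=; have := expg_order (r 2 * r 3); rewrite o3. Qed.

Lemma t12_3 : (t 1 * (t 2)^-1) ^+ 3 = 1.
Proof.
apply: pair_eq1; rewrite ?fstX ?sndX; first by rewrite /= mulgK.
by rewrite t_div //; have := expg_order (r 1 * r 2); rewrite o2.
Qed.

Lemma t01_5 : (t 0 * (t 1)^-1) ^+ 5 = 1.
Proof.
apply: pair_eq1; rewrite ?fstX ?sndX; last first.
  by rewrite t_div //; have := expg_order (r 0 * r 1); rewrite o1.
by rewrite /= invgM -!mulgA mulKVg mulgV mulg1.
Qed.

(* The relations between mix_x i and mix_c i define an octahedral, dihedral or
   dodecahedral rotation group, which is already the image in Gp. *)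
Lemma mix_injm i : 0 < i <= 4 -> {in K i &, injective snd}.
Proof.
move=> hi; rewrite /K hi.
pose fm := restrm (subsetT <<[set mix_x i; mix_c i]>>) (snd_morphism sT {perm Q}).
suff /injmP : 'injm fm by [].
have i4 : [\/ i = 1, i = 2, i = 3 | i = 4]%N.
  by move: hi; case: i {fm} => [|[|[|[|[|]]]]] //; [constructor 1|constructor 2|constructor 3|constructor 4].
have cV (c x : gT) : c * c = 1 -> (c * x) * (c * x) = 1 -> c * x * c = x^-1.
  by move=> c2 cx; apply/eqP; rewrite eq_mulgV1 invgK -mulgA cx.
have braid1 (c x : gT) : c * c = 1 -> (c * x^-1) ^+ 3 = 1 -> c * x * c = x^-1 * c * x^-1.
  move=> c2 e; have cE : c^-1 = c by apply/eqP; rewrite eq_sym eq_mulgV1 invgK c2.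
  apply: (mulgI c); rewrite !mulgA c2 mul1g; apply/eqP.
  rewrite eq_sym eq_mulgV1 invgM cE -!mulgA; apply/eqP.
  by rewrite -e !expgS expg0 mulg1 !mulgA.
have braid2 (c x : gT) : c * c = 1 -> (x^-1 * c) ^+ 3 = 1 -> c * x * c = x^-1 * c * x^-1.
  move=> c2 e; have cE : c^-1 = c by apply/eqP; rewrite eq_sym eq_mulgV1 invgK c2.
  apply: (mulIg c); rewrite -!mulgA c2 mulg1; apply/eqP.
  rewrite eq_sym eq_mulgV1 invgM cE -!mulgA; apply/eqP.
  by rewrite -e !expgS expg0 mulg1 !mulgA.
case: i4 => ei; rewrite {}/fm {}ei {hi}.
- apply: injm_octahedral.
  + exact: t1_2.
  + by apply: braid1; [exact: t1_2|exact: t12_3].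
  + exact: t2_4.
  + exact: o3.
  exact: (etrans (congr1 order (@t_div 1 2 isT isT)) o2).
- apply: (@injm_dihedral _ _ _ _ _ _ 4).
  + exact: t02_2.
  + apply: cV => //; first exact: t02_2.
    by rewrite -[mix_x 2]/(t 2) mulgKV t0_2.
  + exact: t2_4.
  + exact: o3.
  (* Powers of [r 2 * r 3] fix the base vertex, whereas [r 0 * r 2] moves it. *)
  have fx : (r 2 * r 3) (face 1) = face 1 by rewrite permM !rho_fix.
  apply/negP => h; have {h}/cycleP[k e] : r 0 * r 2 \in <[r 2 * r 3]>.
    by rewrite -[r 0 * r 2](@t_div 0 2 isT isT); exact: h.
  have /eqP := rho_move regQ fPhi (isT : 0 < 4).
  apply; apply: (@perm_inj _ (r 2)); rewrite -permM e rho_fix //.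
  by elim: k {e} => [|k IH]; rewrite ?perm1 // expgS permM fx.
- apply: (@injm_dihedral _ _ _ _ _ _ 5).
  + exact: t1_2.
  + apply: cV => //; first exact: t1_2.
    rewrite -[mix_x 3]/(t 0 * (t 1)^-1) -[mix_c 3]/(t 1).
    apply: (mulgI (t 1)^-1); rewrite mulg1 !mulgA mulVg mul1g.
    by rewrite mulgKV -mulgA mulgA t0_2 mul1g.
  + exact: t01_5.
  + exact: (etrans (congr1 order (@t_div 0 1 isT isT)) o1).
  (* Powers of [r 0 * r 1] fix the base facet, whereas [r 1 * r 3] moves it. *)
  have fx : (r 0 * r 1) (face 4) = face 4 by rewrite permM !rho_fix.
  apply/negP => h; have {h}/cycleP[k e] : r 1 * r 3 \in <[r 0 * r 1]>.
    by rewrite -[r 0 * r 1](@t_div 0 1 isT isT); exact: h.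
  have /eqP := rho_move regQ fPhi (isT : 3 < 4).
  apply; have -> : face 4 = r 1 (face 4) by rewrite rho_fix.
  rewrite -permM e rho_fix //.
  by elim: k {e} => [|k IH]; rewrite ?perm1 // expgS permM fx.
apply: injm_dodecahedral.
- exact: t02_2.
- apply: braid2; first exact: t02_2.
  rewrite -[mix_x 4]/(t 0 * (t 1)^-1) -[mix_c 4]/(t 0 * (t 2)^-1) invgM invgK.
  by rewrite -mulgA mulKg t12_3.
- exact: t01_5.
- exact: (etrans (congr1 order (@t_div 0 1 isT isT)) o1).
rewrite (_ : (mix_x 4)^-1 * mix_c 4 = t 1 * (t 2)^-1).
  exact: (etrans (congr1 order (@t_div 1 2 isT isT)) o2).
by rewrite /mix_x /mix_c /= invgM invgK -mulgA mulKg.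
Qed.

Lemma mix_pair i j k : 0 < i <= 4 -> j < 4 -> k < 4 -> j.+1 <> i -> k.+1 <> i ->
  t j * (t k)^-1 \in K i.
Proof.
move=> hi hj hk ji ki; rewrite /K hi.
have mx : mix_x i \in <<[set mix_x i; mix_c i]>> by rewrite mem_gen ?set21.
have mc : mix_c i \in <<[set mix_x i; mix_c i]>> by rewrite mem_gen ?set22.
pose b := if i == 4 then t 2 else 1.
suff h l : l < 4 -> l.+1 <> i -> t l * b^-1 \in <<[set mix_x i; mix_c i]>>.
  have -> : t j * (t k)^-1 = (t j * b^-1) * (t k * b^-1)^-1.
    by rewrite invgM invgK mulgA mulgKV.
  by rewrite groupM ?groupV ?h.
have t0E : (t 0)^-1 = t 0 by apply/eqP; rewrite eq_sym eq_mulgV1 invgK t0_2.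
move: hi mx mc; rewrite /b {b ji ki}; case: i => [|[|[|[|[|]]]]] //= _;
rewrite /mix_x /mix_c /= ?invg1 => mx mc; case: l => [|[|[|[|]]]] //= _ _; rewrite ?mulg1 ?t3 ?group1 //.
- by have := groupM mc mx; rewrite mulgKV.
- by have := groupM mx mc; rewrite mulgKV.
- have -> : t 1 * (t 2)^-1 = (t 0 * (t 1)^-1)^-1 * (t 0 * (t 2)^-1).
    by rewrite invgM invgK -mulgA mulKg.
  by rewrite groupM ?groupV.
by rewrite mulgV group1.
Qed.

(** By [rotation_stab], [h] is a word in pairs of reflections outside [I]; the same word in the
    quotients [t j / t k] lies in all the stabilizers at once. *)
Lemma mix_lift (I : pred nat) h : h \in Gp ->
  (forall i, i < 4 -> I i -> h (face i.+1) = face i.+1) ->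
  exists2 k, k.2 = h & forall i, i < 4 -> I i -> k \in K i.+1.
Proof.
move=> hG hI; have := rotation_stab regQ fPhi index_rot hG hI.
pose X := [set t jk.1 * (t jk.2)^-1 | jk : 'I_4 * 'I_4 & ~~ I jk.1 && ~~ I jk.2].
have -> : rho_pairs Phi I = snd_morphism sT {perm Q} @* X.
  apply/setP => g; apply/imsetP/morphimP => [[jk jkI ->]|[z _ /imsetP[jk jkI ->] ->]].
    exists (t jk.1 * (t jk.2)^-1); rewrite ?inE //; first by apply: imset_f.
    by rewrite [RHS]t_div.
  by exists jk => //; rewrite [LHS]t_div.
rewrite -morphim_gen ?subsetT // => /morphimP[k _ kX ->]; exists k => // i hi Ii.
move: k kX; apply/subsetP; rewrite gen_subG; apply/subsetP => _ /imsetP[[j k] + ->].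
rewrite inE /= => /andP[jI kI]; apply: mix_pair => //.
  by case=> e; rewrite e Ii in jI.
by case=> e; rewrite e Ii in kI.
Qed.

Lemma mix_sub i : K i \subset G.
Proof.
rewrite /K; case: ifP => // hi; rewrite gen_subG; apply/subsetP => z.
have td j k : j < 4 -> k < 4 -> t j * (t k)^-1 \in G by move=> *; rewrite groupM ?groupV ?t_in.
by rewrite /mix_x /mix_c => /set2P[]->; case: ifP => _; rewrite ?td ?t_in.
Qed.

Lemma mix_rot i g : g \in K i -> g.2 \in Gp.
Proof. by move/(subsetP (mix_sub i)); rewrite inE => /andP[]. Qed.

Lemma mix_fix i g : 0 < i <= 4 -> g \in K i -> g.2 (face i) = face i.
Proof.
move=> hi; rewrite /K hi => gK.
suff : snd_morphism sT {perm Q} g \in 'C[face i | 'P].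
  by move/astab1P.
have : snd_morphism sT {perm Q} g \in snd_morphism sT {perm Q} @* <<[set mix_x i; mix_c i]>>.
  by apply: mem_morphim; rewrite ?inE.
apply/subsetP; rewrite morphim_gen ?subsetT // gen_subG.
apply/subsetP => _ /morphimP[z _ /set2P zE ->]; apply/astab1P.
suff : z.2 (face i) = face i by [].
have f1 j : j < 4 -> i <= 5 -> i <> j.+1 -> i <> 4 -> (t j).2 (face i) = face i.
  by move=> *; rewrite permM !rho_fix.
have f2 j k : j < 4 -> k < 4 -> i <= 5 -> i <> j.+1 -> i <> k.+1 ->
    (t j * (t k)^-1).2 (face i) = face i.
  by move=> *; rewrite t_div // permM !rho_fix.
move: hi zE f1 f2; rewrite /mix_x /mix_c {gK}.
case: i => [|[|[|[|[|]]]]] //= _ [] -> f1 f2; by [apply: f1 | apply: f2].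
Qed.

(** [mix_lift] gives an element of both stabilizers above [g.2]; it equals [g] because [snd] is
    injective on [K i]. *)
Lemma mix_meet i j g : 0 < i <= 4 -> 0 < j <= 4 -> g \in K i ->
  g.2 (face j) = face j -> g \in K j.
Proof.
move=> hi hj gK gj; have gi := mix_fix hi gK.
have [k ek kK] : exists2 k : gT, k.2 = g.2 &
    forall l, l < 4 -> pred2 i.-1 j.-1 l -> k \in K l.+1.
  apply: mix_lift; first exact: mix_rot gK.
  by move=> l hl /orP[]/eqP->; rewrite prednK //; lia.
have ki : k \in K i by have := kK i.-1; rewrite /= eqxx prednK; [apply; lia|lia].
have kj : k \in K j by have := kK j.-1; rewrite /= eqxx orbT prednK; [apply; lia|lia].
by rewrite -(mix_injm hi ki gK ek).
Qed.

(** Three faces leave at least one of the four proper ranks free, as [rotation_chain] requires. *)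
Lemma mix_trans i F H : 0 < i <= 4 ->
  (face i >=< F)%O -> (face i >=< H)%O -> (F >=< H)%O ->
  exists2 g, g \in K i & g.2 (face (rk F)) = F /\ g.2 (face (rk H)) = H.
Proof.
move=> hi iF iH FH.
have [l hl [l1 l2 l3]] : exists2 l, l < 4 & [/\ i <> l.+1, rk F <> l.+1 & rk H <> l.+1].
  have [/existsP[l /and3P[/eqP a /eqP b /eqP c]]|no] :=
    boolP [exists l : 'I_4, [&& i != l.+1, rk F != l.+1 & rk H != l.+1]].
    by exists l; rewrite ?ltn_ord.
  have n' l : l < 4 -> [|| i == l.+1, rk F == l.+1 | rk H == l.+1].
    by move=> hl; have := existsPn no (Ordinal hl); rewrite -!negb_or negbK.
  by have := n' 0 isT; have := n' 1%N isT; have := n' 2 isT; have := n' 3 isT; lia.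
have rki : rk (face i) = i by rewrite rk_flag_face //; lia.
have ch : chain [set face i; F; H].
  apply/chainP => x y; rewrite !inE => /orP[/orP[]|]/eqP-> /orP[/orP[]|]/eqP->;
  by rewrite ?comparablexx // comparable_sym.
have [|g gG gC] := rotation_chain regQ fPhi ch hl.
  by move=> x; rewrite !inE => /orP[/orP[]|]/eqP->; rewrite ?rki.
have [k ek kK] : exists2 k : gT, k.2 = g & forall l, l < 4 -> pred1 i.-1 l -> k \in K l.+1.
  apply: mix_lift => // j hj /eqP->; rewrite prednK; last by lia.
  by have := gC (face i); rewrite rki; apply; rewrite !inE eqxx.
exists k; first by have := kK i.-1; rewrite /= eqxx prednK; [apply; lia|lia].
by rewrite ek !gC // !inE eqxx ?orbT.
Qed.

Lemma mix_generate : G \subset <<\bigcup_(i < 6 | 0 < i <= 4) K i>>.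
Proof.
pose H := <<\bigcup_(i < 6 | 0 < i <= 4) K i>>%G.
have sH : H \subset setX S Gp.
  rewrite gen_subG; apply/bigcupsP => i _; exact: mix_sub.
have KH i z : 0 < i <= 4 -> z \in K i -> z \in H.
  move=> hi zK; apply: mem_gen; have hi6 : i < 6 by lia.
  by apply/bigcupP; exists (Ordinal hi6).
have tt j k : j < 4 -> k < 4 -> t j * (t k)^-1 \in H.
  move=> hj hk; have [m hm [m1 m2]] : exists2 m, 0 < m <= 4 & j.+1 <> m /\ k.+1 <> m.
    have [m12|m12] := boolP ((j != 0) && (k != 0)); first by exists 1%N => //; lia.
    have [m3|m3] := boolP ((j != 1%N) && (k != 1%N)); first by exists 2 => //; lia.
    by exists 3 => //; lia.
  exact: KH hm (mix_pair hm hj hk m1 m2).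
have fstH : S \subset fst_morphism sT {perm Q} @* H.
  rewrite -genS gen_subG; apply/subsetP => z; rewrite !inE => hz.
  have [j [k [hj [hk ->]]]] : exists j k, j < 4 /\ (k < 4 /\ z = (t j * (t k)^-1).1).
    case/orP: hz => [/orP[]|]/eqP->; [exists 0, 1%N|exists 1%N, 2|exists 2, 3]; do 2 split=> //.
    - by rewrite /= invgM -!mulgA mulKVg mulgV mulg1.
    - by rewrite /= mulgK.
    by rewrite /= invg1 mulg1.
  by apply: (mem_morphim (fst_morphism sT {perm Q})); rewrite ?inE ?tt.
have sndH : Gp \subset snd_morphism sT {perm Q} @* H.
  rewrite gen_subG; apply/subsetP => _ /imsetP[i hi ->]; rewrite inE in hi.
  have h : i.-1 < 4 by have := ltn_ord i; lia.
  rewrite /sigma -t_div //.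
  by apply: (mem_morphim (snd_morphism sT {perm Q})); rewrite ?inE ?tt.
apply: (goursat simpleS not_dvd sH).
- by move=> x /(subsetP fstH)/morphimP[[y a] _ yH ->]; exists a.
by move=> a /(subsetP sndH)/morphimP[[y b] _ yH ->]; exists y.
Qed.

(** Otherwise [S] is abelian. Then [s1 ^+ 6 = (s1 * s2) ^+ 6 = 1] kills [s1], the other relations
    kill [s2], and [#|S|] divides 4, which divides [#|Gp|]. *)
Lemma mix_center : 'Z(S) = 1.
Proof.
have [->|nz] := eqVneq 'Z(S) 1 => //; have Z := simpleS (center_normal S) nz.
case/negP: not_dvd.
have [i1 i2 i3] := s_in.
have C : commute s1 s2 by move: i1; rewrite -Z => /centerP[_]; apply.
have s6 : s1 ^+ 6 = 1.
  have : (s1 * s2) ^+ 6 = 1 by rewrite (expgM _ 2 3) s12_2 expg1n.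
  by rewrite expgMn // (expgM s2 3 2) s2_3 expg1n mulg1.
have e1 : s1 = 1 by move: s6; rewrite expgS s1_5 mulg1.
have e2 : s2 = 1 by move: s12_2 s2_3; rewrite e1 mul1g (expgS s2 2) => ->; rewrite mulg1.
have -> : #|S| = #[s3].
  rewrite -genS e1 e2; suff -> : <<[set 1; 1; s3]>> = <[s3]> by [].
  apply/eqP; rewrite eqEsubset !gen_subG; apply/andP; split; apply/subsetP => z.
    by rewrite !inE => /orP[/orP[]|]/eqP->; rewrite ?group1 ?cycle_id.
  by move/set1P->; rewrite mem_gen // !inE eqxx orbT.
apply: (@dvdn_trans 4); first by rewrite order_dvdn s3_4.
by have := order_dvdG (rho_pair regQ fPhi (isT : 2 < 4) (isT : 3 < 4)); rewrite o3.
Qed.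

(** [g.2] fixes every face of the base flag, so it is trivial, and [snd] is injective on [K 1]. *)
Lemma mix_trivial g : (forall i, 0 < i <= 4 -> g \in K i) -> g = 1.
Proof.
move=> gK; have h1 : 0 < 1 <= 4 by [].
apply: (mix_injm h1); rewrite ?gK ?group1 //=.
have gA : g.2 \in Aut_polytope Q.
  by apply: (subsetP (rotation_sub regQ fPhi)); apply: mix_rot (gK 1%N isT).
apply: (aut_eq gA (group1 _) fPhi); rewrite imset_perm1; apply: flag_ext => //.
  exact: aut_flag.
move=> i hi; rewrite aut_flag_face //.
have [p|np] := boolP (0 < i <= 4); first exact: (mix_fix p (gK i p)).
rewrite -aut_flag_face //; have fl := aut_flag gA fPhi.
have [->|->] : i = 0%N \/ i = 5 by lia.
  exact: flag_face0.
exact: (@flag_facen 4).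
Qed.

Lemma mix_adj l l' m : l < 4 -> l' < 4 -> 0 < m <= 4 -> m <> l.+1 -> m <> l'.+1 ->
  rotation_lift Phi snd K m l l' (t l' * (t l)^-1).
Proof.
move=> hl hl' hm ml ml'; split => //; first by apply: mix_pair => //; exact/nesym.
by rewrite t_div // rhoM_flag ?rho_aut // rho_flag.
Qed.

Lemma mix_third l l' : l < 4 -> l' < 4 -> exists m, [/\ 0 < m <= 4, m <> l.+1 & m <> l'.+1].
Proof.
move=> hl hl'.
have [m12|m12] := boolP ((l != 0) && (l' != 0)); first by exists 1%N; split=> //; lia.
have [m3|m3] := boolP ((l != 1%N) && (l' != 1%N)); first by exists 2; split=> //; lia.
by exists 3; split=> //; lia.
Qed.

Lemma mix_order i : 0 < i < 4 -> #[t i.-1 * (t i)^-1] = nth 0 [:: 5; 3; 4] i.-1.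
Proof.
move=> hi; have h : i.-1 < 4 by lia.
have hi4 : i < 4 by lia.
have [m [hm m1 m2]] := mix_third h hi4.
have zK : t i.-1 * (t i)^-1 \in K m by apply: mix_pair => //; exact/nesym.
set z := _ * _ in zK *.
have ez k : z ^+ k = 1 <-> z.2 ^+ k = 1.
  rewrite -sndX; split=> [->//|e]; apply: (mix_injm hm); rewrite ?groupX ?group1 //.
have -> : #[z] = #[z.2].
  apply/eqP; rewrite eqn_dvd !order_dvdn -sndX expg_order eqxx andbT.
  by apply/eqP/ez; rewrite expg_order.
rewrite t_div //; move: hi; case: i {h hi4 zK ez m1 m2} @z => [|[|[|[|]]]] //.
Qed.

Lemma mix_rigid (alpha : {morphism G >-> gT}) : 'injm alpha -> alpha @* G \subset G ->
  alpha (t 0 * (t 1)^-1) = t 0 * (t 1)^-1 ->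
  alpha (t 2 * (t 3)^-1) = (t 2 * (t 3)^-1)^-1 -> False.
Proof.
move=> inj sub e1 e3; have [i1 i2 i3] := s_in.
have [beta [bi bs bE]] := prod_automorphism simpleS not_dvd mix_center inj sub.
have c1 : t 0 * (t 1)^-1 = (s1, r 0 * r 1).
  by congr pair; [rewrite /= invgM -!mulgA mulKVg mulgV mulg1 | exact: t_div].
have c3 : t 2 * (t 3)^-1 = (s3, r 2 * r 3) by rewrite t3 invg1 mulg1.
apply: (no_aut bi bs).
  by rewrite (bE _ (r 0 * r 1)) ?rho_pair // -c1 e1 c1.
by rewrite (bE _ (r 2 * r 3)) ?rho_pair // -c3 e3 c3.
Qed.

Theorem chiral_mix : exists (P : polytope 4) (pi : P -> Q),
    [/\ chiral P, has_type P [:: 5; 3; 4], Aut_polytope P \isog setX S Gp,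
    forall u : P, rk (pi u) = rk u &
    forall u w : P, (0 < rk u <= 4) || (0 < rk w <= 4) -> (u < w)%O ->
    [/\ {in [pred x : P | (u < x < w)%O] &, injective pi},
      forall x : P, (u < x < w)%O -> (pi u < pi x < pi w)%O,
      forall F : Q, (pi u < F < pi w)%O -> exists2 x : P, (u < x < w)%O & pi x = F &
      {in [pred x : P | (u < x < w)%O] &, forall x y, (pi x >=< pi y)%O = (x >=< y)%O}]].
Proof.
have fA (g : gT) : g \in G -> g.2 \in Aut_polytope Q.
  by rewrite inE => /andP[_]; apply: (subsetP (rotation_sub regQ fPhi)).
apply: (@chiral_cover 4 Q Phi gT G snd K fPhi _ fA _ mix_sub _ _ mix_fix mix_meet mix_trans
  mix_generate mix_trivial _ _ 3 [:: 5; 3; 4]%N) => //.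
- move=> l l' hl hl'; have [m [hm m1 m2]] := mix_third hl hl'.
  by exists m, (t l' * (t l)^-1); apply: mix_adj.
- move=> g l; rewrite inE => /andP[_ gG] hl e; have := rho_odd regQ fPhi index_rot hl.
  case/negP; suff -> : r l = g.2 by [].
  have gA := subsetP (rotation_sub regQ fPhi) _ gG.
  by apply: (aut_eq (rho_aut regQ fPhi hl) gA fPhi); rewrite e rho_flag.
(* With [l0 = 3], the reflection would fix the rotation sigma_1, which is [t 0 / t 1], and invert
   sigma_3, which is [t 2 / t 3]. *)
- move=> alpha inj sub fix1 inv3; apply: (mix_rigid inj sub).
    by apply: (fix1 0 1%N 3) => //; apply: mix_adj.
  by apply: (inv3 2 1%N) => //; apply: mix_adj.
move=> i hi; have h : i.-1 < 4 by lia.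
have hi4 : i < 4 by lia.
have [m [hm m1 m2]] := mix_third hi4 h.
exists m, (t i.-1 * (t i)^-1); split; first exact: mix_adj.
exact: mix_order.
Qed.

End Mix.

(** * The group L2(p): parameters, simplicity and order *)

Section Concrete.
Local Open Scope ring_scope.

Lemma GL2_surj (F : finFieldType) (M : 'M[F]_2) : \det M != 0 ->
  exists g : {'GL_2[F]}, GLval g = M.
Proof.
move=> dM; have uM : M \is a GRing.unit by rewrite -[_ \is a _]/(M \in unitmx) unitmxE unitfE.
by exists (FinRing.Unit uM).
Qed.

Lemma GL2_M (F : finFieldType) (g h : {'GL_2[F]}) : GLval (g * h)%g = GLval g *m GLval h.
Proof. exact: GL_MxE. Qed.

Lemma GL2_1 (F : finFieldType) : GLval (1%g : {'GL_2[F]}) = 1%:M.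
Proof. exact: GL_1E. Qed.

Lemma GL2_inj (F : finFieldType) : injective (@GLval 2 F).
Proof. exact: val_inj. Qed.

Lemma Fp_multiples p (x y : 'F_p) : x != 0 -> exists n, x *+ n = y.
Proof.
move=> nx; exists (val (y / x) : nat); rewrite -mulr_natr natr_Zp mulrC divfK //.
Qed.

Lemma card_SL2 (F : finFieldType) :
  #|SL2_of (@GLval 2 F)| = (#|F| * (#|F| ^ 2 - 1))%N.
Proof.
have q1 : (1 < #|F|)%N by apply: finNzRing_gt1.
have := card_GL_SL2 (@GL2_M F) (@GL2_1 F) (@GL2_surj F).
have -> : #|[set: {'GL_2[F]}]| = #|'GL_2[F]|%g by [].
rewrite card_GL_2 => e; apply/eqP; rewrite -(@eqn_pmul2r #|F|.-1) -?e; last by lia.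
apply/eqP; have -> : (#|F| ^ 2 - 1 = #|F|.-1 * #|F|.+1)%N.
  by case: #|F| q1 => // k _ /=; rewrite expnS expn1; lia.
by rewrite expnS expn1; lia.
Qed.

(** [f = (1 + q) / 4] solves the golden equation; then [4 s ^+ 2 = (1 - q) / 2], a quotient of two
    squares. *)
Lemma golden_parameters (F : fieldType) (q t r : F) : 2%:R != 0 :> F ->
  q ^+ 2 = 5%:R -> t ^+ 2 = 1 - q -> r ^+ 2 = 2%:R ->
  exists f s : F, 4%:R * f ^+ 2 = 2%:R * f + 1 /\ 4%:R * s ^+ 2 = 1 - 2%:R * f.
Proof.
move=> n2 hq ht hr; have n4 : 4%:R != 0 :> F by rewrite -[4%N]/(2 * 2)%N natrM mulf_neq0.
have nr : r != 0 by apply: contraNneq n2 => e; rewrite -hr e expr0n.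
exists ((1 + q) / 4%:R), (t / (2%:R * r)); split.
  have -> : 4%:R * ((1 + q) / 4%:R) ^+ 2 = (1 + 2%:R * q + q ^+ 2) / 4%:R by field.
  by rewrite hq; field.
have -> : 4%:R * (t / (2%:R * r)) ^+ 2 = t ^+ 2 / r ^+ 2.
  by field; rewrite ?n2 ?nr.
by rewrite ht hr; field; rewrite ?n2 ?n4.
Qed.

(** A number up to 30 with such a residue is 1 or 9, not a prime; modulo 8 the four residues become
    1, 1, 7, 7. *)
Lemma prime_mod40 p : prime p -> (p %% 40)%N \in [:: 1; 9; 31; 39]%N ->
  (30 < p)%N /\ ((p %% 8 == 1) || (p %% 8 == 7))%N.
Proof.
move=> pp hp; have [p31|p31] := ltnP 30 p; last first.
  have : p \in [:: 1; 9; 31; 39]%N by rewrite -(modn_small (m := p) (d := 40)) //; lia.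
  by rewrite !inE => /or4P[]/eqP e; move: pp p31; rewrite e.
split=> //; rewrite -(modn_dvdm p (isT : 8 %| 40)%N).
by move: hp; rewrite !inE => /or4P[]/eqP->.
Qed.

Lemma L2_generators p (sqrt5 : 'F_p) : prime p -> (p %% 40)%N \in [:: 1; 9; 31; 39]%N ->
  sqrt5 ^+ 2 = 5%:R ->
  (exists t : 'F_p, t ^+ 2 = 1 + sqrt5) \/ (exists t : 'F_p, t ^+ 2 = 1 - sqrt5) ->
  exists s1 s2 s3 : coset_of ('Z(SL2 p))%g,
  [/\ (<<[set s1; s2; s3]>> = L2 p)%g,
      [/\ s1 ^+ 5 = 1, s2 ^+ 3 = 1 & s3 ^+ 4 = 1]%g,
      [/\ (s1 * s2) ^+ 2 = 1, (s2 * s3) ^+ 2 = 1 & (s1 * s2 * s3) ^+ 2 = 1]%g &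
      forall beta : {morphism (L2 p) >-> coset_of ('Z(SL2 p))%g},
        ('injm beta)%g -> (beta @* (L2 p) \subset L2 p)%g ->
        beta s1 = s1 -> beta s3 = (s3^-1)%g -> False].
Proof.
move=> pp /(prime_mod40 pp)[p30 p8] h5 ht.
have [r hr] := sqrt2_Fp pp p8.
have n2 : 2%:R != 0 :> 'F_p by apply: (natF_neq0 pp (pchar_Fp pp) p30).
have [al [be hab]] := sum_squares_N1 n2.
(* Changing the sign of [sqrt5] if necessary, [1 - q] is the square. *)
have [q [t [hq e]]] : exists q t : 'F_p, q ^+ 2 = 5%:R /\ t ^+ 2 = 1 - q.
  case: ht => -[t e]; last by exists sqrt5, t.
  by exists (- sqrt5), t; rewrite sqrrN opprK.
have [f [s [hf hs]]] := golden_parameters n2 hq e hr.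
exact: (@PSL_generators 'F_p {'GL_2['F_p]} (@GLval 2 'F_p) (@GL2_1 _) (@GL2_M _) (@GL2_inj _)
  (@GL2_surj _) (@Fp_multiples p) p pp (pchar_Fp pp) p30 al be r f s hab hr hf hs).
Qed.

Lemma L2_simple p (N : {group coset_of ('Z(SL2 p))%g}) : prime p -> (30 < p)%N ->
  (N <| L2 p)%g -> N :!=: 1%g -> N :=: L2 p.
Proof.
move=> pp p30.
exact: (@PSL_normal_full 'F_p {'GL_2['F_p]} (@GLval 2 'F_p) (@GL2_1 _) (@GL2_M _) (@GL2_inj _)
  (@GL2_surj _) (@Fp_multiples p) p pp (pchar_Fp pp) p30 N).
Qed.

Lemma card_L2 p : prime p -> (30 < p)%N -> (2 * #|L2 p| = p * (p ^ 2 - 1))%N.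
Proof.
move=> pp p30.
have cZ : #|'Z(SL2 p)|%g = 2%N.
  exact: (@card_center 'F_p {'GL_2['F_p]} (@GLval 2 'F_p) (@GL2_1 _) (@GL2_M _) (@GL2_inj _)
    (@GL2_surj _) p pp (pchar_Fp pp) p30).
have cS : #|SL2 p| = (p * (p ^ 2 - 1))%N.
  by have := card_SL2 'F_p; rewrite card_Fp.
have := Lagrange (center_sub (SL2_group p)).
by rewrite -card_quotient ?normal_norm ?center_normal // cZ cS.
Qed.

End Concrete.

(** * Realizations of sections *)

Section SectionSpaces.
Import classical_sets functions topology normedtype.
Import numFieldNormedType.Exports.
Local Open Scope classical_set_scope.
Local Open Scope ring_scope.
Variables (R : realType).

(** Reindexing of coordinates along a partial map, with [v0] where it is undefined; this extends
    barycentric coordinates by zero outside an open interval. *)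
Definition coord_map (V : Type) (v0 : V) (T T' : choiceType) (e : T' -> option T)
  (x : {ptws T -> V}) : {ptws T' -> V} := fun F => oapp x v0 (e F).

Lemma coord_map_continuous (V : topologicalType) (v0 : V) (T T' : choiceType)
    (e : T' -> option T) :
  continuous (coord_map v0 e).
Proof.
have cont F : continuous (fun x : {ptws T -> V} => coord_map v0 e x F).
  rewrite /coord_map; case: (e F) => [z|] /=; last exact: cst_continuous.
  exact: (@proj_continuous T (fun=> V) z).
move=> x; apply/cvg_sup; first exact/fmap_filter/nbhs_filter.
move=> F; move: x.
apply/(@continuousP _ (initial_topology (@^~ F))) => A [B oB <-].
by move: B oB; apply/continuousP; exact: cont.
Qed.

Lemma homeomorphic_comp (X Y Z : topologicalType) (A : set X) (B : set Y) (C : set Z)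
    (f : X -> Y) (g : Y -> X) : continuous f -> continuous g ->
  (forall x, A x -> B (f x) /\ g (f x) = x) ->
  (forall y, B y -> A (g y) /\ f (g y) = y) ->
  homeomorphic B C -> homeomorphic A C.
Proof.
move=> cf cg hA hB [f' [g' [cf' cg' hf' hg']]].
exists (f' \o f), (g \o g'); split.
- apply/subspace_continuousP => x Ax.
  have [Bfx _] := hA _ Ax.
  have /subspace_continuousP/(_ _ Bfx) := cf'; apply: cvg_comp.
  move=> W BW; apply: (@filterS _ (nbhs x) _ _ _ _ (cf x _ BW)) => y h Ay.
  by apply: h; have [] := hA _ Ay.
- move=> y; apply: (@continuous_comp (subspace C) Y X g' g); first exact: cg'.
  exact: cg.
- move=> x Ax /=; have [Bfx e] := hA _ Ax; have [Cf e'] := hf' _ Bfx.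
  by rewrite e' e.
move=> z Cz /=; have [Bg e] := hg' _ Cz; have [Ag e'] := hB _ Bg.
by rewrite e' e.
Qed.

(** Barycentric coordinates vanish outside the open intervals, so reindexing along [phi] and its
    partial inverse gives mutually inverse continuous maps of the two spaces. *)
Lemma section_space_iso n m (P : polytope n) (Q : polytope m) (u w : P) (u' w' : Q)
    (phi : P -> Q) :
  {in [pred x : P | (u < x < w)%O] &, injective phi} ->
  (forall x : P, (u < x < w)%O -> (u' < phi x < w')%O) ->
  (forall F : Q, (u' < F < w')%O -> exists2 x : P, (u < x < w)%O & phi x = F) ->
  {in [pred x : P | (u < x < w)%O] &, forall x y, (phi x >=< phi y)%O = (x >=< y)%O} ->
  forall C : set 'rV[R]_3,
  homeomorphic (@section_space R m Q u' w') C -> homeomorphic (@section_space R n P u w) C.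
Proof.
move=> inj phi_in phi_surj phi_comp C.
pose e (F : Q) : option P := [pick x : P | (u < x < w)%O && (phi x == F)].
pose e' (x : P) : option Q := if (u < x < w)%O then Some (phi x) else None.
have eP x : (u < x < w)%O -> e (phi x) = Some x.
  move=> hx; rewrite /e; case: pickP => [y /andP[hy /eqP]|/(_ x)]; last by rewrite hx eqxx.
  by move/inj => -> //; rewrite ?inE.
have eN F : ~~ (u' < F < w')%O -> e F = None.
  move=> hF; rewrite /e; case: pickP => // y /andP[/phi_in h /eqP eF].
  by rewrite -eF h in hF.
have sumE (x : P -> R) : (forall H, x H != 0 -> (u < H < w)%O) ->
    \sum_F oapp x 0 (e F) = \sum_H x H.
  move=> hx.
  rewrite (bigID (fun F : Q => (u' < F < w')%O)) /= addrC big1 ?add0r; last first.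
    by move=> F /eN ->.
  rewrite [RHS](bigID (fun H : P => (u < H < w)%O)) /= [RHS]addrC.
  rewrite [X in _ = X + _]big1 ?add0r; last first.
    by move=> H nH; case: (eqVneq (x H) 0) => // /hx hh; rewrite hh in nH.
  rewrite (reindex_onto phi (fun F => odflt u (e F))) /=; last first.
    by move=> F /phi_surj[y hy <-]; rewrite eP.
  apply: eq_big => y.
    apply/andP/idP => [[h1 /eqP h2]|hy]; last by rewrite phi_in // eP //= eqxx.
    by have [z hz ez] := phi_surj _ h1; rewrite -h2 -ez eP.
  case/andP => h1 /eqP h2; have [z hz ez] := phi_surj _ h1.
  have -> : y = z by rewrite -h2 -ez eP.
  by rewrite eP.
apply: (@homeomorphic_comp _ _ _ _ _ _ (coord_map 0 e) (coord_map 0 e')).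
- exact: coord_map_continuous.
- exact: coord_map_continuous.
- move=> x [h1 h2 h3 h4]; split; last first.
    apply/funext => H; rewrite /coord_map /e'.
    case: ifPn => hH /=; first by rewrite eP.
    by apply/esym/eqP; apply: contraNT hH; apply: h3.
  split; rewrite /coord_map.
  + by move=> F; case: (e F).
  + by rewrite sumE.
  + by move=> F; apply: contraNT => /eN ->; rewrite eqxx.
  have hN F : oapp x 0 (e F) != 0 -> exists2 y, (u < y < w)%O & phi y = F /\ x y != 0.
    move=> nz; have /phi_surj[y hy ey] : (u' < F < w')%O.
      by apply: contraNT nz => /eN ->; rewrite eqxx.
    by exists y => //; split=> //; move: nz; rewrite -ey eP.
  move=> F G /hN[y hy [<- ny]] /hN[z hz [<- nz]].
  by rewrite phi_comp ?inE //; apply: h4.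
move=> y [h1 h2 h3 h4]; split; last first.
  apply/funext => F; rewrite /coord_map /e'.
  have [hF|hF] := boolP (u' < F < w')%O.
    by have [z hz <-] := phi_surj _ hF; rewrite eP //= hz.
  rewrite eN //=; apply/esym/eqP; apply: contraNT hF; exact: h3.
have hx H : oapp y 0 (e' H) != 0 -> (u < H < w)%O.
  by rewrite /e'; case: ifP => //; rewrite eqxx.
split; rewrite /coord_map.
- by move=> H; rewrite /e'; case: ifP => /=.
- rewrite -(sumE (fun H => oapp y 0 (e' H)) hx) -h2; apply: eq_bigr => F _.
  have [hF|hF] := boolP (u' < F < w')%O.
    by have [z hz <-] := phi_surj _ hF; rewrite eP //= /e' hz.
  rewrite eN //=; apply/esym/eqP; apply: contraNT hF; exact: h3.
- exact: hx.
move=> H K nH nK; have hH := hx _ nH; have hK := hx _ nK.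
move: nH nK; rewrite /e' hH hK /= => nH nK.
by rewrite -phi_comp ?inE //; apply: h4.
Qed.

End SectionSpaces.

Lemma rotation_order n (Q : polytope n) (Phi : {set Q}) ps i : regular Q -> Phi \in flags Q ->
  has_type Q ps -> 0 < i < n -> #[rho Phi i.-1 * rho Phi i]%g = nth 0 ps i.-1.
Proof.
move=> regQ fPhi [_ tyQ] hi; have [s /andP[sA /existsP[Psi /andP[a1 a2]]] <-] := tyQ _ _ fPhi hi.
have [h h1] : i.-1 < n /\ i < n by lia.
suff -> : s = (rho Phi i.-1 * rho Phi i)%g by [].
apply: (aut_eq sA _ fPhi); first by rewrite groupM ?rho_aut.
move: a1; rewrite adjacent_atE // => /eqP ePsi.
move: a2; rewrite ePsi adjacent_atE ?adj_flag // => /eqP ->.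
by rewrite rhoM_flag ?rho_aut // rho_flag.
Qed.

Local Open Scope ring_scope.

Theorem theorem7p3 (R : realType) (p : nat) (p_prime : prime p)
    (p_mod40 : (p %% 40)%N \in [:: 1; 9; 31; 39]%N)
    (sqrt5 : 'F_p) (sqrt5E : sqrt5 ^+ 2 = 5%:R)
    (square_mod_p : (exists t : 'F_p, t ^+ 2 = 1 + sqrt5) \/
                    (exists t : 'F_p, t ^+ 2 = 1 - sqrt5))
    (Q : polytope 4)
    (Q_spherical : locally_spherical R Q)
    (Q_regular : directly_regular Q)
    (Q_type : has_type Q [:: 5; 3; 4]%N)
    (Q_order : ~~ (p * (p ^ 2 - 1) %| #|Aut_polytope Q|)%N)
    (Phi : {set Q}) (Phi_flag : Phi \in flags Q) :
  exists P : polytope 4,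
    [/\ locally_spherical R P,
        chiral P,
        has_type P [:: 5; 3; 4]%N &
        Aut_polytope P \isog setX (L2 p) (rotation_group Phi)].
Proof.
have [p30 _] := prime_mod40 p_prime p_mod40.
have [regQ dirQ] := Q_regular; have ind := dirQ _ Phi_flag.
have ord i := @rotation_order 4 Q Phi _ i regQ Phi_flag Q_type.
(* [#|Aut_polytope Q|] and [p * (p ^ 2 - 1)] are twice the orders of the rotation group and of
   [L2 p]. *)
have ndvd : ~~ (#|L2 p| %| #|rotation_group Phi|)%N.
  apply: contra Q_order => d; rewrite -card_L2 //.
  have := Lagrange (rotation_sub regQ Phi_flag); rewrite ind => <-.
  by rewrite mulnC dvdn_mul.
have [s1 [s2 [s3 [gen [e1 e2 e3] [e12 e23 e123] noaut]]]] :=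
  L2_generators p_prime p_mod40 sqrt5E square_mod_p.
have simp N := @L2_simple p N p_prime p30.
have [P [pi [chP tyP isoP rkP secP]]] := chiral_mix regQ Phi_flag ind
  (ord 1%N isT) (ord 2 isT) (ord 3 isT) simp ndvd gen e1 e2 e3 e12 e23 e123 noaut.
exists P; split=> //; have [sph1 sph2] := Q_spherical.
have frP u : face_rank (pi u) = face_rank u by rewrite !face_rankE rkP.
(* A facet has a proper upper end and a vertex-figure a proper lower end, so [secP] identifies each
   with the corresponding section of [Q]. *)
split=> F G rF rG; have [kF kG] := (face_rankE F, face_rankE G).
  have [] := secP F G; first by move: rF rG; rewrite kF kG; lia.
    rewrite lt_neqAle rk0_least; last by move: rF; rewrite kF; lia.
    by rewrite andbT; apply/eqP => e; move: rF; rewrite e rG.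
  by move=> h1 h2 h3 h4; apply: (section_space_iso h1 h2 h3 h4); apply: sph1; rewrite frP.
have [] := secP F G; first by move: rF rG; rewrite kF kG; lia.
  rewrite lt_neqAle rkn_greatest; last by move: rG; rewrite kG; lia.
  by rewrite andbT; apply/eqP => e; move: rF; rewrite e rG.
by move=> h1 h2 h3 h4; apply: (section_space_iso h1 h2 h3 h4); apply: sph2; rewrite frP.
Qed.
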